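(* Let $\mathcal M$ be an $n$-dimensional smooth manifold with a smooth torsion-free connection $\nabla$, let $U\subset\mathcal M$ be open, and let $\Phi:U\to\mathbb{R}$ be smooth with a nondegenerate critical point at some $p\in U$. Then there is a neighborhood $\Omega$ of $p$ and a smooth second-order differential operator $\square$ on $\Omega$ such that $$\left(\frac{\partial}{\partial t}-\frac i2\,\square\right)\left[t^{-\frac n2}e^{it^{-1}(\Phi-\Phi(p))}\right]=0\quad\text{on }\Omega$$ for all $t>0$. Moreover, for all sufficiently small smooth perturbations $(\tilde\Phi,\tilde\nabla)$ of $(\Phi,\nabla)$ there continue to exist, on the same set $\Omega$, corresponding operators $\tilde\square$ such that $$\left(\frac{\partial}{\partial t}-\frac i2\,\tilde\square\right)\left[t^{-\frac n2}e^{it^{-1}(\tilde\Phi-\tilde\Phi(\tilde p))}\right]=0\quad\text{on }\Omega\text{ for all }t>0,$$ where $\tilde p$ is the critical point of $\tilde\Phi$ (near $p$). The operator $\square$ depends only on $\Phi$ and $\nabla$ (no coordinate choices are necessary) and varies smoothly as $\Phi$ and $\nabla$ vary.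
   Context: A small smooth perturbation of $(\Phi,\nabla)$ means a real-valued smooth function $\tilde\Phi$ and a smooth torsion-free connection $\tilde\nabla$ close to $\Phi$ and $\nabla$ in the $C^\infty$ topology (all derivatives, on compact sets). ''Smooth'' differential operator means one with $C^\infty$ coefficients. ''Varies smoothly'' means that the coefficients of $\square$ depend smoothly on $(\Phi,\nabla)$, e.g. along smooth finite-parameter families. *)

(* Defs.v *)
From HB Require Import structures.
From mathcomp Require Import all_boot all_order all_algebra.
From mathcomp Require Import all_classical all_reals all_analysis.
From mathcomp.real_closed Require Import complex.

Set Implicit Arguments.
Unset Strict Implicit.
Unset Printing Implicit Defensive.

Import Order.TTheory GRing.Theory Num.Theory.
Import numFieldNormedType.Exports.

Local Open Scope classical_set_scope.
Local Open Scope ring_scope.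
Local Open Scope complex_scope.

(* 'D_v1 ('D_v2 (... f)) for vs = [:: v1; v2; ...] *)
Definition iter_der (R : realType) (V W : normedModType R) (vs : seq V)
    (f : V -> W) : V -> W :=
  foldr (fun (v : V) (g : V -> W) (x : V) => 'D_v g x) f vs.

(* C^oo on an open set A; the values of f outside A are irrelevant. *)
Definition smooth_on (R : realType) (V W : normedModType R) (A : set V)
    (f : V -> W) : Prop :=
  forall (vs : seq V) (x : V), A x ->
    {for x, continuous (iter_der vs f)} /\
    forall v : V, derivable (iter_der vs f) x v.

Definition csmooth_on (R : realType) (V : normedModType R) (A : set V)
    (f : V -> R[i]) : Prop :=
  smooth_on A (fun x => complex.Re (f x) : R) /\
  smooth_on A (fun x => complex.Im (f x) : R).

Definition basisv (R : realType) (n : nat) (i : 'I_n) : 'rV[R]_n :=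
  delta_mx 0 i.

Definition pder (R : realType) (n : nat) (i : 'I_n) (f : 'rV[R]_n -> R)
    (x : 'rV[R]_n) : R :=
  'D_(basisv R i) f x.

Definition cpder (R : realType) (n : nat) (i : 'I_n) (f : 'rV[R]_n -> R[i])
    (x : 'rV[R]_n) : R[i] :=
  pder i (fun y => complex.Re (f y)) x +i* pder i (fun y => complex.Im (f y)) x.

Definition cderive1 (R : realType) (f : R -> R[i]) (t : R) : R[i] :=
  derive1 (fun s : R => complex.Re (f s) : R) t
    +i* derive1 (fun s : R => complex.Im (f s) : R) t.

(* A homeomorphism from the open set cdom onto an open subset of R^n; cmap and
   cinv are total functions, meaningless outside cdom and its image. *)
Record chart (R : realType) (n : nat) (M : topologicalType) := Chart {
  cdom : set M;
  cmap : M -> 'rV[R]_n;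
  cinv : 'rV[R]_n -> M;
  cdom_open : open cdom;
  cimg_open : open (cmap @` cdom);
  cmapK : forall q, cdom q -> cinv (cmap q) = q;
  cmap_continuous : forall q, cdom q -> {for q, continuous cmap};
  cinv_continuous : forall x, (cmap @` cdom) x -> {for x, continuous cinv}
}.

Definition coords (R : realType) (n : nat) (M : topologicalType)
    (c : chart R n M) (A : set M) : set 'rV[R]_n :=
  cmap c @` (cdom c `&` A).

Record manifold (R : realType) (n : nat) := Manifold {
  carrier :> topologicalType;
  manifold_hausdorff : hausdorff_space carrier;
  manifold_second_countable : @second_countable carrier;
  atlas : set (chart R n carrier);
  atlas_cover : forall q : carrier, exists2 c, atlas c & cdom c q;
  atlas_smooth : forall c d, atlas c -> atlas d ->
    smooth_on (coords c (cdom d)) (fun x => cmap d (cinv c x))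
}.

Definition smooth_map (R : realType) (n : nat) (M1 M2 : manifold R n)
    (A : set M1) (psi : M1 -> M2) : Prop :=
  (forall q, A q -> {for q, continuous psi}) /\
  forall c1 c2, atlas c1 -> atlas c2 ->
    smooth_on (coords c1 (A `&` psi @^-1` cdom c2))
              (fun x => cmap c2 (psi (cinv c1 x))).

Definition smooth_open_embedding (R : realType) (n : nat)
    (M1 M2 : manifold R n) (A : set M1) (psi : M1 -> M2) : Prop :=
  [/\ smooth_map A psi, open (psi @` A) &
      exists phi : M2 -> M1,
        (forall q, A q -> phi (psi q) = q) /\ smooth_map (psi @` A) phi].

Definition smooth_fun (R : realType) (n : nat) (M : manifold R n) (A : set M)
    (f : M -> R) : Prop :=
  forall c, atlas c -> smooth_on (coords c A) (fun x => f (cinv c x)).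

Definition csmooth_fun (R : realType) (n : nat) (M : manifold R n) (A : set M)
    (f : M -> R[i]) : Prop :=
  forall c, atlas c -> csmooth_on (coords c A) (fun x => f (cinv c x)).

(* G i j k x is the Christoffel symbol Gamma^k_{ij}(x), that is
   nabla_{d_i} d_j = \sum_k Gamma^k_{ij} d_k, and gamma_form G x u v is
   \sum_{i,j,k} Gamma^k_{ij}(x) u^i v^j d_k. *)
Definition gamma_form (R : realType) (n : nat)
    (G : 'I_n -> 'I_n -> 'I_n -> 'rV[R]_n -> R) (x u v : 'rV[R]_n) :
    'rV[R]_n :=
  \row_k \sum_i \sum_j G i j k x * u 0 i * v 0 j.

(* Invariance of the covariant derivative under the change of variables tau:
   Dtau (G1(u,v)) = D^2tau(u,v) + G2(Dtau u, Dtau v). *)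
Definition gamma_transform (R : realType) (n : nat) (A : set 'rV[R]_n)
    (tau : 'rV[R]_n -> 'rV[R]_n)
    (G1 G2 : 'I_n -> 'I_n -> 'I_n -> 'rV[R]_n -> R) : Prop :=
  forall x u v : 'rV[R]_n, A x ->
    'D_(gamma_form G1 x u v) tau x =
      'D_u (fun y => 'D_v tau y) x
        + gamma_form G2 (tau x) ('D_u tau x) ('D_v tau x).

(* A smooth affine connection on M. *)
Record connection (R : realType) (n : nat) (M : manifold R n) := Connection {
  gamma : chart R n M -> 'I_n -> 'I_n -> 'I_n -> 'rV[R]_n -> R;
  gamma_smooth : forall c i j k, atlas c ->
    smooth_on (coords c setT) (gamma c i j k);
  gamma_change : forall c d, atlas c -> atlas d ->
    gamma_transform (coords c (cdom d)) (fun x => cmap d (cinv c x))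
                    (gamma c) (gamma d)
}.

Definition torsion_free (R : realType) (n : nat) (M : manifold R n)
    (nabla : connection M) : Prop :=
  forall c i j k x, atlas c -> coords c setT x ->
    gamma nabla c i j k x = gamma nabla c j i k x.

Definition critical_point (R : realType) (n : nat) (M : manifold R n)
    (Phi : M -> R) (p : M) : Prop :=
  forall c (i : 'I_n), atlas c -> cdom c p ->
    pder i (fun x => Phi (cinv c x)) (cmap c p) = 0.

Definition nondegenerate_critical_point (R : realType) (n : nat)
    (M : manifold R n) (Phi : M -> R) (p : M) : Prop :=
  critical_point Phi p /\
  forall c, atlas c -> cdom c p ->
    \det (\matrix_(i < n, j < n)
            pder i (pder j (fun x => Phi (cinv c x))) (cmap c p)) != 0.

(* |d^alpha f - d^alpha g| < e on K for all multi-indices alpha with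
   |alpha| <= r. *)
Definition Cr_close (R : realType) (n : nat) (r : nat) (e : R)
    (K : set 'rV[R]_n) (f g : 'rV[R]_n -> R) : Prop :=
  forall (s : seq 'I_n) (x : 'rV[R]_n), (size s <= r)%N -> K x ->
    `|iter_der (map (@basisv R n) s) f x -
      iter_der (map (@basisv R n) s) g x| < e.

(* P holds for all pairs (Phi', nabla') of a smooth function on U and a smooth
   torsion-free connection on M in a neighborhood of (Phi, nabla) for the
   topology of uniform convergence of all derivatives on compact sets; such a
   neighborhood is given by finitely many charts c a, c' a and compact sets of
   coordinates K a, K' a, an order of differentiation and a tolerance. *)
Definition for_small_perturbations (R : realType) (n : nat) (M : manifold R n)
    (U : set M) (Phi : M -> R) (nabla : connection M)
    (P : (M -> R) -> connection M -> Prop) : Prop :=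
  exists (m : nat) (c c' : 'I_m -> chart R n M)
         (K K' : 'I_m -> set 'rV[R]_n) (r : nat) (e : R),
    [/\ 0 < e,
        forall a, [/\ atlas (c a), compact (K a) & K a `<=` coords (c a) U],
        forall a, [/\ atlas (c' a), compact (K' a) &
                      K' a `<=` coords (c' a) setT] &
        forall (Phi' : M -> R) (nabla' : connection M),
          smooth_fun U Phi' -> torsion_free nabla' ->
          (forall a, Cr_close r e (K a) (fun x => Phi (cinv (c a) x))
                                        (fun x => Phi' (cinv (c a) x))) ->
          (forall a i j k, Cr_close r e (K' a) (gamma nabla (c' a) i j k)
                                               (gamma nabla' (c' a) i j k)) ->
          P Phi' nabla'].

(* \sum_{i,j} a_ij d_i d_j f + \sum_i b_i d_i f + z f at x *)
Definition second_order_expr (R : realType) (n : nat)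
    (a : 'I_n -> 'I_n -> R[i]) (b : 'I_n -> R[i]) (z : R[i])
    (f : 'rV[R]_n -> R[i]) (x : 'rV[R]_n) : R[i] :=
  (\sum_i \sum_j a i j * cpder i (cpder j f) x)
    + (\sum_i b i * cpder i f x) + z * f x.

(* A linear differential operator of order at most 2 with smooth (complex)
   coefficients on the open set A, acting on C^oo(A, C). *)
Definition smooth_diffop2 (R : realType) (n : nat) (M : manifold R n)
    (A : set M) (L : (M -> R[i]) -> (M -> R[i])) : Prop :=
  forall c, atlas c ->
  exists (a : 'I_n -> 'I_n -> 'rV[R]_n -> R[i])
         (b : 'I_n -> 'rV[R]_n -> R[i]) (z : 'rV[R]_n -> R[i]),
    [/\ forall i j, csmooth_on (coords c A) (a i j),
        forall i, csmooth_on (coords c A) (b i),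
        csmooth_on (coords c A) z &
        forall (f : M -> R[i]) (x : 'rV[R]_n),
          csmooth_fun A f -> coords c A x ->
          L f (cinv c x) =
            second_order_expr (fun i j => a i j x) (fun i => b i x) (z x)
                              (fun y => f (cinv c y)) x].

(* A family of such operators on A, parametrized by S, whose coefficients are
   smooth jointly in the parameter and the point. *)
Definition smooth_diffop2_family (R : realType) (k n : nat)
    (S : set 'rV[R]_k) (M : manifold R n) (A : set M)
    (L : 'rV[R]_k -> (M -> R[i]) -> (M -> R[i])) : Prop :=
  forall c, atlas c ->
  exists (a : 'I_n -> 'I_n -> 'rV[R]_k * 'rV[R]_n -> R[i])
         (b : 'I_n -> 'rV[R]_k * 'rV[R]_n -> R[i])
         (z : 'rV[R]_k * 'rV[R]_n -> R[i]),
    [/\ forall i j, csmooth_on (S `*` coords c A) (a i j),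
        forall i, csmooth_on (S `*` coords c A) (b i),
        csmooth_on (S `*` coords c A) z &
        forall (s : 'rV[R]_k) (f : M -> R[i]) (x : 'rV[R]_n),
          S s -> csmooth_fun A f -> coords c A x ->
          L s f (cinv c x) =
            second_order_expr (fun i j => a i j (s, x)) (fun i => b i (s, x))
                              (z (s, x)) (fun y => f (cinv c y)) x].

Definition smooth_fun_family (R : realType) (k n : nat) (S : set 'rV[R]_k)
    (M : manifold R n) (A : set M) (Phi : 'rV[R]_k -> M -> R) : Prop :=
  forall c, atlas c ->
    smooth_on (S `*` coords c A)
      (fun w : 'rV[R]_k * 'rV[R]_n => Phi w.1 (cinv c w.2)).

Definition smooth_connection_family (R : realType) (k n : nat)
    (S : set 'rV[R]_k) (M : manifold R n) (A : set M)
    (nabla : 'rV[R]_k -> connection M) : Prop :=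
  forall c i j l, atlas c ->
    smooth_on (S `*` coords c A)
      (fun w : 'rV[R]_k * 'rV[R]_n => gamma (nabla w.1) c i j l w.2).

(* psi maps the restriction of nabla1 to A to nabla2. *)
Definition connection_preserving (R : realType) (n : nat)
    (M1 M2 : manifold R n) (A : set M1) (psi : M1 -> M2)
    (nabla1 : connection M1) (nabla2 : connection M2) : Prop :=
  forall c1 c2, atlas c1 -> atlas c2 ->
    gamma_transform (coords c1 (A `&` psi @^-1` cdom c2))
      (fun x => cmap c2 (psi (cinv c1 x))) (gamma nabla1 c1) (gamma nabla2 c2).

(* t^{-n/2} e^{i t^{-1} (Phi(q) - Phi(p))} *)
Definition oscillation (R : realType) (n : nat) (M : manifold R n)
    (Phi : M -> R) (p : M) (t : R) (q : M) : R[i] :=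
  (t `^ (- (n%:R / 2)))%:C *
    (cos (t^-1 * (Phi q - Phi p)) +i* sin (t^-1 * (Phi q - Phi p))).

(* (d/dt - (i/2) L) [t^{-n/2} e^{i t^{-1} (Phi - Phi(p))}] = 0 on A, t > 0 *)
Definition evolution_equation (R : realType) (n : nat) (M : manifold R n)
    (A : set M) (Phi : M -> R) (p : M) (L : (M -> R[i]) -> (M -> R[i])) :
    Prop :=
  forall (t : R) (q : M), 0 < t -> A q ->
    cderive1 (fun s => oscillation Phi p s q) t
      - ('i / 2) * L (oscillation Phi p t) q = 0.

(* Main.v *)
Require Import Defs.
From HB Require Import structures.
From mathcomp Require Import all_boot all_order all_algebra.
From mathcomp Require Import all_classical all_reals all_analysis.
From mathcomp.real_closed Require Import complex.
From mathcomp Require Import ring lra.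

Set Implicit Arguments.
Unset Strict Implicit.
Unset Printing Implicit Defensive.

Import Order.TTheory GRing.Theory Num.Theory.
Import numFieldNormedType.Exports.

Local Open Scope classical_set_scope.
Local Open Scope ring_scope.

(** Write [phi] for the phase, [H] for its covariant Hessian and let
    [L h = a^{ij} H(h)_{ij} + b^k d_k h] have no term of order zero. Applying
    [d/dt - (i/2) L] to the oscillation and collecting powers of [1 / t], the
    evolution equation for all [t > 0] becomes two identities:
      [a(d phi, d phi) = 2 (phi - phi(p))]  and  [L phi = n].
    They leave much freedom in [a] and [b]; the proof singles out a solution that
    is determined by the data and depends smoothly on them.

    Near the nondegenerate critical point [H] is invertible. Let [X] be the field
    with [X H = d phi]; it vanishes at [p] with linear part the identity. Put
    [a = 2 H^-1 C H^-T] and [b = H^-1 B]. The identities become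
    [C(X, X) = phi - phi(p)] and [X . B = n - tr (a H^T)], and both follow by
    differentiation along [X] from the linear transport equations
      [D_X C + M C + C M^T = H],   [D_X B + M B = d (n - tr (a H^T))],
    where [M] is the Jacobian of [X]: they say that the Lie derivatives along [X]
    of the form [C] and of the one-form [B] are the right-hand sides. Then the
    difference of the two sides of each identity is constant along [X] and vanishes
    at [p], hence it vanishes, because its differential solves the homogeneous
    equation ([first_integral_cst], [symbol_self], [box_real_self]).

    Since [M] is close to the identity, the zeroth-order terms are damping terms,
    and [x - X x] maps balls around [p] inside themselves. Uniqueness of solutions
    on such a ball is a maximum principle ([transport_unique]). A solution is
    obtained from the scheme [u (x) := (1 - e A(x)) u (x - e X x) + e f(x)]: its
    iterates are bounded, and so are all their derivatives, because the iterates
    together with their rescaled derivatives satisfy a scheme of the same form.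
    Along an ultrafilter, for which the step tends to zero and the number of steps
    to infinity fast enough, they converge with all derivatives to a smooth
    solution ([transport_solution]). Parameters are additional variables in which
    the field has no component, so the same argument gives solutions that are
    smooth in the parameters as well ([local_family]).

    The covariant Hessian is a tensor, so the equations are invariant under
    changes of coordinates and under maps preserving the connections
    ([transport_sol_pull]); with uniqueness this makes the operator independent of
    all choices ([box_of_natural]) and smooth in families ([family_diffop2]).
    The conditions on the ball are open in the [C^3] topology, uniformly
    over the ball ([stable_ball]), and the critical point of a perturbed phase is
    the fixed point of the contraction [x - X x] ([newton_zero]). *)

(** * Differentiation along a finite basis *)

(** Coordinates dominated by the norm. The abstraction treats row vectors and
    products of a space of parameters with them in the same way. *)
Record fbasis (R : realType) (V : normedModType R) := FBasis {
  bidx : finType;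
  bvec : bidx -> V;
  bcoord : bidx -> V -> R;
  bcoord_linear : forall k a u v,
    bcoord k (a *: u + v) = a * bcoord k u + bcoord k v;
  bcoord_le : forall k v, `|bcoord k v| <= `|v|;
  bcoord_sum : forall v, v = \sum_k bcoord k v *: bvec k;
  bcoord_bvec : forall k l, bcoord k (bvec l) = (k == l)%:R
}.

Section FBasisTheory.
Variables (R : realType) (V : normedModType R) (b : fbasis V).
Implicit Types (u v : V) (k : bidx b).

Lemma bcoord0 k : bcoord k 0 = 0.
Proof.
have := bcoord_linear k 1 0 0; rewrite scaler0 addr0 mul1r => /eqP.
by rewrite -subr_eq0 opprD addrA subrr sub0r oppr_eq0 => /eqP.
Qed.

Lemma bcoordD k u v : bcoord k (u + v) = bcoord k u + bcoord k v.
Proof. by have := bcoord_linear k 1 u v; rewrite scale1r mul1r. Qed.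

Lemma bcoordZ k a u : bcoord k (a *: u) = a * bcoord k u.
Proof. by have := bcoord_linear k a u 0; rewrite addr0 bcoord0 addr0. Qed.

Lemma bcoordB k u v : bcoord k (u - v) = bcoord k u - bcoord k v.
Proof. by rewrite bcoordD -scaleN1r bcoordZ mulN1r. Qed.

Lemma bcoord_continuous k : continuous (bcoord k).
Proof.
move=> x; apply/cvgrPdist_lt => e e0; near=> y.
rewrite -bcoordB; apply: (le_lt_trans (bcoord_le _ _)).
by near: y; apply: cvgr_dist_lt.
Unshelve. all: by end_near. Qed.

End FBasisTheory.

Section Mean.
Variables (R : realType) (V : normedModType R).
Implicit Types (f : V -> R) (x v : V).

Lemma is_deriveZdir f x v (c : R) d :
  is_derive x v f d -> is_derive x (c *: v) f (c * d).
Proof.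
move=> [dv <-].
have [->|c0] := eqVneq c 0.
  by rewrite scale0r mul0r; apply: is_derive0.
suff H : (h^-1 *: ((f \o shift x) (h *: (c *: v)) - f x)) @[h --> 0^'] -->
     c * 'D_v f x by split; [apply/cvg_ex; eexists; exact: H | exact: cvg_lim H].
have Hd : (h^-1 *: ((f \o shift x) (h *: v) - f x)) @[h --> 0^'] --> 'D_v f x.
  exact: dv.
have Hc : (h * c : R) @[h --> (0:R)^'] --> (0:R)^'.
  have Hc0 : (h * c : R) @[h --> (0:R)] --> (0 : R).
    by rewrite -[X in _ --> X](mul0r c); apply: cvgMr_tmp; exact: cvg_id.
  move=> P HP; have {}HP : \forall y \near (0 : R), y != 0 -> P y by exact: HP.
  have := Hc0 _ HP => H; change (\forall h \near (0 : R), h != 0 -> P (h * c)).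
  have {}H : \forall h \near (0 : R), h * c != 0 -> P (h * c) := H.
  by apply: filterS H => h + h0; apply; rewrite mulf_neq0.
have H : c * ((h * c)^-1 *: ((f \o shift x) ((h * c) *: v) - f x))
    @[h --> (0:R)^'] --> c * 'D_v f x.
  by apply: cvgMl_tmp; exact: (cvg_comp _ _ Hc Hd).
apply: cvg_trans H; apply: near_eq_cvg; apply: nearW => h /=.
rewrite [h *: (c *: v)]scalerA.
change (c * ((h * c)^-1 * (f ((h * c) *: v + x) - f x)) =
  h^-1 * (f ((h * c) *: v + x) - f x)).
by rewrite invfM mulrA mulrCA mulfV // mulr1.
Unshelve. all: by end_near. Qed.

Lemma is_derive_along f x v t :
  derivable f (t *: v + x) v ->
  is_derive t 1 (fun s : R => f (s *: v + x)) ('D_v f (t *: v + x)).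
Proof.
move=> dv.
suff E : (fun h : R => h^-1 *: (((fun s : R => f (s *: v + x)) \o shift t) (h *: (1:R)) - f (t *: v + x)))
  = (fun h => h^-1 *: ((f \o shift (t *: v + x)) (h *: v) - f (t *: v + x))).
  by split; [rewrite /derivable E | rewrite /derive E].
by apply/funext => h /=; rewrite [h%:A]mulr1 scalerDl addrA.
Qed.

Lemma mean_value f x v :
  (forall t : R, 0 <= t <= 1 -> derivable f (t *: v + x) v) ->
  exists2 t : R, 0 < t < 1 & f (v + x) - f x = 'D_v f (t *: v + x).
Proof.
move=> dv.
have der (t : R) : t \in `[0, 1]%R ->
    is_derive t 1 (fun s : R => f (s *: v + x)) ('D_v f (t *: v + x)).
  by rewrite in_itv /= => ht; apply: is_derive_along; exact: dv.
pose F (s : R) := f (s *: v + x); pose dF (t : R) := 'D_v f (t *: v + x).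
have d1 : forall t : R, t \in `]0, 1[%R -> is_derive t 1 F (dF t).
  by move=> t t01; apply: der; exact: subset_itv_oo_cc t01.
have cF : {within `[(0:R), 1], continuous F}.
  apply: derivable_within_continuous => t t01.
  by have [] := der t t01.
have [t t01] := @MVT R F dF 0 1 ltr01 d1 cF.
by rewrite /F /dF scale1r scale0r add0r subr0 mulr1 => E; exists t.
Qed.

End Mean.

Section ChainRule.
Variables (R : realType) (V : normedModType R) (b : fbasis V).
Implicit Types (f : V -> R).

(** Mean value theorem along one basis vector at a time: every intermediate
    point stays in a ball where the partial derivatives are within [eta] of
    their value at [y0]. *)
Lemma C1_estimate f y0 :
  (forall k : bidx b, \forall y \near y0, derivable f y (bvec k)) ->
  (forall k : bidx b, {for y0, continuous ('D_(bvec k) f)}) ->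
  forall eta : R, 0 < eta -> exists2 d : R, 0 < d &
    forall c : bidx b -> R, (forall k, `|c k| < d) ->
    `|f (\sum_k c k *: bvec k + y0) - f y0 - \sum_k c k * 'D_(bvec k) f y0|
      <= eta * \sum_k `|c k|.
Proof.
move=> df cf eta eta0.
have : \forall y \near y0, forall k : bidx b,
    derivable f y (bvec k) /\ `|'D_(bvec k) f y0 - 'D_(bvec k) f y| < eta.
  apply: filter_forall => k; near=> y; split; first by near: y; exact: df.
  by near: y; apply: (@cvgr_dist_lt _ _ _ _ _ ('D_(bvec k) f)) => //; exact: cf.
move=> /nbhs_ballP [r /= r0 Hr].
pose N := \sum_(k : bidx b) `|bvec k| + 1.
have N0 : 0 < N by rewrite ltr_wpDl // sumr_ge0.
exists (r / N); first by rewrite divr_gt0.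
move=> c cd.
have Hs : forall s : seq (bidx b), \sum_(k <- s) `|c k| * `|bvec k| < r ->
   `|f (\sum_(k <- s) c k *: bvec k + y0) - f y0 -
      \sum_(k <- s) c k * 'D_(bvec k) f y0| <= eta * \sum_(k <- s) `|c k|.
  elim=> [|k s IH].
    by rewrite !big_nil add0r subrr subrr normr0 mulr0.
  rewrite !big_cons => Hr'.
  have Hsr : \sum_(j <- s) `|c j| * `|bvec j| < r.
    by apply: le_lt_trans Hr'; rewrite lerDr mulr_ge0.
  have {}IH := IH Hsr.
  set w := \sum_(j <- s) c j *: bvec j in IH *.
  have nw : `|w| <= \sum_(j <- s) `|c j| * `|bvec j|.
    apply: (le_trans (ler_norm_sum _ _ _)).
    by apply: ler_sum => j _; rewrite normrZ.
  have inb (t : R) : 0 <= t <= 1 -> ball y0 r (t *: (c k *: bvec k) + (w + y0)).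
    move=> /andP[t0 t1]; rewrite -ball_normE /= !addrA opprD addrCA subrr addr0.
    rewrite normrN; apply: le_lt_trans Hr'; apply: (le_trans (ler_normD _ _)).
    apply: lerD => //; rewrite !normrZ ger0_norm //.
    by rewrite ler_piMl // mulr_ge0.
  have [t t01 E] := mean_value (f := f) (x := w + y0) (v := c k *: bvec k)
    (fun t ht => @ex_derive _ _ _ _ _ _ _
      (is_deriveZdir (c k) (derivableP (Hr _ (inb t ht) k).1))).
  have t01' : 0 <= t <= 1 by case/andP: t01 => /ltW -> /ltW ->.
  have [dk ek] := Hr _ (inb t t01') k.
  move: E.
  rewrite (@derive_val _ _ _ _ _ _ _ (is_deriveZdir (c k) (derivableP dk))) => E.
  rewrite -[X in f (X)]addrA.
  set D := 'D_(bvec k) f _ in E ek; set D0 := 'D_(bvec k) f y0 in ek *.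
  have -> : f (c k *: bvec k + (w + y0)) - f y0 -
      (c k * D0 + \sum_(j <- s) c j * 'D_(bvec j) f y0) =
    c k * (D - D0) + (f (w + y0) - f y0 - \sum_(j <- s) c j * 'D_(bvec j) f y0).
    by rewrite mulrBr -E; ring.
  rewrite [leRHS]mulrDr; apply: (le_trans (ler_normD _ _)); apply: lerD => //.
  by rewrite normrM mulrC ler_wpM2r // distrC; exact: ltW.
apply: Hs; apply: (@le_lt_trans _ _ (\sum_(k : bidx b) r / N * `|bvec k|)).
  by apply: ler_sum => k _; rewrite ler_wpM2r // ltW.
by rewrite -mulr_sumr -mulrA gtr_pMr // mulrC ltr_pdivrMr // mul1r ltrDl.
Unshelve. all: by end_near. Qed.

Lemma is_derive_cvg (U W : normedModType R) (g : U -> W) (x v : U) d :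
  is_derive x v g d <->
  (h^-1 *: (g (h *: v + x) - g x)) @[h --> (0:R)^'] --> d.
Proof.
split=> [[dg <-]|H]; first exact: dg.
split; [by apply/cvg_ex; exists d | exact: cvg_lim H].
Qed.

Lemma is_derive_bcoord (k : bidx b) x v :
  is_derive x v (bcoord k) (bcoord k v).
Proof.
apply/is_derive_cvg; apply: cvg_near_cst; near=> h.
rewrite bcoordD bcoordZ addrK.
by rewrite [LHS]mulrA mulVf ?mul1r //; near: h; exact: nbhs_dnbhs_neq.
Unshelve. all: by end_near. Qed.

(** The expansion in [C1_estimate] is uniform in the increment, so the
    increment of [g] can be substituted in it; a derivative of [g] in the single
    direction [v] is enough. *)
Lemma is_derive_chain (U : normedModType R) f (g : U -> V) (x v : U)
    (d : bidx b -> R) :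
  (forall k : bidx b, \forall y \near g x, derivable f y (bvec k)) ->
  (forall k : bidx b, {for g x, continuous ('D_(bvec k) f)}) ->
  (forall k, is_derive x v (fun y => bcoord k (g y)) (d k)) ->
  is_derive x v (fun y => f (g y)) (\sum_k 'D_(bvec k) f (g x) * d k).
Proof.
move=> df cf dg; apply/is_derive_cvg.
pose q (k : bidx b) (h : R) := h^-1 * (bcoord k (g (h *: v + x)) - bcoord k (g x)).
have cq k : q k h @[h --> (0:R)^'] --> d k.
  by have /is_derive_cvg := dg k.
pose S := \sum_k (`|d k| + 1).
have S0 : 0 <= S by rewrite sumr_ge0 // => k _; rewrite addr_ge0.
have main : forall e : R, 0 < e -> \forall h \near (0:R)^',
   `|h^-1 *: (f (g (h *: v + x)) - f (g x)) - \sum_k q k h * 'D_(bvec k) f (g x)|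
     <= e * S.
  move=> e e0; have [dl dl0 Hdl] := C1_estimate df cf e0.
  have nq : \forall h \near (0:R)^', forall k, `|q k h| < `|d k| + 1.
    apply: filter_forall => k.
    by apply: cvgr_norm_lt; [exact: cq | rewrite ltrDl].
  have nh : \forall h \near (0:R)^', forall k : bidx b, `|h| * (`|d k| + 1) < dl.
    apply: filter_forall => k; near=> h.
    rewrite -ltr_pdivlMr ?ltr_wpDl //; near: h; apply: dnbhs0_lt.
    by rewrite divr_gt0 // ltr_wpDl.
  near=> h.
  have h0 : h != 0 by near: h; exact: nbhs_dnbhs_neq.
  have Hq : forall k, `|q k h| < `|d k| + 1 by near: h.
  have Hh : forall k : bidx b, `|h| * (`|d k| + 1) < dl by near: h.
  have Hc k : `|h * q k h| < dl.
    by apply: le_lt_trans (Hh k); rewrite normrM ler_wpM2l // ltW.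
  have := Hdl (fun k => h * q k h) Hc.
  have -> : \sum_k (h * q k h) *: bvec k + g x = g (h *: v + x).
    rewrite -[in RHS](subrK (g x) (g (h *: v + x))); congr (_ + _).
    rewrite [RHS](bcoord_sum b); apply: eq_bigr => k _.
    by rewrite bcoordB /q mulrA mulfV // mul1r.
  move=> Hf; rewrite -(ler_pM2l (_ : 0 < `|h|)) ?normr_gt0 // -normrM mulrBr.
  rewrite [h * (h^-1 *: _)]mulrA mulfV // mul1r mulr_sumr.
  under [X in `|_ - X|]eq_bigr do rewrite mulrA.
  apply: (le_trans Hf); rewrite mulrCA ler_pM2l //.
  rewrite mulr_sumr; apply: ler_sum => k _; rewrite normrM.
  by rewrite ler_wpM2l // ltW.
have cS : (\sum_k q k h * 'D_(bvec k) f (g x)) @[h --> (0:R)^'] -->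
   \sum_k 'D_(bvec k) f (g x) * d k.
  under eq_bigr do rewrite mulrC.
  apply: cvg_big => [|k _]; first exact: add_continuous.
  by apply: cvgMr_tmp.
apply/cvgrPdist_lt => e e0.
have e20 : 0 < e / 2 by rewrite divr_gt0.
have eS : 0 < e / 2 / (S + 1) by rewrite divr_gt0 // ltr_wpDl.
near=> h.
rewrite -(subrKA (\sum_k q k h * 'D_(bvec k) f (g x))).
apply: (le_lt_trans (ler_normD _ _)); rewrite [ltRHS]splitr.
apply: ltr_leD.
  by near: h; apply: cvgr_dist_lt.
rewrite distrC; apply: (@le_trans _ _ (e / 2 / (S + 1) * S)).
  by near: h; exact: main.
rewrite -mulrA ler_piMr // ?(ltW e20) // ler_pdivrMl ?ltr_wpDl //.
by rewrite mulr1 lerDl.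
Unshelve. all: by end_near. Qed.

End ChainRule.

Section SmoothBasic.
Variables (R : realType) (V W : normedModType R).
Implicit Types (A : set V).

Lemma iter_der_rcons (vs : seq V) v (f : V -> W) :
  iter_der (rcons vs v) f = iter_der vs ('D_v f).
Proof. by rewrite /iter_der foldr_rcons. Qed.

Lemma near_open A x : open A -> A x -> \forall y \near x, A y.
Proof. by move=> oA Ax; exact: open_nbhs_nbhs. Qed.

Lemma eq_on_near A x (f g : V -> W) : open A -> A x ->
  (forall y, A y -> f y = g y) -> \forall y \near x, f y = g y.
Proof. by move=> oA Ax fg; apply: filterS (near_open oA Ax) => y /fg. Qed.

Lemma eq_on_derive A (f g : V -> W) : open A ->
  (forall y, A y -> f y = g y) ->
  forall v x, A x -> 'D_v f x = 'D_v g x.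
Proof. by move=> oA fg v x Ax; apply: near_eq_derive; exact: eq_on_near fg. Qed.

Lemma eq_on_iter_der A (f g : V -> W) vs : open A ->
  (forall y, A y -> f y = g y) ->
  forall x, A x -> iter_der vs f x = iter_der vs g x.
Proof.
move=> oA fg; elim: vs => [|v vs IH] x Ax /=; first exact: fg.
exact: (eq_on_derive oA).
Qed.

Lemma near_continuous (f g : V -> W) x :
  (\forall y \near x, f y = g y) -> {for x, continuous f} ->
  {for x, continuous g}.
Proof.
move=> fg cf; rewrite /prop_for /continuous_at.
rewrite -(nbhs_singleton fg); apply: cvg_trans cf; apply: near_eq_cvg.
by apply: filterS fg => y ->.
Qed.

Lemma smooth_on_eq A (f g : V -> W) : open A ->
  (forall y, A y -> f y = g y) -> smooth_on A f -> smooth_on A g.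
Proof.
move=> oA fg sf vs x Ax; have [cf df] := sf vs x Ax.
have E : \forall y \near x, iter_der vs f y = iter_der vs g y.
  by apply: (eq_on_near oA Ax) => y Ay; exact: eq_on_iter_der Ay.
split; first exact: near_continuous cf.
by move=> v; apply: near_eq_derivable (df v).
Qed.

Lemma smooth_on_continuous A (f : V -> W) x :
  smooth_on A f -> A x -> {for x, continuous f}.
Proof. by move=> sf Ax; have [] := sf [::] x Ax. Qed.

Lemma smooth_on_derivable A (f : V -> W) x v :
  smooth_on A f -> A x -> derivable f x v.
Proof. by move=> sf Ax; have [_] := sf [::] x Ax; apply. Qed.

Lemma smooth_on_derive A (f : V -> W) v :
  smooth_on A f -> smooth_on A ('D_v f).
Proof. by move=> sf vs x Ax; rewrite -iter_der_rcons; exact: sf. Qed.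

Lemma smooth_on_iter_der A (f : V -> W) vs :
  smooth_on A f -> smooth_on A (iter_der vs f).
Proof.
by elim: vs => [|v vs IH] //= sf; apply: smooth_on_derive; exact: IH.
Qed.

Lemma smooth_onS A B (f : V -> W) : A `<=` B -> smooth_on B f -> smooth_on A f.
Proof. by move=> AB sf vs x /AB; exact: sf. Qed.

(** For coefficients that are identified with smooth functions only near each
    point. *)
Lemma smooth_on_local A (f : V -> W) :
  (forall x, A x -> exists B g, [/\ open B, B x, smooth_on B g &
     forall y, B y -> f y = g y]) -> smooth_on A f.
Proof.
move=> H vs x Ax; have [B [g [oB Bx sg fg]]] := H x Ax.
by apply: (@smooth_on_eq B g f) => // y By; rewrite fg.
Qed.

End SmoothBasic.

Section SmoothReal.
Variables (R : realType) (V : normedModType R) (b : fbasis V) (A : set V).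
Hypothesis oA : open A.
Implicit Types (f g : V -> R).

(** The chain rule for the identity map: continuous derivatives along the
    basis give derivatives in all directions. *)
Lemma derive_bcoord_sum f x v :
  (forall k : bidx b, forall y, A y -> derivable f y (bvec k)) ->
  (forall k : bidx b, {for x, continuous ('D_(bvec k) f)}) -> A x ->
  is_derive x v f (\sum_(k : bidx b) bcoord k v * 'D_(bvec k) f x).
Proof.
move=> df cf Ax.
have [|||H] := @is_derive_chain _ _ b V f id x v (fun k => bcoord k v).
- by move=> k; apply: filterS (near_open oA Ax); exact: df.
- by move=> k; exact: cf.
- by move=> k; exact: is_derive_bcoord.
- by move=> E; apply: DeriveDef => //; rewrite E; apply: eq_bigr => k _; rewrite mulrC.
Qed.

Section Coinduction.
Variable P : (V -> R) -> Prop.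
Hypothesis P_closed : forall f, P f ->
  (forall x, A x -> {for x, continuous f}) /\
  forall k : bidx b, (forall x, A x -> derivable f x (bvec k)) /\
    exists2 g, P g & forall x, A x -> 'D_(bvec k) f x = g x.

(** Derivatives in an arbitrary direction are linear combinations of
    derivatives along the basis, hence leave the class [P] but not this one. *)
Inductive lin_closure : (V -> R) -> Prop :=
| LinBase f : P f -> lin_closure f
| LinZero : lin_closure (fun=> 0)
| LinAdd f g : lin_closure f -> lin_closure g ->
    lin_closure (fun x => f x + g x)
| LinScale c f : lin_closure f -> lin_closure (fun x => c * f x)
| LinEq f g : (forall x, A x -> f x = g x) -> lin_closure f -> lin_closure g.

Lemma lin_closure_sum (I : finType) (F : I -> V -> R) :
  (forall i, lin_closure (F i)) -> lin_closure (fun x => \sum_i F i x).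
Proof.
move=> HF.
have : forall s : seq I, lin_closure (fun x => \sum_(i <- s) F i x).
  elim=> [|i s IH].
    by apply: (LinEq _ LinZero) => x _; rewrite big_nil.
  by apply: (LinEq _ (LinAdd (HF i) IH)) => x _; rewrite big_cons.
by apply.
Qed.

Lemma lin_closure_step f : lin_closure f ->
  (forall x, A x -> {for x, continuous f}) /\
  forall v, (forall x, A x -> derivable f x v) /\ lin_closure ('D_v f).
Proof.
elim=> {f}.
- move=> f Pf; have [cf df] := P_closed Pf; split=> // v.
  have cdf (k : bidx b) x : A x -> {for x, continuous ('D_(bvec k) f)}.
    move=> Ax; have [_ [g Pg fg]] := df k.
    apply: (near_continuous _ ((P_closed Pg).1 x Ax)).
    by apply: (eq_on_near oA Ax) => y Ay; rewrite fg.
  have H x : A x -> is_derive x v f (\sum_(k : bidx b) bcoord k v * 'D_(bvec k) f x).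
    by move=> Ax; apply: derive_bcoord_sum => //; [move=> k y Ay; exact: (df k).1 | move=> k; exact: cdf].
  split=> [x Ax|]; first by have := H x Ax; case.
  apply: (LinEq (f := fun x => \sum_(k : bidx b) bcoord k v * 'D_(bvec k) f x)).
    by move=> x Ax; have [_ ->] := H x Ax.
  apply: lin_closure_sum => k; apply: LinScale.
  have [_ [g Pg fg]] := df k.
  by apply: LinEq (LinBase Pg) => x Ax; rewrite fg.
- split=> [x Ax|v]; first exact: cvg_cst.
  split=> [x Ax|]; first exact: derivable_cst.
  by apply: LinEq LinZero => x Ax; rewrite derive_cst.
- move=> f g _ [cf df] _ [cg dg]; split=> [x Ax|v].
    by apply: cvgD; [exact: cf | exact: cg].
  split=> [x Ax|]; first by apply: derivableD; [exact: (df v).1 | exact: (dg v).1].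
  apply: LinEq (LinAdd (df v).2 (dg v).2) => x Ax; rewrite deriveD //.
    exact: (df v).1.
  exact: (dg v).1.
- move=> c f _ [cf df]; split=> [x Ax|v].
    by apply: cvgMl_tmp; exact: cf.
  split=> [x Ax|]; first by apply: derivableM; [exact: derivable_cst | exact: (df v).1].
  apply: LinEq (LinScale c (df v).2) => x Ax.
  by rewrite deriveMl //; exact: (df v).1.
- move=> f g fg _ [cf df]; split=> [x Ax|v].
    by apply: near_continuous (cf x Ax); exact: (eq_on_near oA).
  split=> [x Ax|].
    by apply: near_eq_derivable ((df v).1 x Ax); exact: (eq_on_near oA).
  by apply: LinEq (df v).2 => x Ax; exact: (eq_on_derive oA).
Qed.

(** Iterated derivatives need not be computed: it is enough to exhibit a class
    of continuous functions stable under differentiation along the basis. *)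
Lemma smooth_on_coind f : P f -> smooth_on A f.
Proof.
move=> Pf vs x Ax.
have : lin_closure (iter_der vs f).
  elim: vs => [|v vs IH] /=; first exact: LinBase.
  by have [_ /(_ v)[]] := lin_closure_step IH.
move=> /lin_closure_step[c d]; split; first exact: c.
by move=> v; exact: (d v).1.
Qed.

End Coinduction.

Lemma smooth_on_is_derive f x v : smooth_on A f -> A x ->
  is_derive x v f ('D_v f x).
Proof. by move=> sf Ax; apply: derivableP; exact: smooth_on_derivable Ax. Qed.

Lemma deriveEcoord f x v : smooth_on A f -> A x ->
  'D_v f x = \sum_(k : bidx b) bcoord k v * 'D_(bvec k) f x.
Proof.
move=> sf Ax; have [] := @derive_bcoord_sum f x v _ _ Ax => //.
  by move=> k y Ay; exact: smooth_on_derivable Ay.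
by move=> k; apply: smooth_on_continuous Ax; exact: smooth_on_derive.
Qed.

End SmoothReal.

(** * Closure properties of smooth functions *)

Section SmoothClosure.
Variables (R : realType) (V W : normedModType R) (b : fbasis V) (bW : fbasis W).
Variables (A : set V) (B : set W) (g : V -> W).
Hypotheses (oA : open A) (oB : open B) (gAB : forall x, A x -> B (g x)).
Hypothesis sg : forall l : bidx bW, smooth_on A (fun x => bcoord l (g x)).

(** The derivative of a product, an inverse or a composite is built from the
    same operations, so the class that they generate is stable under
    differentiation and [smooth_on_coind] yields all closure properties at once. *)
Inductive smooth_alg : (V -> R) -> Prop :=
| SABase f : smooth_on A f -> smooth_alg f
| SAAdd f1 f2 : smooth_alg f1 -> smooth_alg f2 ->
    smooth_alg (fun x => f1 x + f2 x)
| SAMul f1 f2 : smooth_alg f1 -> smooth_alg f2 ->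
    smooth_alg (fun x => f1 x * f2 x)
| SAInv f : (forall x, A x -> f x != 0) -> smooth_alg f ->
    smooth_alg (fun x => (f x)^-1)
| SAComp f : smooth_on B f -> smooth_alg (fun x => f (g x)).

Lemma continuous_bcoord x :
  (forall l : bidx bW, {for x, continuous (fun y => bcoord l (g y))}) ->
  {for x, continuous g}.
Proof.
move=> H.
have H2 : (\sum_(l : bidx bW) bcoord l (g y) *: bvec l) @[y --> x] -->
    \sum_(l : bidx bW) bcoord l (g x) *: bvec l.
  apply: cvg_big => [|l _]; first exact: add_continuous.
  by apply: cvgZr_tmp; exact: H.
rewrite /prop_for /continuous_at [X in _ --> X](bcoord_sum bW (g x)).
apply: cvg_trans H2; apply: near_eq_cvg; apply: nearW => y.
exact/esym/bcoord_sum.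
Qed.

Lemma is_derive_smooth_comp (f : W -> R) x v : smooth_on B f -> A x ->
  is_derive x v (fun y => f (g y))
   (\sum_(l : bidx bW) 'D_(bvec l) f (g x) * 'D_v (fun y => bcoord l (g y)) x).
Proof.
move=> sf Ax; apply: is_derive_chain.
- move=> l; apply: filterS (near_open oB (gAB Ax)) => y By.
  exact: smooth_on_derivable By.
- move=> l; apply: smooth_on_continuous (gAB Ax); exact: smooth_on_derive.
- move=> l; exact: smooth_on_is_derive Ax.
Qed.

Lemma smooth_alg0 : smooth_alg (fun=> 0).
Proof.
apply: SABase => vs x Ax.
have -> : iter_der vs (fun _ : V => (0 : R)) = cst 0.
  by elim: vs => //= v vs ->; apply/funext => y; rewrite derive_cst.
by split; [exact: cvg_cst | move=> v; exact: derivable_cst].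
Qed.

Lemma smooth_alg_sum (I : finType) (F : I -> V -> R) :
  (forall i, smooth_alg (F i)) -> smooth_alg (fun x => \sum_i F i x).
Proof.
move=> HF.
suff : forall s : seq I, smooth_alg (fun x => \sum_(i <- s) F i x) by apply.
elim=> [|i s IH].
  rewrite (_ : (fun _ => _) = fun=> 0); first exact: smooth_alg0.
  by apply/funext => x; rewrite big_nil.
rewrite (_ : (fun _ => _) = fun x => F i x + \sum_(j <- s) F j x).
  exact: SAAdd.
by apply/funext => x; rewrite big_cons.
Qed.

Lemma smooth_alg_smooth f : smooth_alg f -> smooth_on A f.
Proof.
apply: (smooth_on_coind (b := b) oA) => {}f; elim=> {f}.
- move=> f sf; split=> [x|k]; first exact: smooth_on_continuous.
  split=> [x|]; first exact: smooth_on_derivable.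
  by exists ('D_(bvec k) f) => //; apply: SABase; exact: smooth_on_derive.
- move=> f1 f2 _ [c1 d1] _ [c2 d2]; split=> [x Ax|k].
    by apply: cvgD; [exact: c1 | exact: c2].
  have [e1 [g1 s1 E1]] := d1 k; have [e2 [g2 s2 E2]] := d2 k.
  split=> [x Ax|]; first by apply: derivableD; [exact: e1 | exact: e2].
  exists (fun x => g1 x + g2 x); first exact: SAAdd.
  move=> x Ax; rewrite deriveD; [by rewrite E1 // E2|exact: e1|exact: e2].
- move=> f1 f2 S1 [c1 d1] S2 [c2 d2]; split=> [x Ax|k].
    by apply: cvgM; [exact: c1 | exact: c2].
  have [e1 [g1 s1 E1]] := d1 k; have [e2 [g2 s2 E2]] := d2 k.
  split=> [x Ax|]; first by apply: derivableM; [exact: e1 | exact: e2].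
  exists (fun x => f1 x * g2 x + f2 x * g1 x).
    by apply: SAAdd; exact: SAMul.
  move=> x Ax; rewrite deriveM; [by rewrite E1 // E2|exact: e1|exact: e2].
- move=> f f0 S1 [c1 d1]; split=> [x Ax|k].
    by apply: cvgV; [exact: f0 | exact: c1].
  have [e1 [g1 s1 E1]] := d1 k.
  split=> [x Ax|]; first by apply: derivableV; [exact: f0 | exact: e1].
  exists (fun x => (- 1 * ((f x)^-1 * (f x)^-1)) * g1 x).
    apply: SAMul => //; apply: SAMul; last by apply: SAMul; exact: SAInv.
    apply: SABase => vs x Ax.
    have [c ->] : exists c : R, iter_der vs (fun _ : V => (-1 : R)) = cst c.
      elim: vs => [|v vs [c E]] /=; first by exists (-1).
      by exists 0; rewrite E; apply/funext => y; rewrite derive_cst.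
    by split; [exact: cvg_cst | move=> v; exact: derivable_cst].
  move=> x Ax; rewrite deriveV; [|exact: f0|exact: e1].
  by rewrite E1 // expr2 invfM mulN1r.
- move=> f sf; split=> [x Ax|k].
    apply: continuous_comp; last by apply: smooth_on_continuous (gAB Ax).
    by apply: continuous_bcoord => l; exact: smooth_on_continuous Ax.
  split=> [x Ax|]; first by have [] := is_derive_smooth_comp (bvec k) sf Ax.
  exists (fun x => \sum_(l : bidx bW) 'D_(bvec l) f (g x) * 'D_(bvec k) (fun y => bcoord l (g y)) x).
    apply: smooth_alg_sum => l; apply: SAMul; last first.
      by apply: SABase; apply: smooth_on_derive.
    by apply: (SAComp (f := 'D_(bvec l) f)); exact: smooth_on_derive.
  by move=> x Ax; have [_ ->] := is_derive_smooth_comp (bvec k) sf Ax.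
Qed.

End SmoothClosure.

Lemma smooth_on_comp (R : realType) (V W : normedModType R) (b : fbasis V)
    (bW : fbasis W) (A : set V) (B : set W) (g : V -> W) (f : W -> R) :
  open A -> open B -> (forall x, A x -> B (g x)) ->
  (forall l : bidx bW, smooth_on A (fun x => bcoord l (g x))) ->
  smooth_on B f -> smooth_on A (fun x => f (g x)).
Proof.
move=> oA oB gAB sg sf; apply: (smooth_alg_smooth b (bW := bW) oA oB gAB sg).
exact: SAComp.
Qed.

Section SmoothOps.
Variables (R : realType) (V : normedModType R) (b : fbasis V) (A : set V).
Hypothesis oA : open A.
Implicit Types f g : V -> R.

Lemma smooth_on_cst (c : R) : smooth_on A (fun=> c).
Proof.
apply: (smooth_on_coind (b := b) (P := fun f => exists c, f = fun=> c) oA);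
  last by exists c.
move=> _ [{}c ->]; split=> [x _|k]; first exact: cvg_cst.
split=> [x _|]; first exact: derivable_cst.
by exists (fun=> 0); [exists 0 | move=> x _; rewrite derive_cst].
Qed.

Let idAA x : A x -> A (id x). Proof. by []. Qed.

Lemma smooth_on_bcoord (k : bidx b) : smooth_on A (bcoord k).
Proof.
apply: (smooth_on_coind (b := b)
  (P := fun f => f = bcoord k \/ exists c, f = fun=> c) oA); last by left.
move=> _ [->|[c ->]]; split=> [x _|l].
- exact: bcoord_continuous.
- split=> [x _|]; first by have [] := is_derive_bcoord k x (bvec l).
  exists (fun=> bcoord k (bvec l)); first by right; eexists.
  by move=> x _; have [_ ->] := is_derive_bcoord k x (bvec l).
- exact: cvg_cst.
- split=> [x _|]; first exact: derivable_cst.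
  by exists (fun=> 0); [right; exists 0 | move=> x _; rewrite derive_cst].
Qed.

Let algP f : smooth_alg A A id f -> smooth_on A f.
Proof. exact: (smooth_alg_smooth b oA oA idAA smooth_on_bcoord). Qed.

Lemma smooth_onD f g : smooth_on A f -> smooth_on A g ->
  smooth_on A (fun x => f x + g x).
Proof. by move=> sf sg; apply: algP; apply: SAAdd; exact: SABase. Qed.

Lemma smooth_onM f g : smooth_on A f -> smooth_on A g ->
  smooth_on A (fun x => f x * g x).
Proof. by move=> sf sg; apply: algP; apply: SAMul; exact: SABase. Qed.

Lemma smooth_onN f : smooth_on A f -> smooth_on A (fun x => - f x).
Proof.
move=> sf; have := smooth_onM (smooth_on_cst (-1)) sf.
by apply: smooth_on_eq => // x _; rewrite mulN1r.
Qed.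

Lemma smooth_onB f g : smooth_on A f -> smooth_on A g ->
  smooth_on A (fun x => f x - g x).
Proof. by move=> sf sg; exact: (smooth_onD sf (smooth_onN sg)). Qed.

Lemma smooth_onV f : (forall x, A x -> f x != 0) -> smooth_on A f ->
  smooth_on A (fun x => (f x)^-1).
Proof. by move=> f0 sf; apply: algP; apply: SAInv => //; exact: SABase. Qed.

Lemma smooth_on_sum (I : Type) (s : seq I) (P : pred I) (F : I -> V -> R) :
  (forall i, smooth_on A (F i)) ->
  smooth_on A (fun x => \sum_(i <- s | P i) F i x).
Proof.
move=> sF; elim: s => [|i s IH].
  have := smooth_on_cst 0.
  by apply: smooth_on_eq => // x _; rewrite big_nil.
have [Pi|Pi] := boolP (P i).
  by have := smooth_onD (sF i) IH; apply: smooth_on_eq => // x _; rewrite big_cons Pi.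
by move: IH; apply: smooth_on_eq => // x _; rewrite big_cons (negbTE Pi).
Qed.

Lemma smooth_on_prod (I : Type) (s : seq I) (P : pred I) (F : I -> V -> R) :
  (forall i, smooth_on A (F i)) ->
  smooth_on A (fun x => \prod_(i <- s | P i) F i x).
Proof.
move=> sF; elim: s => [|i s IH].
  have := smooth_on_cst 1.
  by apply: smooth_on_eq => // x _; rewrite big_nil.
have [Pi|Pi] := boolP (P i).
  by have := smooth_onM (sF i) IH; apply: smooth_on_eq => // x _; rewrite big_cons Pi.
by move: IH; apply: smooth_on_eq => // x _; rewrite big_cons (negbTE Pi).
Qed.

Lemma smooth_on_det n (F : V -> 'M[R]_n) :
  (forall i j, smooth_on A (fun x => F x i j)) ->
  smooth_on A (fun x => \det (F x)).
Proof.
move=> sF; apply: smooth_on_sum => s; apply: smooth_onM.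
  exact: smooth_on_cst.
by apply: smooth_on_prod => i; exact: sF.
Qed.

Lemma smooth_on_mulmx m n p (F : V -> 'M[R]_(m, n)) (G : V -> 'M[R]_(n, p)) :
  (forall i j, smooth_on A (fun x => F x i j)) ->
  (forall i j, smooth_on A (fun x => G x i j)) ->
  forall i j, smooth_on A (fun x => (F x *m G x) i j).
Proof.
move=> sF sG i j.
have : smooth_on A (fun x => \sum_k F x i k * G x k j).
  by apply: smooth_on_sum => k; exact: smooth_onM.
by apply: smooth_on_eq => // x _; rewrite mxE.
Qed.

Lemma smooth_on_invmx n (F : V -> 'M[R]_n) :
  (forall x, A x -> \det (F x) != 0) ->
  (forall i j, smooth_on A (fun x => F x i j)) ->
  forall i j, smooth_on A (fun x => invmx (F x) i j).
Proof.
move=> dF sF i j.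
have : smooth_on A (fun x => (\det (F x))^-1 * cofactor (F x) j i).
  apply: smooth_onM; first by apply: smooth_onV => //; exact: smooth_on_det.
  rewrite /cofactor; apply: smooth_onM; first exact: smooth_on_cst.
  apply: smooth_on_det => k l.
  have := sF (lift j k) (lift i l).
  by apply: smooth_on_eq => // x _; rewrite !mxE.
apply: smooth_on_eq => // x Ax; rewrite /invmx unitmxE unitfE dF //.
by rewrite !mxE.
Qed.

(** The second difference quotient is symmetric in [u] and [v], and two mean
    value theorems show that it tends to each of the mixed derivatives. *)
Lemma schwarz_derive f u v x : smooth_on A f -> A x ->
  'D_u ('D_v f) x = 'D_v ('D_u f) x.
Proof.
move=> sf Ax.
have key : forall u v (e : R), 0 < e -> \forall h \near (0:R)^'+,
    `|(h * h)^-1 * (f (h *: u + (h *: v + x)) - f (h *: v + x) - (f (h *: u + x) - f x))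
      - 'D_v ('D_u f) x| < e.
  move=> {}u {}v e e0.
  have : \forall y \near x, A y /\ `|'D_v ('D_u f) x - 'D_v ('D_u f) y| < e.
    near=> y; split; first by near: y; exact: near_open.
    near: y; apply: (@cvgr_dist_lt _ _ _ _ _ ('D_v ('D_u f))) => //.
    exact: (smooth_on_continuous (smooth_on_derive v (smooth_on_derive u sf)) Ax).
  move=> /nbhs_ballP[r /= r0 Hr].
  near=> h.
  have h0 : 0 < h by near: h; exact: nbhs_right_gt.
  have hr : h * (`|u| + `|v|) < r.
    have N0 : 0 < `|u| + `|v| + 1 by rewrite ltr_wpDl // addr_ge0.
    apply: (@le_lt_trans _ _ (h * (`|u| + `|v| + 1))).
      by rewrite (ler_wpM2l (ltW h0)) // lerDl.
    rewrite -ltr_pdivlMr //; near: h; apply: nbhs_right_lt.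
    by rewrite divr_gt0.
  have inb (s t : R) : 0 <= s <= 1 -> 0 <= t <= 1 ->
      ball x r (s *: (h *: u) + (t *: (h *: v) + x)).
    move=> /andP[s0 s1] /andP[t0 t1]; rewrite -ball_normE /=.
    rewrite !addrA opprD addrCA subrr addr0 normrN.
    apply: le_lt_trans hr; apply: (le_trans (ler_normD _ _)).
    rewrite !normrZ !ger0_norm ?(ltW h0) // mulrDr lerD //.
      by rewrite ler_piMl // mulr_ge0 // ltW.
    by rewrite ler_piMl // mulr_ge0 // ltW.
  have I0 : 0 <= (0:R) <= 1 by rewrite lexx ler01.
  have I1 : 0 <= (1:R) <= 1 by rewrite lexx ler01.
  pose F (y : V) := f ((h *: v) + y) - f y.
  have dF (s : R) : 0 <= s <= 1 -> is_derive (s *: (h *: u) + x) (h *: u) F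
    (h * ('D_u f (h *: v + (s *: (h *: u) + x)) - 'D_u f (s *: (h *: u) + x))).
    move=> s01.
    have A1 : A (h *: v + (s *: (h *: u) + x)).
      by have [] := Hr _ (inb s 1 s01 I1); rewrite scale1r addrCA.
    have A2 : A (s *: (h *: u) + x).
      by have [] := Hr _ (inb s 0 s01 I0); rewrite scale0r add0r.
    rewrite mulrBr; apply: is_deriveB; last first.
      by apply: is_deriveZdir; exact: smooth_on_is_derive A2.
    have /is_derive_cvg H := is_deriveZdir h (smooth_on_is_derive u sf A1).
    apply/is_derive_cvg; apply: cvg_trans H; apply: near_eq_cvg; apply: nearW => k /=.
    by congr (_ *: (f _ - _)); rewrite addrCA.
  have [s s01 E] := mean_value (f := F) (x := x) (v := h *: u)
     (fun s s01 => @ex_derive _ _ _ _ _ _ _ (dF s s01)).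
  have s01' : 0 <= s <= 1 by case/andP: s01 => /ltW -> /ltW ->.
  move: E; have [_ ->] := dF s s01' => E.
  have [t t01 E2] := mean_value (f := 'D_u f) (x := s *: (h *: u) + x) (v := h *: v)
    (fun t t01 => @ex_derive _ _ _ _ _ _ _
       (is_deriveZdir h (smooth_on_is_derive v (smooth_on_derive u sf)
       (eq_ind _ A (Hr _ (inb s t s01' t01)).1 _ (addrCA _ _ _))))).
  have t01' : 0 <= t <= 1 by case/andP: t01 => /ltW -> /ltW ->.
  have [A3 B3] := Hr _ (inb s t s01' t01').
  move: A3 B3; rewrite addrCA => A3 B3.
  move: E2; have [_ ->] := is_deriveZdir h (smooth_on_is_derive v (smooth_on_derive u sf) A3).
  move=> E2; move: E; rewrite E2 /F => E.
  rewrite [h *: u + (h *: v + x)]addrCA.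
  have -> : f (h *: v + (h *: u + x)) - f (h *: v + x) - (f (h *: u + x) - f x) =
     h * (h * 'D_v ('D_u f) (t *: (h *: v) + (s *: (h *: u) + x))).
    by rewrite -E; ring.
  have hh0 : h * h != 0 by rewrite mulf_neq0 // gt_eqF.
  have -> (D : R) : (h * h)^-1 * (h * (h * D)) = D.
    by rewrite (mulrA h h D) (mulKf hh0).
  by rewrite distrC.
apply/eqP; rewrite -subr_eq0 -normr_le0; apply/ler_addgt0Pl => e e0.
rewrite addr0.
have e20 : 0 < e / 2 by rewrite divr_gt0.
pose Q (h : R) := (h * h)^-1 *
  (f (h *: u + (h *: v + x)) - f (h *: v + x) - (f (h *: u + x) - f x)).
have K1 : \forall h \near (0:R)^'+, `|Q h - 'D_v ('D_u f) x| < e / 2.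
  exact: key.
have K2 : \forall h \near (0:R)^'+, `|Q h - 'D_u ('D_v f) x| < e / 2.
  apply: filterS (key v u (e / 2) e20) => h.
  suff -> : (h * h)^-1 * (f (h *: v + (h *: u + x)) - f (h *: u + x) -
    (f (h *: v + x) - f x)) = Q h by [].
  rewrite /Q [h *: v + (h *: u + x)]addrCA; congr (_ * _); ring.
have : \forall h \near (0:R)^'+, `|'D_u ('D_v f) x - 'D_v ('D_u f) x| < e.
  apply: filterS2 K1 K2 => h.
  move: ('D_u ('D_v f) x) ('D_v ('D_u f) x) (Q h) => p1 p2 q L1 L2.
  rewrite -(subrKA q); apply: (le_lt_trans (ler_normD _ _)).
  by rewrite (splitr e) ltrD // distrC.
by move=> /filter_ex[h /ltW].
Unshelve. all: by end_near. Qed.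

End SmoothOps.

(** * Row vectors and products *)

Lemma open_setX (T1 T2 : topologicalType) (S : set T1) (W : set T2) :
  open S -> open W -> open (S `*` W).
Proof.
move=> oS oW; rewrite openE => -[x y] [/= Sx Wy].
by exists (S, W) => //; split; exact: open_nbhs_nbhs.
Qed.

Section Bases.
Variable R : realType.

Lemma row_coord_linear n (i : 'I_n) (a : R) (u v : 'rV[R]_n) :
  (a *: u + v) 0 i = a * u 0 i + v 0 i.
Proof. by rewrite !mxE. Qed.

Lemma row_coord_le n (i : 'I_n) (v : 'rV[R]_n) : `|v 0 i| <= `|v|.
Proof.
rewrite [leRHS]/Num.Def.normr /= mx_normrE.
exact: (le_bigmax _ (fun ij : 'I_1 * 'I_n => `|v ij.1 ij.2|) (0, i)).
Qed.

Lemma row_coord_sum n (v : 'rV[R]_n) : v = \sum_i v 0 i *: basisv R i.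
Proof.
apply/rowP => j; rewrite summxE (bigD1 j) //= !mxE !eqxx mulr1.
by rewrite big1 ?addr0 // => i ij; rewrite !mxE eq_sym (negbTE ij) andbF mulr0.
Qed.

Lemma row_coord_basisv n (i j : 'I_n) : basisv R j 0 i = (i == j)%:R.
Proof. by rewrite mxE eqxx. Qed.

Definition row_fbasis n : fbasis 'rV[R]_n :=
  FBasis (@row_coord_linear n) (@row_coord_le n) (@row_coord_sum n)
    (@row_coord_basisv n).

Lemma row_norm_lt n (v : 'rV[R]_n) (e : R) : 0 < e ->
  (forall i, `|v 0 i| < e) -> `|v| < e.
Proof.
move=> e0 H; rewrite [ltLHS]/Num.Def.normr /= mx_normrE.
by apply: bigmax_lt => //= -[i j] _; rewrite ord1 H.
Qed.

Lemma row_norm_le n (v : 'rV[R]_n) (e : R) : 0 <= e ->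
  (forall i, `|v 0 i| <= e) -> `|v| <= e.
Proof.
move=> e0 H; rewrite [leLHS]/Num.Def.normr /= mx_normrE.
by apply: bigmax_le => //= -[i j] _; rewrite ord1 H.
Qed.

Section Prod.
Variables (V1 V2 : normedModType R) (b1 : fbasis V1) (b2 : fbasis V2).

Definition prod_bvec (k : bidx b1 + bidx b2) : V1 * V2 :=
  match k with inl i => (bvec i, 0) | inr j => (0, bvec j) end.

Definition prod_bcoord (k : bidx b1 + bidx b2) (v : V1 * V2) : R :=
  match k with inl i => bcoord i v.1 | inr j => bcoord j v.2 end.

Lemma prod_bcoord_linear k a u v :
  prod_bcoord k (a *: u + v) = a * prod_bcoord k u + prod_bcoord k v.
Proof. by case: k => k /=; rewrite bcoord_linear. Qed.

Lemma prod_bcoord_le k v : `|prod_bcoord k v| <= `|v|.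
Proof.
rewrite prod_normE.
by case: k => k /=; rewrite le_max bcoord_le ?orbT.
Qed.

Lemma prod_bcoord_sum v : v = \sum_k prod_bcoord k v *: prod_bvec k.
Proof.
rewrite big_sumType /=; case: v => v1 v2 /=.
have E (I : finType) (F : I -> V1 * V2) :
    \sum_i F i = (\sum_i (F i).1, \sum_i (F i).2).
  suff : forall s : seq I,
      \sum_(i <- s) F i = (\sum_(i <- s) (F i).1, \sum_(i <- s) (F i).2) by apply.
  by elim=> [|i s IH]; rewrite ?big_nil // !big_cons IH; case: (F i).
rewrite !E /=; under [in X in (X, _) + _]eq_bigr do rewrite /=.
rewrite -(bcoord_sum b1) -(bcoord_sum b2).
by rewrite big1 ?big1 => *; rewrite /= ?scaler0 //; congr pair; rewrite /= ?addr0 ?add0r.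
Qed.

Lemma prod_bcoord_bvec k l : prod_bcoord k (prod_bvec l) = (k == l)%:R.
Proof. by case: k l => [k|k] [l|l] /=; rewrite ?bcoord_bvec ?bcoord0. Qed.

Definition prod_fbasis : fbasis (V1 * V2)%type :=
  FBasis prod_bcoord_linear prod_bcoord_le prod_bcoord_sum prod_bcoord_bvec.

Lemma derive_slice (F : V1 * V2 -> R) s y v :
  'D_v (fun z => F (s, z)) y = 'D_(0, v) F (s, y).
Proof.
rewrite /derive.
suff -> : (fun h : R => h^-1 *: (((fun z => F (s, z)) \o shift y) (h *: v) - F (s, y))) =
  fun h => h^-1 *: ((F \o shift (s, y)) (h *: (0, v)) - F (s, y)) by [].
apply/funext => h /=.
by congr (_ *: (F _ - _)); rewrite /shift /= -[RHS]/(h *: 0 + s, h *: v + y) scaler0 add0r.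
Qed.

Lemma smooth_on_slice (S : set V1) (W : set V2) (F : V1 * V2 -> R) s :
  open S -> open W ->
  smooth_on (S `*` W) F -> S s -> smooth_on W (fun z => F (s, z)).
Proof.
move=> oS oW sF Ss.
apply: (smooth_on_comp b2 (bW := prod_fbasis) oW (open_setX oS oW) _ _ sF).
  by move=> x Wx.
case=> k /=; last exact: smooth_on_bcoord.
exact: (smooth_on_cst b2).
Qed.

Lemma smooth_on_snd (S : set V1) (W : set V2) (f : V2 -> R) : open S -> open W ->
  smooth_on W f -> smooth_on (S `*` W) (fun w => f w.2).
Proof.
move=> oS oW sf.
apply: (smooth_on_comp prod_fbasis (bW := b2) (open_setX oS oW) oW _ _ sf).
  by move=> x [].
move=> k; exact: (smooth_on_bcoord (b := prod_fbasis) (open_setX oS oW) (inr k)).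
Qed.

End Prod.

Section Rows.
Variables (V : normedModType R) (b : fbasis V) (n : nat).

Lemma derive_row (g : V -> 'rV[R]_n) x v j : derivable g x v ->
  ('D_v g x) 0 j = 'D_v (fun y => g y 0 j) x.
Proof. by move=> dg; rewrite derive_mx // mxE. Qed.

Lemma smooth_on_row (A : set V) (g : V -> 'rV[R]_n) j : open A ->
  smooth_on A g -> smooth_on A (fun x => g x 0 j).
Proof.
move=> oA sg.
apply: (smooth_on_coind (b := b) (P := fun f => exists2 h : V -> 'rV[R]_n,
   smooth_on A h & f = fun x => h x 0 j) oA); last by exists g.
move=> _ [h sh ->]; split=> [x Ax|k].
  apply: (@continuous_comp _ _ _ h (fun M : 'rV[R]_n => M 0 j)).
    exact: smooth_on_continuous Ax.
  exact: coord_continuous.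
split=> [x Ax|].
  by have /derivable_mxP := smooth_on_derivable sh Ax (v := bvec k); apply.
exists (fun x => ('D_(bvec k) h x) 0 j).
  by exists ('D_(bvec k) h); [exact: smooth_on_derive | reflexivity].
by move=> x Ax; rewrite derive_row //; exact: smooth_on_derivable Ax.
Qed.

End Rows.

End Bases.

(** * Families with uniformly bounded derivatives *)

Section BoundedFamilies.
Variables (R : realType) (V : normedModType R) (b : fbasis V) (D : set V).
Hypothesis oD : open D.
Implicit Types g : R -> V -> R.

(** The index is a step size in ]0, 1]; derivatives up to order [n] are bounded
    uniformly in the step and in the point. *)
Fixpoint bfamn (n : nat) g : Prop :=
  [/\ forall e : R, 0 < e <= 1 -> smooth_on D (g e),
      exists B : R, forall (e : R) x, 0 < e <= 1 -> D x -> `|g e x| <= B &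
      match n with
      | 0 => True
      | m.+1 => forall k : bidx b, bfamn m (fun e => 'D_(bvec k) (g e))
      end].

Definition bfam g := forall n, bfamn n g.

Lemma bfamn_smooth n g e : bfamn n g -> 0 < e <= 1 -> smooth_on D (g e).
Proof. by case: n => [|n] [+ _ _]; apply. Qed.

Lemma bfamn_bound n g : bfamn n g ->
  exists B : R, forall (e : R) x, 0 < e <= 1 -> D x -> `|g e x| <= B.
Proof. by case: n => [|n] []. Qed.

Lemma bfamn_eq n g g' : (forall (e : R) x, 0 < e <= 1 -> D x -> g e x = g' e x) ->
  bfamn n g -> bfamn n g'.
Proof.
elim: n g g' => [|n IH] g g' E.
  move=> [sg [B HB] _]; split; last by [].
    move=> e e01; apply: (smooth_on_eq oD _ (sg e e01)) => y Dy; exact: E.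
  by exists B => e x e01 Dx; rewrite -(E e x e01 Dx); exact: HB.
move=> [sg [B HB] dg]; split.
- by move=> e e01; apply: (smooth_on_eq oD _ (sg e e01)) => y Dy; exact: E.
- by exists B => e x e01 Dx; rewrite -(E e x e01 Dx); exact: HB.
- move=> k; apply: IH (dg k) => e x e01 Dx.
  by apply: (eq_on_derive oD) => // y Dy; exact: E.
Qed.

Lemma bfamnW n g : bfamn n.+1 g -> bfamn n g.
Proof.
elim: n g => [|n IH] g; first by move=> [sg bg _].
by move=> [sg bg dg]; split=> // k; apply: IH; exact: dg.
Qed.

Lemma bfamn_cst n (c : R) : bfamn n (fun _ _ => c).
Proof.
elim: n c => [|n IH] c.
  split=> //; first by move=> e _; exact: (smooth_on_cst b oD).
  by exists `|c|.
split; [by move=> e _; exact: (smooth_on_cst b oD) | by exists `|c| | ].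
by move=> k; apply: bfamn_eq (IH 0) => e x _ _; rewrite derive_cst.
Qed.

Lemma bfamnD n g1 g2 : bfamn n g1 -> bfamn n g2 ->
  bfamn n (fun e x => g1 e x + g2 e x).
Proof.
elim: n g1 g2 => [|n IH] g1 g2 [s1 [B1 H1] d1] [s2 [B2 H2] d2]; split.
- by move=> e e01; apply: (smooth_onD b oD); [exact: s1 | exact: s2].
- exists (B1 + B2) => e x e01 Dx; apply: (le_trans (ler_normD _ _)).
  by apply: lerD; [exact: H1 | exact: H2].
- by [].
- by move=> e e01; apply: (smooth_onD b oD); [exact: s1 | exact: s2].
- exists (B1 + B2) => e x e01 Dx; apply: (le_trans (ler_normD _ _)).
  by apply: lerD; [exact: H1 | exact: H2].
- move=> k; apply: bfamn_eq (IH _ _ (d1 k) (d2 k)) => e x e01 Dx.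
  by rewrite deriveD; [reflexivity | exact: smooth_on_derivable (s1 e e01) Dx
    | exact: smooth_on_derivable (s2 e e01) Dx].
Qed.

Lemma bfamnM n g1 g2 : bfamn n g1 -> bfamn n g2 ->
  bfamn n (fun e x => g1 e x * g2 e x).
Proof.
elim: n g1 g2 => [|n IH] g1 g2 b1 b2;
  have := b1; have := b2; move=> [s2 [B2 H2] d2] [s1 [B1 H1] d1]; split.
- by move=> e e01; apply: (smooth_onM b oD); [exact: s1 | exact: s2].
- exists (B1 * B2) => e x e01 Dx; rewrite normrM.
  by apply: ler_pM => //; [exact: H1 | exact: H2].
- by [].
- by move=> e e01; apply: (smooth_onM b oD); [exact: s1 | exact: s2].
- exists (B1 * B2) => e x e01 Dx; rewrite normrM.
  by apply: ler_pM => //; [exact: H1 | exact: H2].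
- move=> k; apply: bfamn_eq (bfamnD (IH _ _ (bfamnW b1) (d2 k))
    (IH _ _ (bfamnW b2) (d1 k))) => e x e01 Dx.
  by rewrite deriveM; [reflexivity | exact: smooth_on_derivable (s1 e e01) Dx
    | exact: smooth_on_derivable (s2 e e01) Dx].
Qed.

Lemma bfamn_step n : bfamn n (fun e _ => e).
Proof.
have sm (e : R) : smooth_on D (fun _ : V => e) by exact: (smooth_on_cst b oD).
have bd : exists B : R, forall (e : R) x, 0 < e <= 1 -> D x -> `|e| <= B.
  by exists 1 => e x /andP[e0 e1] _; rewrite gtr0_norm.
case: n => [|n]; split=> // k.
by apply: bfamn_eq (bfamn_cst n 0) => e x _ _; rewrite derive_cst.
Qed.

Lemma bfam_cst (c : R) : bfam (fun _ _ => c).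
Proof. by move=> n; exact: bfamn_cst. Qed.

Lemma bfamD g1 g2 : bfam g1 -> bfam g2 -> bfam (fun e x => g1 e x + g2 e x).
Proof. by move=> h1 h2 n; exact: bfamnD. Qed.

Lemma bfamM g1 g2 : bfam g1 -> bfam g2 -> bfam (fun e x => g1 e x * g2 e x).
Proof. by move=> h1 h2 n; exact: bfamnM. Qed.

Lemma bfam_eq g g' : (forall (e : R) x, 0 < e <= 1 -> D x -> g e x = g' e x) ->
  bfam g -> bfam g'.
Proof. by move=> E h n; exact: bfamn_eq (h n). Qed.

Lemma bfam_step : bfam (fun e _ => e).
Proof. by move=> n; exact: bfamn_step. Qed.

Lemma bfam_derive g (k : bidx b) : bfam g -> bfam (fun e => 'D_(bvec k) (g e)).
Proof. by move=> h n; have [_ _] := h n.+1; apply. Qed.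

Lemma bfam_smooth g e : bfam g -> 0 < e <= 1 -> smooth_on D (g e).
Proof. by move=> h; exact: (bfamn_smooth (h 0)). Qed.

Lemma bfam_bound g : bfam g ->
  exists B : R, forall (e : R) x, 0 < e <= 1 -> D x -> `|g e x| <= B.
Proof. by move=> h; exact: (bfamn_bound (h 0)). Qed.

Lemma bfam_finite_bound (I : finType) (G : I -> R -> V -> R) :
  (forall i, bfam (G i)) -> exists2 B : R, 0 <= B &
    forall i (e : R) x, 0 < e <= 1 -> D x -> `|G i e x| <= B.
Proof.
move=> bG; have [B HB] := choice (fun i => bfam_bound (bG i)).
exists (\sum_i `|B i|); first by rewrite sumr_ge0.
move=> i e x e01 Dx; apply: (le_trans (HB i e x e01 Dx)).
apply: (le_trans (ler_norm _)); rewrite (bigD1 i) //= lerDl.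
by rewrite sumr_ge0.
Qed.

Lemma bfam_const_of_bounded (g : V -> R) : smooth_on D g ->
  (forall vs : seq (bidx b), exists B : R, forall x, D x ->
    `|iter_der (map (@bvec _ _ b) vs) g x| <= B) -> bfam (fun _ => g).
Proof.
move=> sg Hg n; elim: n g sg Hg => [|n IH] g sg Hg.
  by split=> //; have [B HB] := Hg [::]; exists B => e x _; exact: HB.
split; first by [].
  by have [B HB] := Hg [::]; exists B => e x _; exact: HB.
move=> k; apply: IH; first exact: smooth_on_derive.
move=> vs; have [B HB] := Hg (rcons vs k); exists B => x Dx.
by have := HB x Dx; rewrite map_rcons iter_der_rcons.
Qed.

End BoundedFamilies.

Section Ultralimit.
Variables (R : realType) (U : set_system nat).
Hypothesis UU : UltraFilter U.
Implicit Types a : nat -> R.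

(** Passing to the limit along an ultrafilter needs bounds only, no Cauchy
    estimate. *)
Lemma ultralimit_ex a (B : R) : (\forall m \near U, `|a m| <= B) ->
  exists l : R, a @ U --> l.
Proof.
move=> aB.
have PU : ProperFilter U by exact: ultra_proper.
have FU : Filter U by exact: filter_filter.
have [p [_ cp]] : `[- B, B]%classic `&` cluster (a @ U) !=set0.
  apply: segment_compact; rewrite /fmap /=; apply: filterS aB => m /=.
  by rewrite in_itv /= ler_norml.
exists p => N Np.
have [//|H] := in_ultra_setVsetC (a @^-1` N) UU.
have [q [qN' qN]] := cp (~` N) N H Np.
by [].
Qed.

End Ultralimit.

Section MeanBound.
Variables (R : realType) (V : normedModType R) (b : fbasis V) (D : set V).
Hypothesis oD : open D.
Implicit Types g : V -> R.

Lemma mean_bound g (B : R) x v : smooth_on D g ->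
  (forall (k : bidx b) y, D y -> `|'D_(bvec k) g y| <= B) ->
  (forall t : R, 0 <= t <= 1 -> D (t *: v + x)) ->
  `|g (v + x) - g x| <= (\sum_(k : bidx b) `|bcoord k v|) * B.
Proof.
move=> sg gB Dv.
have [t t01 ->] := @mean_value _ _ g x v
  (fun t t01 => smooth_on_derivable sg (Dv t t01) (v := v)).
have t01' : 0 <= t <= 1 by case/andP: t01 => /ltW -> /ltW ->.
rewrite (deriveEcoord b oD v sg (Dv t t01')).
apply: (le_trans (ler_norm_sum _ _ _)); rewrite mulr_suml.
apply: ler_sum => k _; rewrite normrM ler_wpM2l //; apply: gB; exact: Dv.
Qed.

Lemma taylor_bound g (B : R) x v : smooth_on D g ->
  (forall y, D y -> `|'D_v ('D_v g) y| <= B) ->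
  (forall t : R, 0 <= t <= 1 -> D (t *: v + x)) ->
  `|g (v + x) - g x - 'D_v g x| <= B.
Proof.
move=> sg gB Dv.
have [t t01 ->] := @mean_value _ _ g x v
  (fun t t01 => smooth_on_derivable sg (Dv t t01) (v := v)).
have t01' : 0 <= t <= 1 by case/andP: t01 => /ltW -> /ltW ->.
have Ds (s : R) : 0 <= s <= 1 -> D (s *: (t *: v) + x).
  move=> /andP[s0 s1]; rewrite scalerA; apply: Dv.
  case/andP: t01' => t0 t1; rewrite mulr_ge0 //=.
  by rewrite mulr_ile1.
have ds := smooth_on_derive v sg.
have [s s01] := @mean_value _ _ ('D_v g) x (t *: v)
  (fun s s01 => smooth_on_derivable ds (Ds s s01) (v := t *: v)).
move=> ->.
have s01' : 0 <= s <= 1 by case/andP: s01 => /ltW -> /ltW ->.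
have [_ ->] := is_deriveZdir t (smooth_on_is_derive v ds (Ds s s01')).
case/andP: t01' => t0 t1; rewrite normrM ger0_norm //.
apply: le_trans (gB _ (Ds s s01')).
by rewrite ler_piMl.
Qed.

End MeanBound.

(** * A discrete scheme for transport equations *)

Section Scheme.
Variables (R : realType) (V : normedModType R) (b : fbasis V) (D : set V).
Hypothesis oD : open D.
Variable X : V -> V.
Hypothesis sX : forall k : bidx b, bfam b D (fun _ x => bcoord k (X x)).

(** A step backwards along [X]. On the domains used below [X] points outward,
    so that the step stays inside. *)
Definition euler_step (e : R) (x : V) : V := (- e) *: X x + x.
Local Notation N := euler_step.
Hypothesis N_in : forall e x, 0 < e <= 1 -> D x -> D (N e x).

Lemma bcoord_step (k : bidx b) e x :
  bcoord k (N e x) = bcoord k x - e * bcoord k (X x).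
Proof. by rewrite bcoordD bcoordZ mulNr addrC. Qed.

Lemma smooth_step (k : bidx b) e : 0 < e <= 1 ->
  smooth_on D (fun x => bcoord k (N e x)).
Proof.
move=> e01.
have H : smooth_on D (fun x => bcoord k x - e * bcoord k (X x)).
  apply: (smooth_onB b oD); first exact: smooth_on_bcoord.
  apply: (smooth_onM b oD); first exact: (smooth_on_cst b oD).
  exact: (bfam_smooth (sX k) e01).
by apply: smooth_on_eq H => // x _; rewrite bcoord_step.
Qed.

Lemma derive_step (i k : bidx b) e x : 0 < e <= 1 -> D x ->
  'D_(bvec k) (fun y => bcoord i (N e y)) x =
    (k == i)%:R - e * 'D_(bvec k) (fun y => bcoord i (X y)) x.
Proof.
move=> e01 Dx.
have E : (fun y => bcoord i (N e y)) = fun y => bcoord i y - e * bcoord i (X y).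
  by apply/funext => y; exact: bcoord_step.
rewrite E; have d1 := is_derive_bcoord i x (bvec k).
have d2 := smooth_on_is_derive (bvec k) (bfam_smooth (sX i) e01) Dx.
have [_ ->] : is_derive x (bvec k) (fun y => bcoord i y - e * bcoord i (X y))
   (bcoord i (bvec k) - e * 'D_(bvec k) (fun y => bcoord i (X y)) x).
  by apply: is_deriveB; apply: is_deriveZ.
by rewrite bcoord_bvec eq_sym.
Qed.

Section System.
Variables (J : finType) (A : R -> J -> J -> V -> R) (f : R -> J -> V -> R).
Implicit Types u : J -> V -> R.

Definition step_weight e (j l : J) x : R := (j == l)%:R - e * A e j l x.

(** A fixed point of this map solves [D_X u + A u = f] up to an error that is
    small compared to [e], since [u (x - e X x)] is [u x - e D_X u x] to first
    order. *)
Definition scheme_step e u (j : J) (x : V) : R :=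
  \sum_l step_weight e j l x * u l (N e x) + e * f e j x.

Definition scheme e K : J -> V -> R := iter K (scheme_step e) (fun _ _ => 0).

(** The damping of the equation, as it appears in the scheme. *)
Definition stable c e0 := [/\ 0 < c, 0 < e0 <= 1 &
  forall e x j, 0 < e <= e0 -> D x ->
    \sum_l `|step_weight e j l x| <= 1 - c * e].

Hypothesis bA : forall j l, bfam b D (fun e => A e j l).
Hypothesis bf : forall j, bfam b D (fun e => f e j).

Lemma le_stable c e0 e : stable c e0 -> 0 < e <= e0 -> 0 < e <= 1.
Proof. by case=> _ /andP[_ e01] _ /andP[-> /le_trans ->]. Qed.

(** The bound reproduces itself: [(1 - c e) (F / c) + e F = F / c]. *)
Lemma scheme_bound c e0 F : stable c e0 -> 0 <= F ->
  (forall j e x, 0 < e <= 1 -> D x -> `|f e j x| <= F) ->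
  forall e K j x, 0 < e <= e0 -> D x -> `|scheme e K j x| <= F / c.
Proof.
move=> st F0 fF e K j x ee Dx; have e01 := le_stable st ee.
case: st => c0 _ st; have e0' : 0 <= e by case/andP: ee => /ltW.
elim: K j x Dx => [|K IH] j x Dx /=.
  by rewrite normr0 divr_ge0 // ltW.
apply: (le_trans (ler_normD _ _)).
have -> : F / c = (1 - c * e) * (F / c) + e * F.
  by field; rewrite gt_eqF.
apply: lerD; last first.
  by rewrite normrM ger0_norm // ler_wpM2l //; exact: fF.
apply: (le_trans (ler_norm_sum _ _ _)).
apply: (@le_trans _ _ (\sum_l `|step_weight e j l x| * (F / c))).
  apply: ler_sum => l _; rewrite normrM ler_wpM2l //; apply: IH; exact: N_in.
by rewrite -mulr_suml ler_wpM2r ?divr_ge0 ?(ltW c0) //; exact: st.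
Qed.

(** The difference of consecutive iterates satisfies the homogeneous recursion. *)
Lemma scheme_diff c e0 F : stable c e0 -> 0 <= F ->
  (forall j e x, 0 < e <= 1 -> D x -> `|f e j x| <= F) ->
  forall e K j x, 0 < e <= e0 -> D x ->
    `|scheme e K.+1 j x - scheme e K j x| <= (1 - c * e) ^+ K * (e * F).
Proof.
move=> st F0 fF e K j x ee Dx; have e01 := le_stable st ee.
case: st => c0 _ st; have e0' : 0 <= e by case/andP: ee => /ltW.
elim: K j x Dx => [|K IH] j x Dx.
  rewrite expr0 mul1r /= subr0 /scheme_step big1 => [|l _]; last by rewrite mulr0.
  by rewrite add0r normrM ger0_norm // ler_wpM2l //; exact: fF.
have -> : scheme e K.+2 j x - scheme e K.+1 j x = \sum_l step_weight e j l x *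
    (scheme e K.+1 l (N e x) - scheme e K l (N e x)).
  rewrite [scheme e K.+2]iterS [in X in _ - X j x]/scheme iterS -/(scheme e K).
  rewrite /scheme_step -/(scheme e K.+1) opprD addrACA subrr addr0 -sumrB.
  by apply: eq_bigr => l _; rewrite mulrBr.
apply: (le_trans (ler_norm_sum _ _ _)).
apply: (@le_trans _ _ (\sum_l `|step_weight e j l x| * ((1 - c * e) ^+ K * (e * F)))).
  apply: ler_sum => l _; rewrite normrM ler_wpM2l //; apply: IH; exact: N_in.
rewrite -mulr_suml exprS -mulrA ler_wpM2r //; last exact: st.
apply: mulr_ge0; last exact: mulr_ge0.
apply: exprn_ge0; apply: le_trans (st e x j ee Dx).
by rewrite sumr_ge0.
Qed.

Lemma smooth_weight e j l : 0 < e <= 1 -> smooth_on D (step_weight e j l).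
Proof.
move=> e01; apply: (smooth_onB b oD); first exact: (smooth_on_cst b oD).
apply: (smooth_onM b oD); first exact: (smooth_on_cst b oD).
exact: (bfam_smooth (bA j l) e01).
Qed.

Lemma smooth_comp_step e (g : V -> R) : 0 < e <= 1 -> smooth_on D g ->
  smooth_on D (fun x => g (N e x)).
Proof.
move=> e01; apply: (smooth_on_comp b (bW := b) oD oD) => [x Dx|k].
  exact: N_in.
exact: smooth_step.
Qed.

Lemma scheme_smooth e K j : 0 < e <= 1 -> smooth_on D (scheme e K j).
Proof.
move=> e01; elim: K j => [|K IH] j /=; first exact: (smooth_on_cst b oD).
apply: (smooth_onD b oD).
  apply: (smooth_on_sum b oD) => l; apply: (smooth_onM b oD).
    exact: smooth_weight.
  exact: smooth_comp_step.
apply: (smooth_onM b oD); first exact: (smooth_on_cst b oD).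
exact: (bfam_smooth (bf j) e01).
Qed.

Lemma derive_comp_step e (g : V -> R) k x : 0 < e <= 1 -> smooth_on D g -> D x ->
  'D_(bvec k) (fun y => g (N e y)) x =
   \sum_(i : bidx b) ((k == i)%:R - e * 'D_(bvec k) (fun y => bcoord i (X y)) x)
     * 'D_(bvec i) g (N e x).
Proof.
move=> e01 sg Dx.
have [_ ->] := @is_derive_smooth_comp _ _ _ b D D (N e) oD
   (fun x Dx => N_in e01 Dx) (fun l => smooth_step l e01) g x (bvec k) sg Dx.
by apply: eq_bigr => i _; rewrite derive_step // mulrC.
Qed.

Lemma derive_scheme e K j k x : 0 < e <= 1 -> D x ->
  'D_(bvec k) (scheme e K.+1 j) x =
   \sum_l (- (e * 'D_(bvec k) (A e j l) x)) * scheme e K l (N e x) +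
   \sum_l step_weight e j l x * (\sum_(i : bidx b)
     ((k == i)%:R - e * 'D_(bvec k) (fun y => bcoord i (X y)) x)
     * 'D_(bvec i) (scheme e K l) (N e x)) +
   e * 'D_(bvec k) (f e j) x.
Proof.
move=> e01 Dx.
have dw l : is_derive x (bvec k) (step_weight e j l) (- (e * 'D_(bvec k) (A e j l) x)).
  rewrite -[X in is_derive _ _ _ X]add0r; apply: is_deriveB.
  have da := smooth_on_is_derive (bvec k) (bfam_smooth (bA j l) e01) Dx.
  by apply: is_deriveZ.
have dc l : is_derive x (bvec k) (fun y => scheme e K l (N e y)) (\sum_(i : bidx b)
     ((k == i)%:R - e * 'D_(bvec k) (fun y => bcoord i (X y)) x)
     * 'D_(bvec i) (scheme e K l) (N e x)).
  rewrite -(derive_comp_step k e01 (scheme_smooth K l e01) Dx).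
  apply: smooth_on_is_derive Dx; apply: smooth_comp_step => //.
  exact: scheme_smooth.
have df := smooth_on_is_derive (bvec k) (bfam_smooth (bf j) e01) Dx.
have ds : is_derive x (bvec k)
   (fun y => \sum_l step_weight e j l y * scheme e K l (N e y))
   (\sum_l (step_weight e j l x * (\sum_(i : bidx b)
     ((k == i)%:R - e * 'D_(bvec k) (fun y => bcoord i (X y)) x)
     * 'D_(bvec i) (scheme e K l) (N e x))
     + scheme e K l (N e x) * (- (e * 'D_(bvec k) (A e j l) x)))).
  have : forall s : seq J, is_derive x (bvec k)
   (fun y => \sum_(l <- s) step_weight e j l y * scheme e K l (N e y))
   (\sum_(l <- s) (step_weight e j l x * (\sum_(i : bidx b)
     ((k == i)%:R - e * 'D_(bvec k) (fun y => bcoord i (X y)) x)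
     * 'D_(bvec i) (scheme e K l) (N e x))
     + scheme e K l (N e x) * (- (e * 'D_(bvec k) (A e j l) x)))).
    elim=> [|l s IH].
      rewrite big_nil (_ : (fun _ => _) = cst 0); first exact: is_derive_cst.
      by apply/funext => y; rewrite big_nil.
    rewrite big_cons (_ : (fun _ => _) = (step_weight e j l * (fun y => scheme e K l (N e y))) +
      fun y => \sum_(l <- s) step_weight e j l y * scheme e K l (N e y)).
      by apply: is_deriveD; apply: is_deriveM.
    by apply/funext => y; rewrite big_cons.
  by apply.
have dz : is_derive x (bvec k) (fun y => e * f e j y) (e * 'D_(bvec k) (f e j) x).
  by apply: is_deriveZ.
have [_ E] := is_deriveD ds dz.
apply: (eq_trans E).
rewrite big_split /=; congr (_ + _); rewrite addrC; congr (_ + _).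
by apply: eq_bigr => l _; rewrite mulrC.
Qed.

End System.

Section Prolongation.
Variables (J : finType) (A : R -> J -> J -> V -> R) (f : R -> J -> V -> R).
Hypothesis bA : forall j l, bfam b D (fun e => A e j l).
Hypothesis bf : forall j, bfam b D (fun e => f e j).
Variable w : bidx b -> R.
Hypothesis w0 : forall k, 0 < w k.

Let J' := (J + J * bidx b)%type.
Let dX (k i : bidx b) x := 'D_(bvec k) (fun y => bcoord i (X y)) x.

(** The components [inr (j, k)] stand for the derivative of the component [j]
    along the basis vector [k], multiplied by [w k]. The term of order [e] in the
    last case arises because the step matrix of the derivatives is the product of
    the step matrix of the values and the Jacobian of the step. *)
Definition prolong_coef (e : R) (j' l' : J') (x : V) : R :=
  match j', l' with
  | inl j, inl l => A e j l x
  | inl j, inr _ => 0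
  | inr (j, k), inl l => w k * 'D_(bvec k) (A e j l) x
  | inr (j, k), inr (l, i) =>
      A e j l x * (k == i)%:R + (j == l)%:R * dX k i x * (w k / w i)
        - e * (A e j l x * dX k i x * (w k / w i))
  end.

Definition prolong_rhs (e : R) (j' : J') (x : V) : R :=
  match j' with
  | inl j => f e j x
  | inr (j, k) => w k * 'D_(bvec k) (f e j) x
  end.

Lemma bfam_prolong_coef j' l' : bfam b D (fun e => prolong_coef e j' l').
Proof.
case: j' l' => [j|[j k]] [l|[l i]] /=.
- exact: bA.
- exact: (bfam_cst b oD).
- apply: (bfamM oD); first exact: (bfam_cst b oD).
  exact: bfam_derive.
- have bX : bfam b D (fun _ => dX k i) by exact: bfam_derive.
  have bc (c : R) : bfam b D (fun _ _ => c) by exact: (bfam_cst b oD).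
  have bAX : bfam b D (fun e x => e * (A e j l x * dX k i x * (w k / w i))).
    apply: (bfamM oD); first exact: (bfam_step b oD).
    by apply: (bfamM oD) => //; apply: (bfamM oD).
  have bAX' : bfam b D (fun e x => -1 * (e * (A e j l x * dX k i x * (w k / w i)))).
    exact: (bfamM oD).
  have b2 : bfam b D (fun (e : R) x => A e j l x * (k == i)%:R + (j == l)%:R * dX k i x * (w k / w i)).
    apply: (bfamD oD); first exact: (bfamM oD).
    by apply: (bfamM oD) => //; apply: (bfamM oD).
  by apply: (bfam_eq oD _ (bfamD oD b2 bAX')) => e x _ _; rewrite mulN1r.
Qed.

Lemma bfam_prolong_rhs j' : bfam b D (fun e => prolong_rhs e j').
Proof.
case: j' => [j|[j k]] /=; first exact: bf.
by apply: (bfamM oD); [exact: (bfam_cst b oD) | exact: bfam_derive].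
Qed.

Lemma prolong_weight_mixed e j k l x :
  step_weight prolong_coef e (inr (j, k)) (inl l) x =
    - (e * (w k * 'D_(bvec k) (A e j l) x)).
Proof. by rewrite /step_weight /= sub0r. Qed.

Lemma prolong_weight_top e j k l i x :
  step_weight prolong_coef e (inr (j, k)) (inr (l, i)) x =
    step_weight A e j l x * ((k == i)%:R - e * dX k i x) * (w k / w i).
Proof.
rewrite /step_weight /=.
have -> : (inr (j, k) == inr (l, i) :> J') = (j == l) && (k == i) by [].
have [->|ki] := eqVneq k i.
  by rewrite andbT mulfV ?gt_eqF //=; ring.
by rewrite andbF /=; ring.
Qed.

Lemma prolong_scheme e K x : 0 < e <= 1 -> D x ->
  (forall j, scheme prolong_coef prolong_rhs e K (inl j) x = scheme A f e K j x) /\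
  (forall j k, scheme prolong_coef prolong_rhs e K (inr (j, k)) x =
     w k * 'D_(bvec k) (scheme A f e K j) x).
Proof.
move=> e01; elim: K x => [|K IH] x Dx.
  split=> // j k; rewrite /scheme /= .
  by rewrite (_ : (fun _ : V => 0) = cst 0) // derive_cst mulr0.
have [IH1 IH2] := IH _ (N_in e01 Dx).
split=> [j|j k].
  rewrite [scheme prolong_coef _ _ _]iterS [in RHS]/scheme iterS.
  rewrite /scheme_step -/(scheme _ _ e K) big_sumType /=.
  rewrite [X in _ + X + _]big1 ?addr0 => [|[l i] _]; last first.
    by rewrite /step_weight /= mulr0 subr0 mul0r.
  by congr (_ + _); apply: eq_bigr => l _; rewrite IH1.
rewrite (derive_scheme bA bf K j k e01 Dx) !mulrDr.
rewrite [scheme prolong_coef _ _ _]iterS.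
rewrite /scheme_step -/(scheme _ _ e K) big_sumType /=.
congr (_ + _ + _).
- rewrite mulr_sumr; apply: eq_bigr => l _; rewrite IH1 prolong_weight_mixed.
  by ring.
- rewrite mulr_sumr.
  rewrite [RHS](eq_bigr (fun l => \sum_(i : bidx b)
     step_weight prolong_coef e (inr (j, k)) (inr (l, i)) x *
     scheme prolong_coef prolong_rhs e K (inr (l, i)) (N e x))); last first.
    move=> l _; rewrite mulrA mulr_sumr; apply: eq_bigr => i _.
    rewrite prolong_weight_top IH2 /dX.
    have wi0 : w i != 0 by rewrite gt_eqF.
    by field.
  by rewrite pair_big /=; apply: eq_bigr => -[l i] _.
- by ring.
Qed.

End Prolongation.

(** In suitably rescaled coordinates, backward steps along the field expand by
    an arbitrarily small rate. *)
Hypothesis HX : forall mu : R, 0 < mu ->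
  exists2 w : bidx b -> R, (forall k, 0 < w k) &
    forall e x k, 0 < e <= 1 / 2 -> D x ->
      \sum_(i : bidx b)
        `|(k == i)%:R - e * 'D_(bvec k) (fun y => bcoord i (X y)) x| * (w k / w i)
      <= 1 + mu * e.

(** Small weights make the coupling of the derivatives to the values
    negligible. The growth caused by the Jacobian of the step is limited to half
    of the damping rate by the hypothesis on [X]; a quarter of the rate remains. *)
Lemma prolong_stable (J : finType) (A : R -> J -> J -> V -> R) c e0 :
  (forall j l, bfam b D (fun e => A e j l)) -> stable A c e0 ->
  exists w c' e0', (forall k, 0 < w k) /\ stable (prolong_coef A w) c' e0'.
Proof.
move=> bA st; have [c0 /andP[e00 e01] st'] := st.
have c20 : 0 < c / 2 by rewrite divr_gt0.
have [w w0 Hw] := HX c20.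
have [M M0 HM] := bfam_finite_bound
  (G := fun p : J * J * bidx b => fun e => 'D_(bvec p.2) (A e p.1.1 p.1.2))
  (fun p => bfam_derive p.2 (bA p.1.1 p.1.2)).
pose W := \sum_k w k.
have W0 : 0 <= W by rewrite sumr_ge0 // => k _; exact: ltW.
pose Q := W * (#|J|%:R * M) + 1.
have Q0 : 0 < Q by rewrite ltr_wpDl // mulr_ge0 // mulr_ge0.
have [th thE th0] : exists2 th, th = c / 4 / Q & 0 < th.
  by exists (c / 4 / Q); rewrite // !divr_gt0.
exists (fun k => th * w k), (c / 4), (Num.min e0 (1 / 2)).
split; first by move=> k; rewrite mulr_gt0.
split; [by rewrite divr_gt0 | | ].
  rewrite lt_min e00 divr_gt0 //= ge_min.
  by rewrite e01.
move=> e x j' /andP[e_0]; rewrite le_min => /andP[ee0 e12] Dx.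
have ee : 0 < e <= e0 by rewrite e_0.
have e_1 : 0 < e <= 1 := le_stable st ee.
rewrite big_sumType /=.
case: j' => [j|[j k]].
  rewrite [X in _ + X]big1 ?addr0 => [|[l i] _]; last first.
    by rewrite /step_weight /= mulr0 subr0 normr0.
  apply: (le_trans (st' e x j ee Dx)).
  by rewrite lerB // ler_wpM2r ?(ltW e_0) // ler_pdivrMr // ler_peMr ?(ltW c0) // ler1n.
have H1 : \sum_l `|step_weight (prolong_coef A (fun k => th * w k)) e (inr (j, k)) (inl l) x|
    <= c / 4 * e.
  apply: (@le_trans _ _ (\sum_(l : J) e * (th * w k * M))).
    apply: ler_sum => l _; rewrite prolong_weight_mixed normrN.
    have tw0 : 0 <= th * w k by rewrite mulr_ge0 // ltW.
    rewrite normrM gtr0_norm // ler_pM2l // normrM ger0_norm //.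
    by apply: (ler_wpM2l tw0); exact: (HM (j, l, k)).
  rewrite sumr_const -[_ *+ _]mulr_natl.
  have -> : #|J|%:R * (e * (th * w k * M)) = e * (th * (w k * (#|J|%:R * M))) by ring.
  rewrite mulrC ler_pM2r // thE -mulrA ler_piMr ?divr_ge0 ?(ltW c0) //.
  rewrite ler_pdivrMl // mulr1 /Q.
  apply: ler_wpDr => //; rewrite ler_wpM2r ?mulr_ge0 //.
  by rewrite /W (bigD1 k) //= lerDl sumr_ge0 // => i _; exact: ltW.
have H2 : \sum_(p : J * bidx b)
    `|step_weight (prolong_coef A (fun k => th * w k)) e (inr (j, k)) (inr p) x|
    <= (1 - c * e) * (1 + c / 2 * e).
  rewrite (eq_bigr (fun p => `|step_weight A e j p.1 x| *
     (`|(k == p.2)%:R - e * 'D_(bvec k) (fun y => bcoord p.2 (X y)) x| *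
      (w k / w p.2)))); last first.
    move=> [l i] _; rewrite prolong_weight_top; last by move=> ?; rewrite mulr_gt0.
    rewrite !normrM -mulrA; congr (_ * (_ * _)) => /=.
    rewrite normfV !normrM !gtr0_norm ?mulr_gt0 //.
    have wi0 : w i != 0 by rewrite gt_eqF.
    have tn0 : th != 0 by rewrite gt_eqF.
    by field; rewrite wi0 tn0.
  rewrite -(pair_big xpredT xpredT (fun l i => `|step_weight A e j l x| *
     (`|(k == i)%:R - e * 'D_(bvec k) (fun y => bcoord i (X y)) x| *
      (w k / w i)))) /=.
  apply: (@le_trans _ _ (\sum_l `|step_weight A e j l x| * (1 + c / 2 * e))).
    apply: ler_sum => l _; rewrite -mulr_sumr ler_wpM2l //.
    by apply: Hw => //; rewrite e_0.
  have t0 : 0 <= 1 + c / 2 * e by rewrite addr_ge0 // mulr_ge0 // ltW.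
  by rewrite -mulr_suml; apply: (ler_wpM2r t0); exact: st'.
apply: (le_trans (lerD H1 H2)).
have H : 0 <= c / 2 * e * (c * e) by rewrite !mulr_ge0 ?ltW.
rewrite -subr_ge0.
have -> // : 1 - c / 4 * e - (c / 4 * e + (1 - c * e) * (1 + c / 2 * e)) =
  c / 2 * e * (c * e) by field.
Qed.

Lemma iter_der_scale (vs : seq V) (g : V -> R) (a : R) x : smooth_on D g -> D x ->
  iter_der vs (fun y => a * g y) x = a * iter_der vs g x.
Proof.
move=> sg Dx; elim: vs x Dx => [//|v vs IH] x Dx /=.
rewrite (eq_on_derive oD IH v Dx).
have sd := smooth_on_iter_der vs sg.
by rewrite deriveMl; [reflexivity | exact: smooth_on_derivable sd Dx].
Qed.

(** A derivative of the scheme is a component of its prolongation, which is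
    again stable; this lowers the order by one. *)
Lemma scheme_iter_der_bound (vs : seq (bidx b)) :
  forall (J : finType) (A : R -> J -> J -> V -> R) (f : R -> J -> V -> R) c e0,
  (forall j l, bfam b D (fun e => A e j l)) ->
  (forall j, bfam b D (fun e => f e j)) ->
  stable A c e0 ->
  exists B e1, 0 < e1 <= 1 /\ forall e K j x, 0 < e <= e1 -> D x ->
    `|iter_der (map (@bvec _ _ b) vs) (scheme A f e K j) x| <= B.
Proof.
elim/last_ind: vs => [|vs k IH] J A f c e0 bA bf st.
  have [F F0 HF] := bfam_finite_bound (G := fun j e => f e j) bf.
  exists (F / c), e0; split; first by case: st.
  by move=> e K j x ee Dx; exact: (scheme_bound st F0 HF).
have [w [c' [e0' [w0 st']]]] := prolong_stable bA st.
have [B [e1 [/andP[e10 e11] HB]]] := IH _ _ _ _ _ (bfam_prolong_coef bA w)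
  (bfam_prolong_rhs bf w) st'.
have [W W0 HW] : exists2 W, 0 < W & forall k, (w k)^-1 <= W.
  exists (\sum_k (w k)^-1 + 1).
    by rewrite ltr_wpDl // sumr_ge0 // => i _; rewrite invr_ge0 ltW.
  move=> i; rewrite (bigD1 i) //= -addrA lerDl addr_ge0 // sumr_ge0 // => j _.
  by rewrite invr_ge0 ltW.
exists (W * B), e1; split; first by rewrite e10.
move=> e K j x ee Dx.
have e01 : 0 < e <= 1 by case/andP: ee => -> /le_trans ->.
have sm := scheme_smooth bA bf K j e01.
rewrite map_rcons iter_der_rcons.
have E y : D y -> 'D_(bvec k) (scheme A f e K j) y = (w k)^-1 *
    scheme (prolong_coef A w) (prolong_rhs f w) e K (inr (j, k)) y.
  move=> Dy; have [_ ->] := prolong_scheme bA bf w0 K e01 Dy.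
  by rewrite mulKf // gt_eqF.
have sm' := scheme_smooth (bfam_prolong_coef bA w) (bfam_prolong_rhs bf w)
  K (inr (j, k)) e01.
rewrite (eq_on_iter_der _ oD E Dx) (iter_der_scale _ _ sm' Dx).
rewrite normrM gtr0_norm ?invr_gt0 //; apply: ler_pM => //.
  by rewrite invr_ge0 ltW.
exact: HB.
Qed.

Section Limit.
Variables (J : finType) (A : J -> J -> V -> R) (f : J -> V -> R) (c e0 : R).
Hypothesis bA : forall j l, bfam b D (fun _ => A j l).
Hypothesis bf : forall j, bfam b D (fun _ => f j).
Hypothesis st : stable (fun _ => A) c e0.

(* The step [e] is the harmonic sequence and the number of steps [e ^- 2]: the
   elapsed time [1 / e] tends to infinity. *)
Let u (m : nat) : J -> V -> R :=
  scheme (fun _ => A) (fun _ => f) (harmonic m) (m.+1 * m.+1).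

Variable U : set_system nat.
Hypothesis UU : UltraFilter U.
Hypothesis Uoo : \oo `<=` U.

Let PU : ProperFilter U. Proof. exact: ultra_proper. Qed.
Let FU : Filter U. Proof. exact: filter_filter. Qed.

Lemma harmonic01 m : 0 < (harmonic m : R) <= 1.
Proof.
by rewrite harmonic_gt0 /= /harmonic invf_le1 // ler1n.
Qed.

Lemma u_smooth m j : smooth_on D (u m j).
Proof. exact: (scheme_smooth bA bf _ j (harmonic01 m)). Qed.

Lemma harmonic_U : (harmonic m : R) @[m --> U] --> (0 : R).
Proof.
have := @cvg_harmonic R; apply: cvg_trans => P HP; exact: Uoo.
Qed.

Lemma u_bounds (vs : seq (bidx b)) : exists B, 0 <= B /\
  \forall m \near U, forall j x, D x ->
    `|iter_der (map (@bvec _ _ b) vs) (u m j) x| <= B.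
Proof.
have [B [e1 [/andP[e10 e11] HB]]] := scheme_iter_der_bound vs bA bf st.
exists `|B|; split=> //.
have : \forall m \near U, (harmonic m : R) < e1.
  by apply: (cvgr_lt (0:R)) => //; exact: harmonic_U.
apply: filterS => m hm j x Dx; apply: le_trans (ler_norm _).
by apply: HB => //; case/andP: (harmonic01 m) => -> _; exact: ltW.
Qed.

Definition ulim (vs : seq (bidx b)) (j : J) (x : V) : R :=
  lim (iter_der (map (@bvec _ _ b) vs) (u m j) x @[m --> U]).

Lemma ulimP vs j x : D x ->
  iter_der (map (@bvec _ _ b) vs) (u m j) x @[m --> U] --> ulim vs j x.
Proof.
move=> Dx; have [B [_ HB]] := u_bounds vs.
have [l Hl] : exists l : R,
    (fun m => iter_der (map (@bvec _ _ b) vs) (u m j) x) @ U --> l.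
  apply: (ultralimit_ex UU (B := B)).
  by apply: filterS HB => m; apply.
by apply/cvg_ex; exists l.
Qed.

Lemma ulim_continuous vs j x : D x -> {for x, continuous (ulim vs j)}.
Proof.
move=> Dx.
have [B [B0 HB]] : exists B, 0 <= B /\ \forall m \near U,
    forall (k : bidx b) y, D y ->
    `|'D_(bvec k) (iter_der (map (@bvec _ _ b) vs) (u m j)) y| <= B.
  have HH k := u_bounds (k :: vs).
  have [Bk HBk] := choice HH.
  exists (\sum_k Bk k); split; first by rewrite sumr_ge0 // => k _; case: (HBk k).
  have : \forall m \near U, forall k : bidx b, forall j x, D x ->
    `|iter_der (map (@bvec _ _ b) (k :: vs)) (u m j) x| <= Bk k.
    by apply: filter_forall => k; case: (HBk k).
  apply: filterS => m Hm k y Dy; apply: (le_trans (Hm k j y Dy)).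
  rewrite (bigD1 k) //= lerDl sumr_ge0 // => i _; by case: (HBk i).
have /nbhs_ballP[r /= r0 Hr] := near_open oD Dx.
pose Q := #|bidx b|%:R * B + 1.
have Q0 : 0 < Q by rewrite ltr_wpDl // mulr_ge0.
apply/cvgrPdist_lt => e e_0.
apply/nbhs_ballP; exists (Num.min r (e / Q)); first by rewrite /= lt_min r0 divr_gt0.
move=> y; rewrite -ball_normE /= lt_min => /andP[yr ye].
have Dseg (t : R) : 0 <= t <= 1 -> D (t *: (y - x) + x).
  move=> /andP[t0 t1]; apply: Hr; rewrite -ball_normE /= opprD addrCA subrr addr0.
  rewrite normrN normrZ ger0_norm // distrC; apply: le_lt_trans yr.
  by rewrite ler_piMl.
have Dy : D y by apply: Hr; rewrite -ball_normE.
have Hm : \forall m \near U, `|iter_der (map (@bvec _ _ b) vs) (u m j) x -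
   iter_der (map (@bvec _ _ b) vs) (u m j) y| <= `|x - y| * (#|bidx b|%:R * B).
  apply: filterS HB => m Hm.
  have := mean_bound oD (smooth_on_iter_der (map (@bvec _ _ b) vs) (u_smooth m j)) Hm Dseg.
  rewrite subrK distrC => /le_trans; apply.
  rewrite mulrA ler_wpM2r // mulr_natr -sumr_const; apply: ler_sum => k _.
  by rewrite distrC; exact: bcoord_le.
have Hl : `|iter_der (map (@bvec _ _ b) vs) (u m j) x -
   iter_der (map (@bvec _ _ b) vs) (u m j) y| @[m --> U] -->
   `|ulim vs j x - ulim vs j y|.
  by apply: cvg_norm; apply: cvgB; exact: ulimP.
apply: (@le_lt_trans _ _ (`|x - y| * (#|bidx b|%:R * B))).
  exact: (cvgr_to_le Hl).
apply: (@le_lt_trans _ _ (`|x - y| * Q)).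
  by rewrite ler_wpM2l // lerDl.
by rewrite -ltr_pdivlMr.
Qed.

(** The Taylor estimate for the approximations is uniform, hence passes to the
    limit and identifies the derivative of the limit. *)
Lemma ulim_is_derive vs j (k : bidx b) x : D x ->
  is_derive x (bvec k) (ulim vs j) (ulim (k :: vs) j x).
Proof.
move=> Dx.
have [B [B0 HB]] := u_bounds [:: k, k & vs].
have /nbhs_ballP[r /= r0 Hr] := near_open oD Dx.
apply/is_derive_cvg.
have main : \forall h \near (0:R)^',
   `|h^-1 *: (ulim vs j (h *: bvec k + x) - ulim vs j x) - ulim (k :: vs) j x|
     <= `|h| * B.
  near=> h.
  have h0 : h != 0 by near: h; exact: nbhs_dnbhs_neq.
  have hr : `|h| * `|bvec k : V| < r.
    apply: (@le_lt_trans _ _ (`|h| * (`|bvec k : V| + 1))).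
      by rewrite ler_wpM2l // lerDl.
    rewrite -ltr_pdivlMr ?ltr_wpDl //; near: h; apply: dnbhs0_lt.
    by rewrite divr_gt0 // ltr_wpDl.
  have Dseg (t : R) : 0 <= t <= 1 -> D (t *: (h *: bvec k) + x).
    move=> /andP[t0 t1]; apply: Hr; rewrite -ball_normE /= opprD addrCA subrr addr0.
    rewrite normrN !normrZ ger0_norm //; apply: le_lt_trans hr.
    by rewrite ler_piMl // mulr_ge0.
  have Dh : D (h *: bvec k + x).
    by have := Dseg 1; rewrite scale1r; apply; rewrite ler01 lexx.
  have Hm : \forall m \near U,
     `|iter_der (map (@bvec _ _ b) vs) (u m j) (h *: bvec k + x) -
       iter_der (map (@bvec _ _ b) vs) (u m j) x -
       h * iter_der (map (@bvec _ _ b) (k :: vs)) (u m j) x| <= `|h| * `|h| * B.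
    apply: filterS HB => m Hm.
    have sm := smooth_on_iter_der (map (@bvec _ _ b) vs) (u_smooth m j).
    have Ed y : D y -> 'D_(h *: bvec k) (iter_der (map (@bvec _ _ b) vs) (u m j)) y =
        h * 'D_(bvec k) (iter_der (map (@bvec _ _ b) vs) (u m j)) y.
      by move=> Dy; have [_ ->] := is_deriveZdir h (smooth_on_is_derive (bvec k) sm Dy).
    have := taylor_bound (v := h *: bvec k) (B := `|h| * `|h| * B) (x := x) sm _ Dseg.
    rewrite (Ed x Dx) => Ht; apply: Ht => y Dy.
    rewrite (eq_on_derive oD Ed _ Dy).
    have sd := smooth_on_derive (bvec k) sm.
    rewrite deriveMl; last exact: smooth_on_derivable sd Dy.
    have [_ ->] := is_deriveZdir h (smooth_on_is_derive (bvec k) sd Dy).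
    rewrite mulrA normrM normrM ler_wpM2l ?mulr_ge0 //.
    exact: Hm.
  have Hl : `|iter_der (map (@bvec _ _ b) vs) (u m j) (h *: bvec k + x) -
       iter_der (map (@bvec _ _ b) vs) (u m j) x -
       h * iter_der (map (@bvec _ _ b) (k :: vs)) (u m j) x| @[m --> U] -->
     `|ulim vs j (h *: bvec k + x) - ulim vs j x - h * ulim (k :: vs) j x|.
    apply: cvg_norm; apply: cvgB; first by apply: cvgB; exact: ulimP.
    by apply: cvgMl_tmp; exact: ulimP.
  have := cvgr_to_le Hl Hm; move=> /(_ PU) {}Hl.
  rewrite -(ler_pM2l (_ : 0 < `|h|)) ?normr_gt0 // -normrM mulrBr.
  by rewrite [h * (h^-1 *: _)]mulrA mulfV // mul1r [leRHS]mulrA.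
apply/cvgrPdist_lt => e e_0.
have B1 : 0 < B + 1 by rewrite ltr_wpDl.
near=> h; rewrite distrC; apply: (@le_lt_trans _ _ (`|h| * B)).
  by near: h; exact: main.
apply: (@le_lt_trans _ _ (`|h| * (B + 1))); first by rewrite ler_wpM2l // lerDl.
by rewrite -ltr_pdivlMr //; near: h; apply: dnbhs0_lt; rewrite divr_gt0.
Unshelve. all: by end_near. Qed.

Lemma ulim_smooth j : smooth_on D (ulim [::] j).
Proof.
apply: (smooth_on_coind (b := b) (P := fun g => exists vs, g = ulim vs j) oD);
  last by exists [::].
move=> _ [vs ->]; split=> [x|k]; first exact: ulim_continuous.
split=> [x Dx|]; first by have [] := ulim_is_derive vs j k Dx.
exists (ulim (k :: vs) j); first by exists (k :: vs).
by move=> x Dx; have [_ ->] := ulim_is_derive vs j k Dx.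
Qed.

Let S x := \sum_(k : bidx b) `|bcoord k (X x)|.

Let segN (e t : R) x : t *: ((- e) *: X x) + x = N (t * e) x.
Proof. by rewrite scalerA mulrN. Qed.

Let N_seg (e t : R) x : 0 < e <= 1 -> D x -> 0 <= t <= 1 ->
  D (t *: ((- e) *: X x) + x).
Proof.
move=> e01 Dx /andP[t0 t1]; rewrite segN; have [->|tn0] := eqVneq t 0.
  by rewrite mul0r /N oppr0 scale0r add0r.
case/andP: e01 => e00 e11; apply: N_in => //.
have tp : 0 < t by rewrite lt_def tn0.
by apply/andP; split; [exact: mulr_gt0 | exact: (mulr_ile1 t0 (ltW e00) t1 e11)].
Qed.

Let sum_bcoord_step (e t : R) x : 0 <= e -> 0 <= t <= 1 ->
  \sum_(k : bidx b) `|bcoord k (t *: ((- e) *: X x))| <= e * S x.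
Proof.
move=> e00 /andP[t0 t1]; rewrite /S mulr_sumr; apply: ler_sum => k _.
rewrite !bcoordZ normrM normrM normrN (ger0_norm t0) (ger0_norm e00).
by rewrite ler_piMl // mulr_ge0.
Qed.

Lemma u_step_cvg j x : D x -> u m j (N (harmonic m) x) @[m --> U] --> ulim [::] j x.
Proof.
move=> Dx.
have HH k := u_bounds [:: k].
have [Bk HBk] := choice HH.
have HB : \forall m \near U, forall k : bidx b, forall j x, D x ->
    `|iter_der (map (@bvec _ _ b) [:: k]) (u m j) x| <= Bk k.
  by apply: filter_forall => k; case: (HBk k).
pose B := \sum_k Bk k.
have Hd : (u m j (N (harmonic m) x) - u m j x) @[m --> U] --> (0 : R).
  apply/cvgrPdist_le => e e_0.
  have B1 : 0 < S x * B + 1.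
    rewrite ltr_wpDl // mulr_ge0 // sumr_ge0 // => k _; by case: (HBk k).
  have hU : \forall m \near U, (harmonic m : R) < e / (S x * B + 1).
    by apply: (cvgr_lt (0 : R)); [exact: harmonic_U | rewrite divr_gt0].
  apply: filterS2 HB hU => m HB hm; rewrite sub0r normrN.
  have h01 := harmonic01 m; have hge : 0 <= (harmonic m : R) by case/andP: h01 => /ltW.
  have Hk (k : bidx b) y : D y -> `|'D_(bvec k) (u m j) y| <= B.
    move=> Dy; apply: (le_trans (HB k j y Dy)).
    rewrite /B (bigD1 k) //= lerDl sumr_ge0 // => i _; by case: (HBk i).
  have := mean_bound oD (u_smooth m j) Hk (fun t => N_seg h01 Dx (t := t)).
  move/le_trans; apply.
  have B0 : 0 <= B by rewrite sumr_ge0 // => k _; case: (HBk k).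
  apply: (@le_trans _ _ (harmonic m * S x * B)).
    apply: ler_wpM2r => //.
    by have := sum_bcoord_step x hge (t := 1); rewrite scale1r; apply; rewrite ler01 lexx.
  rewrite -mulrA; apply: (@le_trans _ _ (harmonic m * (S x * B + 1))).
    by apply: ler_wpM2l => //; rewrite lerDl.
  by rewrite -ler_pdivlMr // ltW.
have := cvgD Hd (@ulimP [::] j x Dx) => /(_ FU); rewrite add0r.
by apply: cvg_trans; apply: near_eq_cvg; apply: nearW => m /=; rewrite subrK.
Qed.

Lemma u_step_diff_cvg j x : D x ->
  (harmonic m)^-1 * (u m j (N (harmonic m) x) - u m j x) @[m --> U] -->
  - 'D_(X x) (ulim [::] j) x.
Proof.
move=> Dx.
have [Bk HBk] := choice (fun p : bidx b * bidx b => u_bounds [:: p.1; p.2]).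
have HB : \forall m \near U, forall p : bidx b * bidx b, forall j x, D x ->
    `|iter_der (map (@bvec _ _ b) [:: p.1; p.2]) (u m j) x| <= Bk p.
  by apply: filter_forall => p; case: (HBk p).
pose B := \sum_p Bk p.
have B0 : 0 <= B by rewrite sumr_ge0 // => p _; case: (HBk p).
have S0 : 0 <= S x by rewrite sumr_ge0.
have DX : - 'D_(X x) (ulim [::] j) x =
    - \sum_(k : bidx b) bcoord k (X x) * ulim [:: k] j x.
  rewrite (deriveEcoord b oD _ (ulim_smooth j) Dx).
  congr (- _); apply: eq_bigr => k _.
  by have [_ ->] := ulim_is_derive [::] j k Dx.
have cD : - (\sum_(k : bidx b) bcoord k (X x) * 'D_(bvec k) (u m j) x)
    @[m --> U] --> - \sum_(k : bidx b) bcoord k (X x) * ulim [:: k] j x.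
  apply: cvgN; apply: cvg_big => [|k _]; first exact: add_continuous.
  by apply: cvgMl_tmp; exact: (@ulimP [:: k] j x Dx).
rewrite DX.
have Hd : ((harmonic m)^-1 * (u m j (N (harmonic m) x) - u m j x) +
   (\sum_(k : bidx b) bcoord k (X x) * 'D_(bvec k) (u m j) x)) @[m --> U] --> (0 : R).
  apply/cvgrPdist_le => e e_0.
  have B1 : 0 < S x * (S x * B) + 1 by rewrite ltr_wpDl // !mulr_ge0.
  have hU : \forall m \near U, (harmonic m : R) < e / (S x * (S x * B) + 1).
    by apply: (cvgr_lt (0 : R)); [exact: harmonic_U | rewrite divr_gt0].
  apply: filterS2 HB hU => m HB hm; rewrite sub0r normrN.
  have h01 := harmonic01 m; have hgt : 0 < (harmonic m : R) by case/andP: h01.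
  have hge : 0 <= (harmonic m : R) := ltW hgt.
  have Hk (p : bidx b * bidx b) y : D y -> `|'D_(bvec p.1) ('D_(bvec p.2) (u m j)) y| <= B.
    move=> Dy; apply: (le_trans (HB p j y Dy)).
    rewrite /B (bigD1 p) //= lerDl sumr_ge0 // => i _; by case: (HBk i).
  have sm := u_smooth m j.
  have Dseg t := N_seg h01 Dx (t := t).
  have [t t01 E] := @mean_value _ _ (u m j) x ((- harmonic m) *: X x)
    (fun t t01 => smooth_on_derivable sm (Dseg t t01) (v := (- harmonic m) *: X x)).
  have t01' : 0 <= t <= 1 by case/andP: t01 => /ltW -> /ltW ->.
  rewrite /N E (deriveEcoord b oD _ sm (Dseg t t01')).
  have -> : \sum_(k : bidx b) bcoord k (- harmonic m *: X x) *
      'D_(bvec k) (u m j) (t *: (- harmonic m *: X x) + x) =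
      - harmonic m * \sum_(k : bidx b) bcoord k (X x) *
      'D_(bvec k) (u m j) (t *: (- harmonic m *: X x) + x).
    by rewrite mulr_sumr; apply: eq_bigr => k _; rewrite bcoordZ mulrA.
  rewrite mulrA mulrN mulVf ?gt_eqF // mulN1r addrC -sumrB.
  apply: (le_trans (ler_norm_sum _ _ _)).
  apply: (@le_trans _ _ (\sum_(k : bidx b) `|bcoord k (X x)| * (harmonic m * S x * B))).
    apply: ler_sum => k _; rewrite -mulrBr normrM; apply: ler_wpM2l => //.
    rewrite distrC.
    have Dseg2 s : 0 <= s <= 1 -> D (s *: (t *: (- harmonic m *: X x)) + x).
      move=> /andP[s0 s1]; rewrite scalerA; apply: Dseg.
      by case/andP: t01' => t0 t1; rewrite mulr_ge0 //= mulr_ile1.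
    have := mean_bound oD (smooth_on_derive (bvec k) sm) (fun i y => Hk (i, k) y) Dseg2.
    move/le_trans; apply; apply: ler_wpM2r => //.
    exact: sum_bcoord_step.
  rewrite -mulr_suml -/(S x).
  have -> : S x * (harmonic m * S x * B) = harmonic m * (S x * (S x * B)) by ring.
  apply: (@le_trans _ _ (harmonic m * (S x * (S x * B) + 1))).
    by apply: ler_wpM2l => //; rewrite lerDl.
  by rewrite -ler_pdivlMr // ltW.
have := cvgD Hd cD => /(_ FU); rewrite add0r.
by apply: cvg_trans; apply: near_eq_cvg; apply: nearW => m /=; rewrite addrK.
Qed.

(** One more step changes the approximation by a quantity of the size
    [(1 - c e) ^+ K e] with [K = e ^- 2]; by the Bernoulli inequality this is
    negligible compared to [e]. *)
Lemma residual_cvg j x : D x -> (harmonic m)^-1 *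
  (scheme (fun _ => A) (fun _ => f) (harmonic m) (m.+1 * m.+1).+1 j x - u m j x)
   @[m --> U] --> (0 : R).
Proof.
move=> Dx.
have [F F0 HF] := bfam_finite_bound (G := fun j (e : R) => f j) bf.
have [c0 /andP[e00 e01] _] := st.
apply/cvgrPdist_le => e e_0.
have h1 : \forall m \near U, (harmonic m : R) < e0.
  by apply: (cvgr_lt (0 : R)) => //; exact: harmonic_U.
have F1 : 0 < F + 1 by rewrite ltr_wpDl.
have h2 : \forall m \near U, (harmonic m : R) < e / (F + 1) * c.
  by apply: (cvgr_lt (0 : R)); [exact: harmonic_U | rewrite mulr_gt0 // divr_gt0].
apply: filterS2 h1 h2 => m h1 h2; rewrite sub0r normrN.
have h0 : 0 < (harmonic m : R) by case/andP: (harmonic01 m).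
have hh : 0 < (harmonic m : R) <= e0 by rewrite h0 ltW.
have Hs := scheme_diff st F0 HF (m.+1 * m.+1) j hh Dx.
rewrite normrM gtr0_norm ?invr_gt0 // ler_pdivrMl //.
apply: (le_trans Hs); rewrite mulrCA ler_pM2l //.
have [y y0 yE] : exists2 y : R, 0 < y & y = c * harmonic m.
  by exists (c * harmonic m); rewrite // mulr_gt0.
rewrite -yE; have [y1|/ltW y1] := lerP y 1; last first.
  (* the contraction factor is nonnegative as a bound of a sum of norms *)
  have [_ _ st'] := st; have := st' _ x j hh Dx; rewrite -yE => Hy.
  have : 0 <= 1 - y by apply: le_trans Hy; rewrite sumr_ge0.
  rewrite subr_ge0 => y1'; have -> : y = 1 by apply/eqP; rewrite eq_le y1 y1'.
  by rewrite subrr expr0n muln_eq0 /= mul0r ltW.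
have bern : forall n, (1 - y) ^+ n * (1 + n%:R * y) <= 1.
  elim=> [|n IHn]; first by rewrite expr0 mul0r addr0 mul1r.
  rewrite exprS; apply: le_trans IHn; rewrite mulrAC mulrC.
  apply: ler_wpM2l; first by rewrite exprn_ge0 // subr_ge0.
  rewrite -natr1; have n0 : 0 <= n%:R :> R by [].
  rewrite -subr_ge0.
  have -> : 1 + n%:R * y - (1 - y) * (1 + (n%:R + 1) * y) = (n%:R + 1) * (y * y) by ring.
  by rewrite mulr_ge0 ?addr_ge0 // mulr_ge0 // ltW.
have := bern (m.+1 * m.+1)%N.
set P := (1 - y) ^+ _ => HP.
have P0 : 0 <= P by rewrite exprn_ge0 // subr_ge0.
have hE : (harmonic m : R) * m.+1%:R = 1 by rewrite /harmonic mulVf.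
have cP : P * c <= harmonic m.
  have : P * ((m.+1 * m.+1)%:R * y) <= 1 by apply: le_trans HP; rewrite ler_wpM2l // lerDr.
  rewrite yE natrM.
  have -> : P * (m.+1%:R * m.+1%:R * (c * harmonic m)) =
    (P * c) * m.+1%:R * (harmonic m * m.+1%:R) by ring.
  rewrite hE mulr1 -ler_pdivlMr ?ltr0n //.
  by rewrite div1r.
have : P * c < e / (F + 1) * c by apply: le_lt_trans h2.
rewrite ltr_pM2r // => HPe.
apply: (@le_trans _ _ (P * (F + 1))); first by rewrite ler_wpM2l // lerDl.
by rewrite -ler_pdivlMr // ltW.
Qed.

Lemma ulim_solution j x : D x ->
  'D_(X x) (ulim [::] j) x + \sum_l A j l x * ulim [::] l x = f j x.
Proof.
move=> Dx.
have H1 := residual_cvg j Dx.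
have H2 : (harmonic m)^-1 *
  (scheme (fun _ => A) (fun _ => f) (harmonic m) (m.+1 * m.+1).+1 j x - u m j x)
   @[m --> U] --> - 'D_(X x) (ulim [::] j) x -
     \sum_l A j l x * ulim [::] l x + f j x.
  have cA : (\sum_l A j l x * u m l (N (harmonic m) x)) @[m --> U] -->
      \sum_l A j l x * ulim [::] l x.
    apply: cvg_big => [|l _]; first exact: add_continuous.
    by apply: cvgMl_tmp; exact: u_step_cvg.
  have := cvgD (cvgB (@u_step_diff_cvg j x Dx) cA) (cvg_cst (f j x)).
  move=> /(_ FU FU FU); apply: cvg_trans; apply: near_eq_cvg; apply: nearW => m.
  have E : scheme (fun _ => A) (fun _ => f) (harmonic m) (m.+1 * m.+1).+1 j x =
    \sum_l ((j == l)%:R - harmonic m * A j l x) * u m l (N (harmonic m) x) +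
    harmonic m * f j x by [].
  change ((harmonic m)^-1 * (u m j (N (harmonic m) x) - u m j x) -
    \sum_l A j l x * u m l (N (harmonic m) x) + f j x = (harmonic m)^-1 *
    (scheme (fun _ => A) (fun _ => f) (harmonic m) (m.+1 * m.+1).+1 j x - u m j x)).
  rewrite E {E}.
  have h0 : harmonic m != 0 :> R by rewrite gt_eqF // harmonic_gt0.
  have -> : \sum_l ((j == l)%:R - harmonic m * A j l x) * u m l (N (harmonic m) x) =
    u m j (N (harmonic m) x) - harmonic m * \sum_l A j l x * u m l (N (harmonic m) x).
    rewrite mulr_sumr (eq_bigr (fun l => (j == l)%:R * u m l (N (harmonic m) x) -
      harmonic m * (A j l x * u m l (N (harmonic m) x)))); last first.
      by move=> l _; rewrite mulrBl mulrA.
    rewrite sumrB (bigD1 j) //= eqxx mul1r big1 ?addr0 // => l lj.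
    by rewrite eq_sym (negbTE lj) mul0r.
  move: (u m j (N (harmonic m) x)) (\sum_l A j l x * u m l (N (harmonic m) x))
    (u m j x) (harmonic m : R) h0 => a s d h h0.
  by field.
have H := @cvg_unique _ (@Rhausdorff R) _ (fmap_proper_filter _ PU) _ _ H1 H2.
move: ('D_(X x) (ulim [::] j) x) (\sum_l A j l x * ulim [::] l x) (f j x) H.
by move=> p q r H; lra.
Qed.

End Limit.

Theorem transport_solution (J : finType) (A : J -> J -> V -> R) (f : J -> V -> R)
    (c e0 : R) :
  (forall j l, bfam b D (fun _ => A j l)) -> (forall j, bfam b D (fun _ => f j)) ->
  stable (fun _ => A) c e0 ->
  exists u : J -> V -> R, (forall j, smooth_on D (u j)) /\
    forall j x, D x -> 'D_(X x) (u j) x + \sum_l A j l x * u l x = f j x.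
Proof.
move=> bA bf st.
have [U [UU Uoo]] := ultraFilterLemma (F := \oo) _.
exists (ulim A f U [::]); split=> [j|j x Dx].
  exact: (ulim_smooth bA bf st UU Uoo).
exact: (ulim_solution bA bf st UU Uoo).
Qed.

End Scheme.

(** * Maximum principle *)

Section ClosedBox.
Variables (R : realType) (n : nat).
Implicit Types (c x : 'rV[R]_n) (r : R).

Definition cbox c r : set 'rV[R]_n := [set x | `|x - c| <= r].

Lemma ball_cbox c r x : ball c r x -> cbox c r x.
Proof. by rewrite -ball_normE /= distrC => /ltW. Qed.

Lemma cbox_ball_lt c r r' x : r < r' -> cbox c r x -> ball c r' x.
Proof. by move=> rr' H; rewrite -ball_normE /= distrC; exact: le_lt_trans rr'. Qed.

Lemma ball_segment c r x y (t : R) : ball c r x -> ball c r y -> 0 <= t <= 1 ->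
  ball c r (t *: (x - y) + y).
Proof.
move=> Bx By /andP[t0 t1]; rewrite -ball_normE /=.
have -> : c - (t *: (x - y) + y) = t *: (c - x) + (1 - t) *: (c - y).
  by apply/rowP => i; rewrite !mxE; ring.
apply: (le_lt_trans (ler_normD _ _)); rewrite !normrZ !ger0_norm ?subr_ge0 //.
move: Bx By; rewrite -!ball_normE /= => h1 h2.
have [->|tn0] := eqVneq t 0; first by rewrite mul0r add0r subr0 mul1r.
have tp : 0 < t by rewrite lt_def tn0.
have -> : r = t * r + (1 - t) * r by ring.
apply: ltr_leD; first by rewrite ltr_pM2l.
by apply: ler_wpM2l; [rewrite subr_ge0 | exact: ltW].
Qed.

Lemma cbox_compact c r : 0 <= r -> compact (cbox c r).
Proof.
move=> r0.
have -> : cbox c r = [set v : 'rV[R]_n |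
    forall i, `[c 0 i - r, c 0 i + r]%classic (v ord0 i)].
  apply/seteqP; split=> x /=.
    move=> H i; rewrite in_itv /=.
    have := le_trans (row_coord_le i (x - c)) H.
    rewrite !mxE ler_norml => /andP[h1 h2]; apply/andP; split; lra.
  move=> H; apply: row_norm_le => // i; rewrite !mxE ler_norml.
  by have := H i; rewrite in_itv /= => /andP[h1 h2]; apply/andP; split; lra.
apply: (@rV_compact R n (fun i => `[c 0 i - r, c 0 i + r]%classic)) => i.
exact: segment_compact.
Qed.

End ClosedBox.

Section MaximumPrinciple.
Variables (R : realType) (n : nat).
Local Notation V := 'rV[R]_n.
Variables (xc : V) (r0 r : R) (X : V -> V).
Hypothesis r0r : r0 < r.
Hypothesis inward : forall x, ball xc r x -> `|x - X x - xc| < r0.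

Lemma euler_step_cbox r' x t : r0 <= r' -> r' < r -> cbox xc r' x ->
  0 <= t <= 1 -> cbox xc r' (euler_step X t x).
Proof.
move=> r0r' r'r Hx /andP[t0 t1]; rewrite /cbox /= /euler_step.
have -> : - t *: X x + x - xc = (1 - t) *: (x - xc) + t *: (x - X x - xc).
  by apply/rowP => i; rewrite !mxE; ring.
apply: (le_trans (ler_normD _ _)); rewrite !normrZ !ger0_norm ?subr_ge0 //.
have H2 : `|x - X x - xc| <= r'.
  by apply: le_trans r0r'; apply/ltW/inward; exact: cbox_ball_lt r'r Hx.
apply: (@le_trans _ _ ((1 - t) * r' + t * r')); last by rewrite -mulrDl subrK mul1r.
by apply: lerD; apply: ler_wpM2l => //; rewrite subr_ge0.
Qed.

(** Near the maximum the values reached by stepping backwards are compared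
    with it. *)
Lemma derive_inward (v : V -> R) r' x m : r0 <= r' -> r' < r -> cbox xc r' x ->
  is_derive x (X x) v m -> (forall y, cbox xc r' y -> v y <= v x) -> 0 <= m.
Proof.
move=> r0r' r'r Hx /is_derive_cvg dv vmax; rewrite leNgt; apply/negP => m0.
have [d /= d0 Hd] : \forall h \near (0:R)^', h^-1 *: (v (h *: X x + x) - v x) < 0.
  exact: (cvgr_lt m dv).
have t0 : 0 < Num.min (d / 2) 1 by rewrite lt_min divr_gt0 // ltr01.
set t := Num.min (d / 2) 1 in t0.
have td : t < d.
  by apply: (@le_lt_trans _ _ (d / 2)); rewrite ?ge_min ?lexx // ltr_pdivrMr // ltr_pMr // ltr1n.
have t1 : t <= 1 by rewrite ge_min lexx orbT.
have := Hd (- t); rewrite /ball /= sub0r opprK gtr0_norm // oppr_eq0 gt_eqF //.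
move=> /(_ td isT); rewrite invrN.
have Hv : v (- t *: X x + x) - v x <= 0.
  rewrite subr_le0; apply: vmax; apply: euler_step_cbox => //.
  by rewrite ltW.
have : 0 <= - t^-1 * (v (- t *: X x + x) - v x).
  by rewrite mulNr oppr_ge0 mulr_ge0_le0 // invr_ge0 ltW.
by move=> H; rewrite ltNge => /negP; apply; exact: H.
Qed.

(** Consider a closed ball of radius [r'] between [r0] and [r], containing the
    given point; backward steps preserve it. Let [|u l|] attain at [x] its maximum
    over the ball and over all components. Since backward steps from [x] cannot
    exceed the maximum, the derivative along [X] of the maximal component has the
    sign of this component, whereas the damping gives it the opposite sign unless
    the maximum is zero. *)
Lemma transport_unique (J : finType) (A : J -> J -> V -> R) (u : J -> V -> R)
    (c e : R) :
  0 < c -> 0 < e ->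
  (forall x j, ball xc r x -> \sum_l `|(j == l)%:R - e * A j l x| <= 1 - c * e) ->
  (forall j, smooth_on (ball xc r) (u j)) ->
  (forall j x, ball xc r x -> 'D_(X x) (u j) x + \sum_l A j l x * u l x = 0) ->
  forall j x, ball xc r x -> u j x = 0.
Proof.
move=> c0 e0 HA su Hu j x0 Hx0.
pose r' := Num.max r0 `|x0 - xc|.
have r0r' : r0 <= r' by rewrite le_max lexx.
have r'r : r' < r by rewrite gt_max r0r distrC; move: Hx0; rewrite -ball_normE.
have Kx0 : cbox xc r' x0 by rewrite /cbox /= le_max lexx orbT.
have r'0 : 0 <= r' by rewrite le_max normr_ge0 orbT.
have KB x : cbox xc r' x -> ball xc r x by exact: cbox_ball_lt.
have Hmax l : exists2 y, cbox xc r' y & forall z, cbox xc r' z -> `|u l z| <= `|u l y|.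
  have [||y] := @compact_EVT_max _ R (fun y => `|u l y|) (cbox xc r') _ (@cbox_compact R n xc r' r'0).
  - by exists x0.
  - apply: continuous_in_subspaceT => y /set_mem Ky.
    have cu := smooth_on_continuous (su l) (KB y Ky).
    exact: (cvg_norm cu).
  - move=> /set_mem Ky Hy; exists y => // z Kz; apply: Hy; exact: mem_set.
have [y Hy] := choice (fun l => let: ex_intro2 y h1 h2 := Hmax l in ex_intro _ y (conj h1 h2)).
pose l0 := [arg max_(l > j) `|u l (y l)|]%O.
have Hl0 l z : cbox xc r' z -> `|u l z| <= `|u l0 (y l0)|.
  move=> Kz; apply: (le_trans ((Hy l).2 z Kz)).
  by rewrite /l0; case: arg_maxP => // i _; apply.
set m := `|u l0 (y l0)| in Hl0.
suff m0 : m <= 0.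
  by apply/eqP; rewrite -normr_le0; apply: le_trans (Hl0 j x0 Kx0) m0.
pose x := y l0; have Kx : cbox xc r' x := (Hy l0).1; have Bx := KB x Kx.
pose s : R := Num.sg (u l0 x).
have sm : s * u l0 x = m by rewrite /s -normrEsg.
have s1 : `|s| <= 1 by rewrite /s normr_sg; case: (_ != 0).
have dv : is_derive x (X x) (fun z => s * u l0 z) (s * 'D_(X x) (u l0) x).
  have du := smooth_on_is_derive (X x) (su l0) Bx.
  exact: is_deriveZ.
have H0 : 0 <= s * 'D_(X x) (u l0) x.
  apply: (derive_inward r0r' r'r Kx dv) => z Kz; rewrite sm.
  apply: (le_trans (ler_norm _)); rewrite normrM.
  apply: le_trans (Hl0 l0 z Kz).
  by rewrite ler_piMl.
have E := Hu l0 x Bx.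
have E2 : s * 'D_(X x) (u l0) x = - (s * \sum_l A l0 l x * u l x).
  by apply/eqP; rewrite -addr_eq0 -mulrDr E mulr0.
rewrite E2 oppr_ge0 in H0.
have H1 : `|\sum_l ((l0 == l)%:R - e * A l0 l x) * u l x| <= (1 - c * e) * m.
  apply: (le_trans (ler_norm_sum _ _ _)).
  apply: (@le_trans _ _ (\sum_l `|(l0 == l)%:R - e * A l0 l x| * m)).
    apply: ler_sum => l _; rewrite normrM; apply: ler_wpM2l => //.
    exact: Hl0.
  by rewrite -mulr_suml; apply: ler_wpM2r; [exact: normr_ge0 | exact: HA].
have E3 : \sum_l ((l0 == l)%:R - e * A l0 l x) * u l x = u l0 x - e * \sum_l A l0 l x * u l x.
  rewrite (eq_bigr (fun l => (l0 == l)%:R * u l x - e * (A l0 l x * u l x))); last first.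
    by move=> l _; rewrite mulrBl mulrA.
  rewrite sumrB mulr_sumr; congr (_ - _).
  rewrite (bigD1 l0) //= eqxx mul1r big1 ?addr0 // => l ll0.
  by rewrite eq_sym (negbTE ll0) mul0r.
have H2 : s * (u l0 x - e * \sum_l A l0 l x * u l x) <= (1 - c * e) * m.
  apply: (le_trans (ler_norm _)); rewrite normrM -E3; apply: le_trans H1.
  by rewrite ler_piMl.
move: H2; rewrite mulrBr sm mulrCA mulrBl mul1r lerD2l lerN2 => H2.
have H3 : c * e * m <= 0.
  by apply: (le_trans H2); rewrite mulr_ge0_le0 // ltW.
by move: H3; rewrite pmulr_rle0 // mulr_gt0.
Qed.

End MaximumPrinciple.

(** * The operator in coordinates *)

Section MatrixCalculus.
Variables (R : realType) (n : nat).
Local Notation V := 'rV[R]_n.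
Local Notation b := (row_fbasis R n).
Implicit Types (x v : V).

Definition msmooth p q (W : set V) (F : V -> 'M[R]_(p, q)) :=
  forall i j, smooth_on W (fun y => F y i j).

Definition derm p q (v : V) (F : V -> 'M[R]_(p, q)) (x : V) : 'M[R]_(p, q) :=
  \matrix_(i, j) 'D_v (fun y => F y i j) x.

Definition gradr (f : V -> R) (x : V) : 'rV[R]_n := \row_j pder j f x.

Definition jac m (F : V -> 'rV[R]_m) (x : V) : 'M[R]_(n, m) :=
  \matrix_(i, k) pder i (fun y => F y 0 k) x.

Variable W : set V.
Hypothesis oW : open W.

Lemma derive_gradr f x v : smooth_on W f -> W x ->
  'D_v f x = (v *m (gradr f x)^T) 0 0.
Proof.
move=> sf Wx; rewrite (deriveEcoord b oW v sf Wx) mxE.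
by apply: eq_bigr => i _; rewrite !mxE.
Qed.

Lemma derm_eq p q v (F G : V -> 'M[R]_(p, q)) x :
  (forall y, W y -> F y = G y) -> W x -> derm v F x = derm v G x.
Proof.
move=> FG Wx; apply/matrixP => i j; rewrite !mxE.
by apply: (eq_on_derive oW) => // y Wy; rewrite FG.
Qed.

Lemma derm_tr p q v (F : V -> 'M[R]_(p, q)) x :
  derm v (fun y => (F y)^T) x = (derm v F x)^T.
Proof.
apply/matrixP => i j; rewrite !mxE; congr (derive _ _ _).
by apply/funext => y; rewrite mxE.
Qed.

Lemma is_derive_sum_seq (I : Type) (s : seq I) (F : I -> V -> R) (d : I -> R) x v :
  (forall i, is_derive x v (F i) (d i)) ->
  is_derive x v (fun y => \sum_(i <- s) F i y) (\sum_(i <- s) d i).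
Proof.
move=> dF; elim: s => [|i s IH].
  rewrite big_nil (_ : (fun _ => _) = cst 0); first exact: is_derive_cst.
  by apply/funext => y; rewrite big_nil.
rewrite big_cons (_ : (fun _ => _) = F i + fun y => \sum_(j <- s) F j y).
  exact: is_deriveD.
by apply/funext => y; rewrite big_cons.
Qed.

Lemma derm_mul p q m v (F : V -> 'M[R]_(p, q)) (G : V -> 'M[R]_(q, m)) x :
  msmooth W F -> msmooth W G -> W x ->
  derm v (fun y => F y *m G y) x = derm v F x *m G x + F x *m derm v G x.
Proof.
move=> sF sG Wx; apply/matrixP => i j; rewrite !mxE -big_split /=.
have [_ E] : is_derive x v (fun y => \sum_k F y i k * G y k j)
    (\sum_k (F x i k * 'D_v (fun y => G y k j) x + G x k j * 'D_v (fun y => F y i k) x)).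
  apply: is_derive_sum_seq => k.
  have d1 := smooth_on_is_derive v (sF i k) Wx.
  have d2 := smooth_on_is_derive v (sG k j) Wx.
  exact: is_deriveM.
transitivity ('D_v (fun y => \sum_k F y i k * G y k j) x).
  by congr (derive _ _ _); apply/funext => y; rewrite mxE.
rewrite E; apply: eq_bigr => k _; rewrite !mxE addrC; congr (_ + _).
by rewrite mulrC.
Qed.

Lemma msmooth_mul p q m (F : V -> 'M[R]_(p, q)) (G : V -> 'M[R]_(q, m)) :
  msmooth W F -> msmooth W G -> msmooth W (fun y => F y *m G y).
Proof. by move=> sF sG; exact: (smooth_on_mulmx b oW). Qed.

Lemma msmooth_tr p q (F : V -> 'M[R]_(p, q)) :
  msmooth W F -> msmooth W (fun y => (F y)^T).
Proof.
by move=> sF i j; apply: smooth_on_eq (sF j i) => // y _; rewrite mxE.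
Qed.

Lemma smooth_trace p (F : V -> 'M[R]_p) :
  msmooth W F -> smooth_on W (fun y => \tr (F y)).
Proof. by move=> sF; apply: (smooth_on_sum b oW) => i; exact: sF. Qed.

Lemma msmooth_gradr f : smooth_on W f -> msmooth W (gradr f).
Proof.
move=> sf i j; apply: smooth_on_eq (smooth_on_derive (basisv R j) sf) => // y _.
by rewrite mxE.
Qed.

Lemma msmooth_jac m (F : V -> 'rV[R]_m) : msmooth W F -> msmooth W (jac F).
Proof.
move=> sF i j; apply: smooth_on_eq (smooth_on_derive (basisv R i) (sF 0 j)) => // y _.
by rewrite mxE.
Qed.

Lemma derive_rowE m (F : V -> 'rV[R]_m) x v k : msmooth W F -> W x ->
  'D_v (fun y => F y 0 k) x = (v *m jac F x) 0 k.
Proof.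
move=> sF Wx; rewrite (deriveEcoord b oW v (sF 0 k) Wx) mxE.
by apply: eq_bigr => i _; rewrite !mxE.
Qed.

Lemma derm_row m (F : V -> 'rV[R]_m) x v : msmooth W F -> W x ->
  derm v F x = v *m jac F x.
Proof.
by move=> sF Wx; apply/rowP => k; rewrite mxE derive_rowE.
Qed.

Lemma row_jac m (F : V -> 'rV[R]_m) i x : row i (jac F x) = derm (basisv R i) F x.
Proof. by apply/rowP => k; rewrite !mxE. Qed.

(** Equality of mixed partials, for a vector-valued map. *)
Lemma derm_jac m (F : V -> 'rV[R]_m) x v i k : msmooth W F -> W x ->
  derm v (jac F) x i k = pder i (fun y => (v *m jac F y) 0 k) x.
Proof.
move=> sF Wx; rewrite mxE.
have -> : (fun y => jac F y i k) = pder i (fun y => F y 0 k).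
  by apply/funext => y; rewrite mxE.
rewrite /pder (schwarz_derive oW _ _ (sF 0 k) Wx).
apply: (eq_on_derive oW) => // y Wy; exact: derive_rowE.
Qed.

End MatrixCalculus.

Section Composition.
Variables (R : realType) (n : nat).
Local Notation V := 'rV[R]_n.
Local Notation b := (row_fbasis R n).
Variables (W1 W2 : set V) (tau : V -> V).
Hypotheses (oW1 : open W1) (oW2 : open W2).
Hypothesis tauW : forall x, W1 x -> W2 (tau x).
Hypothesis stau : msmooth W1 tau.

Let stau' : forall l : bidx b, smooth_on W1 (fun x => bcoord l (tau x)).
Proof. by move=> l; exact: stau. Qed.

Lemma smooth_comp (f : V -> R) : smooth_on W2 f -> smooth_on W1 (fun x => f (tau x)).
Proof. exact: (smooth_on_comp b (bW := b) oW1 oW2 tauW stau'). Qed.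

Lemma msmooth_comp p q (F : V -> 'M[R]_(p, q)) :
  msmooth W2 F -> msmooth W1 (fun x => F (tau x)).
Proof. by move=> sF i j; exact: (smooth_comp (sF i j)). Qed.

Lemma derive_comp (f : V -> R) x v : smooth_on W2 f -> W1 x ->
  'D_v (fun y => f (tau y)) x = 'D_(v *m jac tau x) f (tau x).
Proof.
move=> sf Wx.
have [_ ->] := @is_derive_smooth_comp _ _ _ b W1 W2 tau oW2 tauW stau' f x v sf Wx.
rewrite (deriveEcoord b oW2 _ sf (tauW Wx)); apply: eq_bigr => l _.
rewrite [LHS]mulrC; congr (_ * _); exact: (derive_rowE oW1 v l stau Wx).
Qed.

Lemma gradr_comp (f : V -> R) x : smooth_on W2 f -> W1 x ->
  gradr (fun y => f (tau y)) x = gradr f (tau x) *m (jac tau x)^T.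
Proof.
move=> sf Wx; apply/rowP => i; rewrite !mxE /pder derive_comp //.
rewrite (derive_gradr oW2 _ sf (tauW Wx)) mxE; apply: eq_bigr => k _.
by rewrite mulrC /basisv -rowE !mxE.
Qed.

Lemma derm_comp p q (F : V -> 'M[R]_(p, q)) x v : msmooth W2 F -> W1 x ->
  derm v (fun y => F (tau y)) x = derm (v *m jac tau x) F (tau x).
Proof.
by move=> sF Wx; apply/matrixP => i j; rewrite !mxE (derive_comp v (sF i j) Wx).
Qed.

End Composition.

Section LocalOperator.
Variables (R : realType) (n : nat).
Local Notation V := 'rV[R]_n.
Local Notation b := (row_fbasis R n).
Local Notation chris := ('I_n -> 'I_n -> 'I_n -> V -> R).
Implicit Types (G : chris) (W : set V) (x v : V).

(** The covariant Hessian of [f], not symmetrized. *)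
Definition hessm G (f : V -> R) x : 'M[R]_n :=
  \matrix_(i, j) (pder i (pder j f) x - \sum_k G i j k x * pder k f x).

(** At a nondegenerate critical point this field vanishes and its linear part
    is the identity; for a nondegenerate quadratic [f] in flat space it is the Euler
    field. *)
Definition grad_field G (f : V -> R) x : V := gradr f x *m invmx (hessm G f x).

(** The indices of [C] are raised with the Hessian; the factor 2 turns
    [C(X, X) = f - f(p)] into the eikonal equation of [f]. *)
Definition symbol G f (C : V -> 'M[R]_n) x : 'M[R]_n :=
  2%:R *: (invmx (hessm G f x) *m C x *m (invmx (hessm G f x))^T).

(** What the first-order part of the operator must contribute on [f] in order
    that the operator map [f] to [n]. *)
Definition defect G f C x : R :=
  n%:R - \tr (symbol G f C x *m (hessm G f x)^T).

(** The two equations say that the Lie derivatives along the gradient field of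
    the form [C] and of the one-form [B] are the covariant Hessian and the
    differential of the defect. *)
Record transport_sol G f W (C : V -> 'M[R]_n) (B : V -> 'cV[R]_n) : Prop :=
 TransportSol {
  ts_fun : smooth_on W f;
  ts_chris : forall i j k, smooth_on W (G i j k);
  ts_hess : forall x, W x -> \det (hessm G f x) != 0;
  ts_form : msmooth W C;
  ts_covec : msmooth W B;
  ts_form_eq : forall x, W x -> derm (grad_field G f x) C x +
    jac (grad_field G f) x *m C x + C x *m (jac (grad_field G f) x)^T =
    hessm G f x;
  ts_covec_eq : forall x, W x -> derm (grad_field G f x) B x +
    jac (grad_field G f) x *m B x = (gradr (defect G f C) x)^T
}.

(** The action on real functions; its coefficients are real. *)
Definition box_real G f (C : V -> 'M[R]_n) (B : V -> 'cV[R]_n) (h : V -> R) x : R :=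
  \tr (symbol G f C x *m (hessm G h x)^T) +
  (gradr h x *m invmx (hessm G f x) *m B x) 0 0.

Section Smoothness.
Variables (G : chris) (f : V -> R) (W : set V).
Hypotheses (oW : open W) (sG : forall i j k, smooth_on W (G i j k)).

Lemma msmooth_hessm (h : V -> R) : smooth_on W h -> msmooth W (hessm G h).
Proof.
move=> sh i j.
have H : smooth_on W (fun x => pder i (pder j h) x - \sum_k G i j k x * pder k h x).
  apply: (smooth_onB b oW).
    exact: (smooth_on_derive (basisv R i) (smooth_on_derive (basisv R j) sh)).
  apply: (smooth_on_sum b oW) => k.
  exact: (smooth_onM b oW (sG i j k) (smooth_on_derive (basisv R k) sh)).
by apply: (smooth_on_eq oW _ H) => x _; rewrite mxE.
Qed.

Hypotheses (sf : smooth_on W f) (hf : forall x, W x -> \det (hessm G f x) != 0).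

Lemma msmooth_invhess : msmooth W (fun x => invmx (hessm G f x)).
Proof. by apply: (smooth_on_invmx b oW hf); exact: msmooth_hessm. Qed.

Lemma msmooth_grad_field : msmooth W (grad_field G f).
Proof.
apply: (msmooth_mul oW); [exact: msmooth_gradr | exact: msmooth_invhess].
Qed.

Lemma msmooth_symbol C : msmooth W C -> msmooth W (symbol G f C).
Proof.
move=> sC i j.
have H : msmooth W (fun x => invmx (hessm G f x) *m C x *m (invmx (hessm G f x))^T).
  exact: (msmooth_mul oW (msmooth_mul oW msmooth_invhess sC)
    (msmooth_tr oW msmooth_invhess)).
apply: (smooth_on_eq oW _ (smooth_onM b oW (smooth_on_cst b oW 2%:R) (H i j))).
by move=> x _; rewrite [RHS]mxE.
Qed.

Lemma smooth_defect C : msmooth W C -> smooth_on W (defect G f C).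
Proof.
move=> sC; apply: (smooth_onB b oW); first exact: (smooth_on_cst b oW).
apply: (smooth_trace oW); apply: (msmooth_mul oW); first exact: msmooth_symbol.
by apply: (msmooth_tr oW); exact: msmooth_hessm.
Qed.

Lemma hess_unit x : W x -> hessm G f x \in unitmx.
Proof. by move=> Wx; rewrite unitmxE unitfE hf. Qed.

Lemma grad_field_hess x : W x -> grad_field G f x *m hessm G f x = gradr f x.
Proof. by move=> Wx; rewrite /grad_field mulmxKV // hess_unit. Qed.

End Smoothness.

Section Naturality.
Variables (G1 G2 : chris) (W1 W2 : set V) (tau : V -> V).
Hypotheses (oW1 : open W1) (oW2 : open W2).
Hypothesis tauW : forall x, W1 x -> W2 (tau x).
Hypothesis stau : smooth_on W1 tau.
Hypothesis tauU : forall x, W1 x -> jac tau x \in unitmx.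
Hypothesis tauG : gamma_transform W1 tau G1 G2.

Local Notation T := (jac tau).

Lemma smooth_on_msmooth (W : set V) (g : V -> V) : open W -> smooth_on W g -> msmooth W g.
Proof.
move=> oW sg i j; rewrite (ord1 i); exact: (smooth_on_row b j oW sg).
Qed.

Let mtau : msmooth W1 tau. Proof. exact: smooth_on_msmooth. Qed.

Lemma chris_transform x i j l : W1 x ->
  \sum_k G1 i j k x * T x k l = pder i (fun y => T y j l) x +
    \sum_a \sum_c G2 a c l (tau x) * T x i a * T x j c.
Proof.
move=> Wx; have := tauG (basisv R i) (basisv R j) Wx.
move=> /(congr1 (fun v : V => v 0 l)); rewrite !mxE.
have dT v y : W1 y -> ('D_v tau y) 0 l = (v *m T y) 0 l.
  move=> Wy; rewrite derive_row; last exact: smooth_on_derivable stau Wy.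
  exact: (derive_rowE oW1).
have bT k m y : (basisv R k *m T y) 0 m = T y k m by rewrite /basisv -rowE mxE.
have bc k m y : W1 y -> ('D_(basisv R k) tau y) 0 m = T y k m.
  move=> Wy; rewrite derive_row; last exact: smooth_on_derivable stau Wy.
  by rewrite mxE.
rewrite (dT _ x Wx) mxE.
have -> : \sum_k gamma_form G1 x (basisv R i) (basisv R j) 0 k * T x k l =
    \sum_k G1 i j k x * T x k l.
  apply: eq_bigr => k _; rewrite mxE (bigD1 i) //= (bigD1 j) //= !mxE !eqxx !mulr1.
  rewrite big1 => [|c cj]; last by rewrite !mxE (negbTE cj) mulr0.
  rewrite big1 => [|a ai]; last first.
    by rewrite big1 // => c _; rewrite !mxE (negbTE ai) mulr0 mul0r.
  by rewrite !addr0.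
move=> ->; congr (_ + _); last first.
  by apply: eq_bigr => a _; apply: eq_bigr => c _; rewrite (bc i a x Wx) (bc j c x Wx).
rewrite derive_row; last first.
  exact: smooth_on_derivable (smooth_on_derive _ stau) Wx.
by apply: (eq_on_derive oW1) => // y Wy; rewrite bc.
Qed.

Lemma pder_comp (f : V -> R) j y : smooth_on W2 f -> W1 y ->
  pder j (fun z => f (tau z)) y = \sum_l pder l f (tau y) * T y j l.
Proof.
move=> sf Wy.
have := congr1 (fun v : V => v 0 j) (gradr_comp oW1 oW2 tauW mtau sf Wy).
rewrite /gradr mxE => ->; rewrite mxE; apply: eq_bigr => l _.
by rewrite !mxE.
Qed.

(** The inhomogeneous term in the transformation of the Christoffel symbols
    cancels the second derivatives of [tau]: the covariant Hessian is a tensor. *)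
Lemma hessm_comp (f : V -> R) x : smooth_on W2 f -> W1 x ->
  hessm G1 (fun y => f (tau y)) x = T x *m hessm G2 f (tau x) *m (T x)^T.
Proof.
move=> sf Wx; apply/matrixP => i j; rewrite mxE.
have sd l : smooth_on W2 (pder l f) by exact: smooth_on_derive.
have D2 : pder i (pder j (fun y => f (tau y))) x =
    \sum_l ((\sum_m pder m (pder l f) (tau x) * T x i m) * T x j l +
      pder l f (tau x) * pder i (fun y => T y j l) x).
  rewrite {1}/pder (eq_on_derive oW1 (fun y Wy => pder_comp j sf Wy) _ Wx).
  have [_ ->] : is_derive x (basisv R i) (fun y => \sum_l pder l f (tau y) * T y j l)
      (\sum_l (pder l f (tau x) * pder i (fun y => T y j l) x +
        T x j l * pder i (fun y => pder l f (tau y)) x)).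
    apply: is_derive_sum_seq => l.
    have d1 := smooth_on_is_derive (basisv R i) (smooth_comp oW1 oW2 tauW mtau (sd l)) Wx.
    have d2 := smooth_on_is_derive (basisv R i) (msmooth_jac oW1 mtau j l) Wx.
    exact: is_deriveM.
  apply: eq_bigr => l _; rewrite addrC (pder_comp i (sd l) Wx).
  by congr (_ + _); rewrite mulrC.
rewrite D2.
have -> : \sum_k G1 i j k x * pder k (fun y => f (tau y)) x =
    \sum_l pder l f (tau x) * (\sum_k G1 i j k x * T x k l).
  under eq_bigr => k _ do rewrite (pder_comp k sf Wx) mulr_sumr.
  rewrite exchange_big /=; apply: eq_bigr => l _; rewrite mulr_sumr.
  by apply: eq_bigr => k _; rewrite mulrCA.
under [X in _ - X]eq_bigr => l _ do rewrite (chris_transform i j l Wx) mulrDr.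
rewrite !big_split /= opprD [X in X + _]addrC addrACA subrr add0r.
rewrite mxE.
under [RHS]eq_bigr => l _ do rewrite !mxE.
have -> : \sum_l pder l f (tau x) * (\sum_a \sum_c G2 a c l (tau x) * T x i a * T x j c)
   = \sum_c \sum_a (T x i a * (\sum_l G2 a c l (tau x) * pder l f (tau x))) * T x j c.
  under eq_bigr => l _ do rewrite mulr_sumr.
  rewrite exchange_big [RHS]exchange_big /=; apply: eq_bigr => a _.
  under eq_bigr => l _ do rewrite mulr_sumr.
  rewrite exchange_big /=; apply: eq_bigr => c _.
  rewrite mulr_sumr mulr_suml; apply: eq_bigr => l _; ring.
rewrite -sumrB; apply: eq_bigr => l _.
rewrite !mulr_suml -sumrB; apply: eq_bigr => a _.
by rewrite !mxE; ring.
Qed.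

End Naturality.

End LocalOperator.

(** * Naturality, uniqueness and the two identities *)

Section TransportNaturality.
Variables (R : realType) (n : nat).
Local Notation V := 'rV[R]_n.
Local Notation b := (row_fbasis R n).
Local Notation chris := ('I_n -> 'I_n -> 'I_n -> V -> R).
Implicit Types (x v : V).

Lemma gradr_eq_on (W : set V) (f g : V -> R) x : open W ->
  (forall y, W y -> f y = g y) -> W x -> gradr f x = gradr g x.
Proof.
by move=> oW fg Wx; apply/rowP => i; rewrite !mxE; apply: (eq_on_derive oW).
Qed.

Lemma hessm_eq_on (W : set V) (G : chris) (f g : V -> R) x : open W ->
  (forall y, W y -> f y = g y) -> W x -> hessm G f x = hessm G g x.
Proof.
move=> oW fg Wx; apply/matrixP => i j; rewrite !mxE.
have E k y : W y -> pder k f y = pder k g y by move=> Wy; apply: (eq_on_derive oW).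
have E1 : pder i (pder j f) x = pder i (pder j g) x.
  exact: (eq_on_derive oW (E j) (basisv R i) Wx).
rewrite E1; congr (_ - _); apply: eq_bigr => k _; by rewrite (E k x Wx).
Qed.

Lemma invmx_congr (T H : 'M[R]_n) : T \in unitmx -> H \in unitmx ->
  invmx (T *m H *m T^T) = (invmx T)^T *m invmx H *m invmx T.
Proof.
move=> uT uH.
have uTT : T^T \in unitmx by rewrite unitmx_tr.
have uA : T *m H *m T^T \in unitmx by rewrite !unitmx_mul uT uH uTT.
apply: (can_inj (mulKmx uA)); rewrite mulmxV // trmx_inv.
by rewrite !mulmxA mulmxK // mulmxK // mulmxV.
Qed.

(** Lie derivatives of forms commute with pull-back. Here [M1] and [M2] are the
    Jacobians of two related fields and [DT] is the derivative along the first of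
    the Jacobian [T] of the map that relates them. *)
Lemma lie_form_congr (T C DT M1 DC M2 H : 'M[R]_n) :
  M1 *m T = T *m M2 - DT -> DC + M2 *m C + C *m M2^T = H ->
  (DT *m C + T *m DC) *m T^T + T *m C *m DT^T + M1 *m (T *m C *m T^T) +
    T *m C *m T^T *m M1^T = T *m H *m T^T.
Proof.
move=> E1 <-; rewrite !mulmxA E1 -[_ *m T^T *m M1^T]mulmxA -trmx_mul E1.
rewrite [in (_ - _)^T]linearB /= trmx_mul.
rewrite !(mulmxDl, mulmxDr, mulNmx, mulmxN) !mulmxA.
move: (DT *m _ *m _) (T *m DC *m _) (_ *m DT^T) (T *m M2 *m _ *m _)
  (T *m _ *m M2^T *m _) => a1 a2 a3 a4 a5.
by apply/matrixP => i j; rewrite !mxE; ring.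
Qed.

Lemma lie_covec_congr (T DT M1 M2 : 'M[R]_n) (B DB H : 'cV[R]_n) :
  M1 *m T = T *m M2 - DT -> DB + M2 *m B = H ->
  DT *m B + T *m DB + M1 *m (T *m B) = T *m H.
Proof.
move=> E1 <-; rewrite mulmxA E1 mulmxBl mulmxDr !mulmxA.
move: (DT *m _) (T *m DB) (T *m M2 *m _) => a1 a2 a3.
by apply/matrixP => i j; rewrite !mxE; ring.
Qed.

Variables (G1 G2 : chris) (W1 W2 : set V) (tau : V -> V).
Hypotheses (oW1 : open W1) (oW2 : open W2).
Hypothesis tauW : forall x, W1 x -> W2 (tau x).
Hypothesis stau : smooth_on W1 tau.
Hypothesis tauU : forall x, W1 x -> jac tau x \in unitmx.
Hypothesis tauG : gamma_transform W1 tau G1 G2.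
Hypothesis sG1 : forall i j k, smooth_on W1 (G1 i j k).
Local Notation T := (jac tau).

Let mtau : msmooth W1 tau. Proof. exact: smooth_on_msmooth. Qed.

Variables (f1 f2 : V -> R) (C : V -> 'M[R]_n) (B : V -> 'cV[R]_n).
Hypothesis f12 : forall x, W1 x -> f1 x = f2 (tau x).
Hypothesis sol2 : transport_sol G2 f2 W2 C B.

Let sf2 : smooth_on W2 f2. Proof. exact: ts_fun sol2. Qed.
Let sG2 : forall i j k, smooth_on W2 (G2 i j k). Proof. exact: ts_chris sol2. Qed.
Let hf2 : forall x, W2 x -> \det (hessm G2 f2 x) != 0. Proof. exact: ts_hess sol2. Qed.

Let sf1 : smooth_on W1 f1.
Proof.
apply: (smooth_on_eq oW1 _ (smooth_comp oW1 oW2 tauW mtau sf2)) => x Wx.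
by rewrite f12.
Qed.

Let uH2 x : W1 x -> hessm G2 f2 (tau x) \in unitmx.
Proof. by move=> Wx; rewrite unitmxE unitfE hf2 //; exact: tauW. Qed.

Let uTT x : W1 x -> (T x)^T \in unitmx.
Proof. by move=> Wx; rewrite unitmx_tr tauU. Qed.

Let gradr1 x : W1 x -> gradr f1 x = gradr f2 (tau x) *m (T x)^T.
Proof.
move=> Wx; rewrite (gradr_eq_on oW1 f12 Wx).
exact: (gradr_comp oW1 oW2 tauW mtau sf2 Wx).
Qed.

Let hess1 x : W1 x -> hessm G1 f1 x = T x *m hessm G2 f2 (tau x) *m (T x)^T.
Proof.
move=> Wx; rewrite (hessm_eq_on G1 oW1 f12 Wx).
exact: (hessm_comp oW1 oW2 tauW stau tauG sf2 Wx).
Qed.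

Let uH1 x : W1 x -> hessm G1 f1 x \in unitmx.
Proof. by move=> Wx; rewrite hess1 // !unitmx_mul tauU // uH2 // uTT. Qed.

Let hf1 x : W1 x -> \det (hessm G1 f1 x) != 0.
Proof. by move=> Wx; have := uH1 Wx; rewrite unitmxE unitfE. Qed.

Lemma grad_field_comp x : W1 x ->
  grad_field G1 f1 x *m T x = grad_field G2 f2 (tau x).
Proof.
move=> Wx; apply: (can_inj (mulmxK (uH2 Wx))).
apply: (can_inj (mulmxK (uTT Wx))).
rewrite -!mulmxA [T x *m (_ *m _)]mulmxA -(hess1 Wx).
by rewrite (mulVmx (uH1 Wx)) mulmx1 (mulKmx (uH2 Wx)) (gradr1 Wx).
Qed.

Let mX1 : msmooth W1 (grad_field G1 f1).
Proof. exact: msmooth_grad_field. Qed.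

Let mX2 : msmooth W2 (grad_field G2 f2).
Proof. exact: msmooth_grad_field. Qed.

Let mT : msmooth W1 T. Proof. exact: msmooth_jac. Qed.

Lemma derm_cst_mul p q m (A : 'M[R]_(p, q)) (F : V -> 'M[R]_(q, m)) x v :
  msmooth W1 F -> W1 x -> derm v (fun y => A *m F y) x = A *m derm v F x.
Proof.
move=> sF Wx.
have sA : msmooth W1 (fun _ : V => A) by move=> i j; exact: (smooth_on_cst b oW1).
rewrite (derm_mul v sA sF Wx).
have -> : derm v (fun _ : V => A) x = 0.
  by apply/matrixP => i j; rewrite !mxE derive_cst.
by rewrite mul0mx add0r.
Qed.

(** The relation between the two gradient fields, differentiated; equality of
    mixed partials produces the derivative of [T] along the first field. *)
Lemma jac_grad_field_comp x : W1 x ->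
  jac (grad_field G1 f1) x *m T x + derm (grad_field G1 f1 x) T x =
    T x *m jac (grad_field G2 f2) (tau x).
Proof.
move=> Wx; apply/row_matrixP => i; rewrite linearD /= !row_mul.
set X1 := grad_field G1 f1; set X2 := grad_field G2 f2.
have r1 := row_jac X1 i x.
have r2 : row i (derm (X1 x) T x) = X1 x *m derm (basisv R i) T x.
  apply/rowP => k; rewrite mxE (derm_jac oW1 _ _ _ mtau Wx).
  by rewrite -(derm_cst_mul _ _ mT Wx) mxE.
rewrite r1 r2 -(derm_mul _ mX1 mT Wx).
rewrite (derm_eq oW1 (G := fun y => X2 (tau y)) _ _ Wx); last first.
  by move=> y Wy; exact: grad_field_comp.
rewrite (derm_comp oW1 oW2 tauW mtau _ mX2 Wx).
by rewrite (derm_row oW2 _ mX2 (tauW Wx)) /basisv -rowE.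
Qed.

Definition pull_form x := T x *m C (tau x) *m (T x)^T.
Definition pull_covec x := T x *m B (tau x).

Let mC2 : msmooth W1 (fun x => C (tau x)).
Proof. exact: (msmooth_comp oW1 oW2 tauW mtau (ts_form sol2)). Qed.

Let mB2 : msmooth W1 (fun x => B (tau x)).
Proof. exact: (msmooth_comp oW1 oW2 tauW mtau (ts_covec sol2)). Qed.

Let mpull_form : msmooth W1 pull_form.
Proof. exact: (msmooth_mul oW1 (msmooth_mul oW1 mT mC2) (msmooth_tr oW1 mT)). Qed.

Let inv1 x : W1 x -> invmx (hessm G1 f1 x) =
  (invmx (T x))^T *m invmx (hessm G2 f2 (tau x)) *m invmx (T x).
Proof. by move=> Wx; rewrite hess1 // invmx_congr ?tauU // uH2. Qed.

Lemma symbol_comp x : W1 x -> symbol G1 f1 pull_form x =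
  (invmx (T x))^T *m symbol G2 f2 C (tau x) *m invmx (T x).
Proof.
move=> Wx; rewrite /symbol inv1 // /pull_form -scalemxAr -scalemxAl.
congr (_ *: _); rewrite !trmx_mul trmxK !mulmxA.
rewrite (mulmxKV (tauU Wx)).
by rewrite -[_ *m (T x)^T *m _]mulmxA -trmx_mul (mulVmx (tauU Wx)) trmx1 mulmx1.
Qed.

Lemma trace_comp (S H : 'M[R]_n) x : W1 x ->
  \tr ((invmx (T x))^T *m S *m invmx (T x) *m (T x *m H *m (T x)^T)^T) =
  \tr (S *m H^T).
Proof.
move=> Wx; rewrite !trmx_mul trmxK !mulmxA (mulmxKV (tauU Wx)).
rewrite mxtrace_mulC !mulmxA -trmx_mul mulVmx ?(tauU Wx) // trmx1 mul1mx //.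
Qed.

Lemma defect_comp x : W1 x -> defect G1 f1 pull_form x = defect G2 f2 C (tau x).
Proof.
by move=> Wx; rewrite /defect (symbol_comp Wx) (hess1 Wx) (trace_comp _ _ Wx).
Qed.

(** All ingredients of the equations are tensors. *)
Lemma transport_sol_pull : transport_sol G1 f1 W1 pull_form pull_covec.
Proof.
have XT x : W1 x -> jac (grad_field G1 f1) x *m T x =
    T x *m jac (grad_field G2 f2) (tau x) - derm (grad_field G1 f1 x) T x.
  by move=> Wx; rewrite -(jac_grad_field_comp Wx) addrK.
apply: TransportSol.
- exact: sf1.
- exact: sG1.
- exact: hf1.
- exact: mpull_form.
- exact: (msmooth_mul oW1 mT mB2).
- move=> x Wx; rewrite /pull_form.
  rewrite (derm_mul _ (msmooth_mul oW1 mT mC2) (msmooth_tr oW1 mT) Wx).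
  rewrite (derm_mul _ mT mC2 Wx) derm_tr.
  rewrite (derm_comp oW1 oW2 tauW mtau _ (ts_form sol2) Wx) (grad_field_comp Wx).
  rewrite (hess1 Wx).
  exact: (lie_form_congr (XT x Wx) (ts_form_eq sol2 (tauW Wx))).
- move=> x Wx; rewrite /pull_covec (derm_mul _ mT mB2 Wx).
  rewrite (derm_comp oW1 oW2 tauW mtau _ (ts_covec sol2) Wx) (grad_field_comp Wx).
  rewrite (gradr_eq_on oW1 defect_comp Wx).
  have sdef : smooth_on W2 (defect G2 f2 C).
    exact: (smooth_defect oW2 sG2 sf2 hf2 (ts_form sol2)).
  rewrite (gradr_comp oW1 oW2 tauW mtau sdef Wx) trmx_mul trmxK.
  exact: (lie_covec_congr (XT x Wx) (ts_covec_eq sol2 (tauW Wx))).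
Qed.

Lemma box_real_comp (h : V -> R) x : smooth_on W2 h -> W1 x ->
  box_real G1 f1 pull_form pull_covec (fun y => h (tau y)) x =
  box_real G2 f2 C B h (tau x).
Proof.
move=> sh Wx; rewrite /box_real (symbol_comp Wx).
rewrite (hessm_comp oW1 oW2 tauW stau tauG sh Wx) (trace_comp _ _ Wx); congr (_ + _).
rewrite (gradr_comp oW1 oW2 tauW mtau sh Wx) (inv1 Wx) /pull_covec !mulmxA.
rewrite (mulmxKV (tauU Wx)) -[_ *m (T x)^T *m _]mulmxA -trmx_mul.
by rewrite mulVmx ?(tauU Wx) // trmx1 mulmx1.
Qed.

End TransportNaturality.

Section RowSums.
Variables (R : realType) (n : nat) (M : 'M[R]_n).
Hypothesis HM : forall i, \sum_k `|M i k - (i == k)%:R| <= 1 / 4.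

(** The identity damps at rate 1 and the deviation from it costs 1/4. *)
Lemma covec_weight (e : R) i : 0 <= e <= 1 ->
  \sum_k `|(i == k)%:R - e * M i k| <= 1 - 1 / 2 * e.
Proof.
move=> /andP[e0 e1].
apply: (@le_trans _ _ (\sum_k ((1 - e) * (i == k)%:R + e * `|M i k - (i == k)%:R|))).
  apply: ler_sum => k _.
  have -> : (i == k)%:R - e * M i k =
    (1 - e) * (i == k)%:R - e * (M i k - (i == k)%:R) by ring.
  apply: (le_trans (ler_normB _ _)); rewrite !normrM (ger0_norm e0).
  by rewrite ger0_norm ?subr_ge0 // ger0_norm.
rewrite big_split /= -!mulr_sumr (bigD1 i) //= eqxx big1 => [|k ki]; last first.
  by rewrite eq_sym (negbTE ki).
rewrite addr0 mulr1.
have := ler_wpM2l e0 (HM i); move: (\sum_k _) => S HS; lra.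
Qed.

(** For [p = (i, j)] and [q = (k, l)], the coefficient of [C k l] in the entry
    [(i, j)] of [M C + C M^T]. *)
Definition form_coef (p q : 'I_n * 'I_n) : R :=
  M p.1 q.1 * (p.2 == q.2)%:R + M p.2 q.2 * (p.1 == q.1)%:R.

Lemma form_coef_sum (C : 'M[R]_n) p :
  \sum_q form_coef p q * C q.1 q.2 = (M *m C + C *m M^T) p.1 p.2.
Proof.
case: p => i j; rewrite -(pair_big xpredT xpredT (fun k l => form_coef (i, j) (k, l) * C k l)) /=.
rewrite !mxE; under eq_bigr => k _ do under eq_bigr => l _ do
  rewrite /form_coef /= mulrDl.
under eq_bigr => k _ do rewrite big_split /=.
rewrite big_split /=; congr (_ + _).
  apply: eq_bigr => k _; rewrite (bigD1 j) //= eqxx mulr1 big1 ?addr0 // => l lj.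
  by rewrite eq_sym (negbTE lj) mulr0 mul0r.
rewrite (bigD1 i) //= [X in _ + X]big1 ?addr0 => [|k ki]; last first.
  by rewrite big1 // => l _; rewrite eq_sym (negbTE ki) mulr0 mul0r.
by apply: eq_bigr => l _; rewrite eqxx mulr1 mxE mulrC.
Qed.

(** On forms the identity damps at rate 2, and the deviation counts twice. *)
Lemma form_weight (e : R) p : 0 <= e <= 1 / 2 ->
  \sum_q `|(p == q)%:R - e * form_coef p q| <= 1 - 1 / 2 * e.
Proof.
case: p => i j /andP[e0 e1].
rewrite -(pair_big xpredT xpredT (fun k l => `|((i, j) == (k, l))%:R - e * form_coef (i, j) (k, l)|)) /=.
apply: (@le_trans _ _ (\sum_k \sum_l ((1 - 2 * e) * ((i == k)%:R * (j == l)%:R) +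
   e * (`|M i k - (i == k)%:R| * (j == l)%:R) +
   e * (`|M j l - (j == l)%:R| * (i == k)%:R)))).
  apply: ler_sum => k _; apply: ler_sum => l _; rewrite /form_coef /=.
  have -> : ((i, j) == (k, l)) = (i == k) && (j == l) by [].
  have -> : ((i == k) && (j == l))%:R - e * (M i k * (j == l)%:R + M j l * (i == k)%:R)
    = (1 - 2 * e) * ((i == k)%:R * (j == l)%:R) -
      e * ((M i k - (i == k)%:R) * (j == l)%:R) -
      e * ((M j l - (j == l)%:R) * (i == k)%:R).
    by rewrite -mulnb natrM; ring.
  apply: (le_trans (ler_normB _ _)); apply: lerD.
    apply: (le_trans (ler_normB _ _)); apply: lerD.
      by rewrite ger0_norm // mulr_ge0 ?mulr_ge0 //; lra.
    by rewrite !normrM (ger0_norm e0) [`|(_)%:R|]ger0_norm.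
  by rewrite !normrM (ger0_norm e0) [`|(_)%:R|]ger0_norm.
have ind (m : 'I_n) (F : 'I_n -> R) : \sum_l F l * (m == l)%:R = F m.
  rewrite (bigD1 m) //= eqxx mulr1 big1 ?addr0 // => l lm.
  by rewrite eq_sym (negbTE lm) mulr0.
have i1 (m : 'I_n) : \sum_l (m == l)%:R = 1 :> R.
  by rewrite -[RHS](ind m (fun _ => 1)); apply: eq_bigr => l _; rewrite mul1r.
have pull (a : R) (F : 'I_n -> 'I_n -> R) :
    \sum_k \sum_l a * F k l = a * \sum_k \sum_l F k l.
  by rewrite mulr_sumr; apply: eq_bigr => k _; rewrite mulr_sumr.
under eq_bigr => k _ do rewrite !big_split /=.
rewrite !big_split /= !pull.
have -> : \sum_k \sum_l (i == k)%:R * (j == l)%:R = 1 :> R.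
  rewrite -[RHS](i1 i); apply: eq_bigr => k _.
  by rewrite -mulr_sumr i1 mulr1.
have -> : \sum_k \sum_l `|M i k - (i == k)%:R| * (j == l)%:R = \sum_k `|M i k - (i == k)%:R|.
  by apply: eq_bigr => k _; rewrite -mulr_sumr i1 mulr1.
have -> : \sum_k \sum_l `|M j l - (j == l)%:R| * (i == k)%:R = \sum_l `|M j l - (j == l)%:R|.
  rewrite exchange_big; apply: eq_bigr => l _; by rewrite -mulr_sumr i1 mulr1.
have H1 := ler_wpM2l e0 (HM i); have H2 := ler_wpM2l e0 (HM j).
by move: (\sum_k `|M i k - _|) (\sum_k `|M j k - _|) H1 H2 => S1 S2 H1 H2; lra.
Qed.

End RowSums.

Section LocalVerification.
Variables (R : realType) (n : nat).
Local Notation V := 'rV[R]_n.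
Local Notation b := (row_fbasis R n).
Local Notation chris := ('I_n -> 'I_n -> 'I_n -> V -> R).
Implicit Types (x v : V).

(** The bound on [x - X x] keeps backward steps inside the ball, the bound on the
    Jacobian provides the damping. *)
Definition inward_field (X : V -> V) (xc : V) (r0 r : R) :=
  [/\ 0 < r0, r0 < r, forall x, ball xc r x -> `|x - X x - xc| < r0 &
    forall x i, ball xc r x -> \sum_k `|jac X x i k - (i == k)%:R| < 1 / 4].

Variables (G : chris) (f : V -> R) (xc : V) (r0 r : R).
Local Notation X := (grad_field G f).
Hypothesis HX : inward_field X xc r0 r.
Local Notation W := (ball xc r).

Let oW : open W. Proof. exact: ball_open. Qed.
Let r0r : r0 < r. Proof. by case: HX. Qed.
Let inw x : W x -> `|x - X x - xc| < r0. Proof. by case: HX => _ _ + _; exact. Qed.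
Let HM x : W x -> forall i, \sum_k `|jac X x i k - (i == k)%:R| <= 1 / 4.
Proof. by move=> Wx i; case: HX => _ _ _ /(_ x i Wx) /ltW. Qed.

Lemma covec_unique (B : V -> 'cV[R]_n) : msmooth W B ->
  (forall x, W x -> derm (X x) B x + jac X x *m B x = 0) ->
  forall x, W x -> B x = 0.
Proof.
move=> sB HB x Wx; apply/matrixP => i j; rewrite (ord1 j) mxE.
apply: (transport_unique r0r inw (A := fun i k x => jac X x i k)
  (u := fun i x => B x i 0) (c := 1 / 2) (e := 1)) Wx => //.
- by move=> y k Wy; apply: (covec_weight (HM Wy)); rewrite ler01 lexx.
- move=> k y Wy; have := congr1 (fun v : 'cV[R]_n => v k 0) (HB y Wy).
  by rewrite !mxE.
Qed.

Lemma form_unique (C : V -> 'M[R]_n) : msmooth W C ->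
  (forall x, W x -> derm (X x) C x + jac X x *m C x + C x *m (jac X x)^T = 0) ->
  forall x, W x -> C x = 0.
Proof.
move=> sC HC x Wx; apply/matrixP => i j; rewrite mxE.
apply: (transport_unique r0r inw
  (A := fun p q x => form_coef (jac X x) p q)
  (u := fun p x => C x p.1 p.2) (c := 1 / 2) (e := 1 / 2) _ _ _ _ _ (i, j) Wx) => //.
- move=> y k Wy; apply: (form_weight (HM Wy)); rewrite lexx andbT.
  by rewrite divr_ge0.
- move=> k y Wy; rewrite form_coef_sum.
  have := congr1 (fun v : 'M[R]_n => v k.1 k.2) (HC y Wy).
  by rewrite -addrA !mxE.
Qed.

Lemma derm_sub p q v (F1 F2 : V -> 'M[R]_(p, q)) x :
  msmooth W F1 -> msmooth W F2 -> W x ->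
  derm v (fun y => F1 y - F2 y) x = derm v F1 x - derm v F2 x.
Proof.
move=> s1 s2 Wx; apply/matrixP => i j; rewrite !mxE.
have d1 := smooth_on_is_derive v (s1 i j) Wx.
have d2 := smooth_on_is_derive v (s2 i j) Wx.
have [_ <-] := is_deriveB d1 d2.
by apply: (eq_on_derive oW _ _ Wx) => y _; rewrite !mxE.
Qed.

Lemma msmooth_sub p q (F1 F2 : V -> 'M[R]_(p, q)) :
  msmooth W F1 -> msmooth W F2 -> msmooth W (fun y => F1 y - F2 y).
Proof.
move=> s1 s2 i j; apply: (smooth_on_eq oW _ (smooth_onB b oW (s1 i j) (s2 i j))).
by move=> y _; rewrite !mxE.
Qed.

Lemma transport_sol_unique C1 B1 C2 B2 :
  transport_sol G f W C1 B1 -> transport_sol G f W C2 B2 ->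
  forall x, W x -> C1 x = C2 x /\ B1 x = B2 x.
Proof.
move=> s1 s2.
have EC x : W x -> C1 x = C2 x.
  move=> Wx; apply/eqP; rewrite -subr_eq0; apply/eqP.
  apply: (form_unique (C := fun y => C1 y - C2 y) _ _ Wx).
    exact: msmooth_sub (ts_form s1) (ts_form s2).
  move=> y Wy; rewrite (derm_sub _ (ts_form s1) (ts_form s2) Wy).
  rewrite mulmxBr mulmxBl.
  have := ts_form_eq s1 Wy; rewrite -(ts_form_eq s2 Wy).
  move: (derm _ C1 _) (derm _ C2 _) (_ *m C1 y) (_ *m C2 y) (C1 y *m _) (C2 y *m _).
  move=> a1 a2 b1 b2 c1 c2 E.
  have -> : a1 - a2 + (b1 - b2) + (c1 - c2) = (a1 + b1 + c1) - (a2 + b2 + c2).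
    by apply/matrixP => i j; rewrite !mxE; ring.
  by rewrite E subrr.
move=> x Wx; split; first exact: EC.
apply/eqP; rewrite -subr_eq0; apply/eqP.
apply: (covec_unique (B := fun y => B1 y - B2 y) _ _ Wx).
  exact: msmooth_sub (ts_covec s1) (ts_covec s2).
move=> y Wy; rewrite (derm_sub _ (ts_covec s1) (ts_covec s2) Wy) mulmxBr.
have Ed : gradr (defect G f C1) y = gradr (defect G f C2) y.
  apply: (gradr_eq_on oW _ Wy) => z Wz.
  by rewrite /defect /symbol (EC z Wz).
have := ts_covec_eq s1 Wy; rewrite Ed -(ts_covec_eq s2 Wy).
move: (derm _ B1 _) (derm _ B2 _) (_ *m B1 y) (_ *m B2 y) => a1 a2 b1 b2 E.
have -> : a1 - a2 + (b1 - b2) = (a1 + b1) - (a2 + b2).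
  by apply/matrixP => i j; rewrite !mxE; ring.
by rewrite E subrr.
Qed.

Variables (C : V -> 'M[R]_n) (B : V -> 'cV[R]_n) (p : V).
Hypothesis sol : transport_sol G f W C B.
Hypotheses (Wp : W p) (crit : gradr f p = 0).

Let sf : smooth_on W f. Proof. exact: ts_fun sol. Qed.
Let sG : forall i j k, smooth_on W (G i j k). Proof. exact: ts_chris sol. Qed.
Let hf : forall x, W x -> \det (hessm G f x) != 0. Proof. exact: ts_hess sol. Qed.
Let mX : msmooth W X. Proof. exact: (msmooth_grad_field oW sG sf hf). Qed.
Let sC : msmooth W C. Proof. exact: ts_form sol. Qed.
Let sB : msmooth W B. Proof. exact: ts_covec sol. Qed.

Let tr11 (A : 'M[R]_1) : A^T 0 0 = A 0 0. Proof. by rewrite mxE. Qed.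

Lemma field_crit : X p = 0.
Proof. by rewrite /grad_field crit mul0mx. Qed.

(** The differential of such a function solves the homogeneous transport
    equation on covectors, hence vanishes by uniqueness. *)
Lemma first_integral_cst (w : V -> R) : smooth_on W w -> w p = 0 ->
  (forall x, W x -> 'D_(X x) w x = 0) -> forall x, W x -> w x = 0.
Proof.
move=> sw wp Hw.
have dw x : W x -> gradr w x = 0.
  move=> Wx; apply: trmx_inj; rewrite trmx0.
  apply: (covec_unique (B := fun y => (gradr w y)^T) _ _ Wx).
    exact: (msmooth_tr oW (msmooth_gradr oW sw)).
  move=> y Wy; apply/matrixP => i j; rewrite (ord1 j) !mxE.
  have E1 : pder i (fun z => \sum_k X z 0 k * pder k w z) y = 0.
    rewrite -[RHS](derive_cst (0 : R) y (basisv R i)).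
    apply: (eq_on_derive oW) => // z Wz.
    transitivity ('D_(X z) w z); last exact: Hw.
    exact/esym/(deriveEcoord b oW _ sw Wz).
  have E2 : is_derive y (basisv R i) (fun z => \sum_k X z 0 k * pder k w z)
     (\sum_k (X y 0 k * pder i (pder k w) y + pder k w y * pder i (fun z => X z 0 k) y)).
    apply: is_derive_sum_seq => k.
    have d1 := smooth_on_is_derive (basisv R i) (mX 0 k) Wy.
    have d2 := smooth_on_is_derive (basisv R i) (smooth_on_derive (basisv R k) sw) Wy.
    exact: is_deriveM.
  have [_ E3] := E2; rewrite -[RHS]E1 [RHS]E3 big_split /=; congr (_ + _).
    have -> : (fun z => (gradr w z)^T i 0) = pder i w.
      by apply/funext => z; rewrite !mxE.
    rewrite (deriveEcoord b oW _ (smooth_on_derive (basisv R i) sw) Wy).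
    apply: eq_bigr => k _.
    exact: (congr1 (fun z => X y 0 k * z)
      (schwarz_derive oW (basisv R k) (basisv R i) sw Wy)).
  by apply: eq_bigr => k _; rewrite !mxE mulrC.
move=> x Wx.
have Wseg (t : R) : 0 <= t <= 1 -> W (t *: (x - p) + p) by exact: ball_segment.
have [t t01 E] := @mean_value _ _ w p (x - p)
  (fun t t01 => smooth_on_derivable sw (Wseg t t01) (v := x - p)).
have t01' : 0 <= t <= 1 by case/andP: t01 => /ltW -> /ltW ->.
move: E; rewrite subrK wp subr0 => ->.
by rewrite (derive_gradr oW _ sw (Wseg t t01')) (dw _ (Wseg t t01')) trmx0 mulmx0 mxE.
Qed.

(** Both sides vanish at [p], and their derivatives along [X] are [H(X, X)] and
    [d f (X)], which agree by the definition of [X]. *)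
Lemma form_on_field x : W x -> (X x *m C x *m (X x)^T) 0 0 = f x - f p.
Proof.
move=> Wx; apply/eqP; rewrite -subr_eq0; apply/eqP.
have mF : msmooth W (fun x => X x *m C x *m (X x)^T).
  exact: (msmooth_mul oW (msmooth_mul oW mX sC) (msmooth_tr oW mX)).
have sF := mF 0 0.
have sfp : smooth_on W (fun y => f y - f p).
  exact: (smooth_onB b oW sf (smooth_on_cst b oW (f p))).
apply: (first_integral_cst (w := fun y => (X y *m C y *m (X y)^T) 0 0 - (f y - f p))
  _ _ _ Wx).
- exact: (smooth_onB b oW sF sfp).
- by rewrite field_crit mul0mx mul0mx mxE !subrr.
move=> y Wy.
have dF := smooth_on_is_derive (X y) sF Wy.
have df := smooth_on_is_derive (X y) sf Wy.
have [_ ->] := is_deriveB dF (is_deriveB df (is_derive_cst (f p) y (X y))).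
rewrite subr0.
have -> : 'D_(X y) (fun y => (X y *m C y *m (X y)^T) 0 0) y =
  derm (X y) (fun y => X y *m C y *m (X y)^T) y 0 0 by rewrite mxE.
rewrite (derm_mul _ (msmooth_mul oW mX sC) (msmooth_tr oW mX) Wy).
rewrite (derm_mul _ mX sC Wy) derm_tr (derm_row oW _ mX Wy).
rewrite (derive_gradr oW _ sf Wy) -(grad_field_hess hf Wy) -(ts_form_eq sol Wy).
move: (X y) (jac X y) (derm (X y) C y) (C y) => x0 M D0 C0.
apply/eqP; rewrite subr_eq0; apply/eqP.
rewrite (_ : (x0 *m (x0 *m _)^T) 0 0 =
  (x0 *m (D0 + M *m C0 + C0 *m M^T) *m x0^T) 0 0); last first.
  by rewrite -tr11 trmx_mul trmxK.
rewrite !(mulmxDr, mulmxDl) trmx_mul !mulmxA.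
by rewrite [x0 *m D0 *m _ + _]addrC.
Qed.

Lemma jac_field_crit : jac X p = 1%:M.
Proof.
have uH : hessm G f p \in unitmx by rewrite unitmxE unitfE hf.
apply: (can_inj (mulmxK uH)); rewrite mul1mx; apply/row_matrixP => i.
rewrite row_mul.
have r1 := row_jac X i p.
have mH := msmooth_hessm oW sG sf.
have E := derm_mul (basisv R i) mX mH Wp.
rewrite field_crit mul0mx addr0 in E.
rewrite r1 -E (derm_eq oW (G := gradr f) _ _ Wp); last first.
  by move=> y Wy; exact: (grad_field_hess hf Wy).
apply/rowP => j; rewrite !mxE.
have -> : (fun y => gradr f y 0 j) = pder j f by apply/funext => y; rewrite mxE.
rewrite [X in _ - X]big1 ?subr0 // => k _.
have := congr1 (fun v : V => v 0 k) crit; rewrite !mxE => ->.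
by rewrite mulr0.
Qed.

(** At [p] the equation for the form reads [2 C = H]. *)
Lemma defect_crit : defect G f C p = 0.
Proof.
have uH : hessm G f p \in unitmx by rewrite unitmxE unitfE hf.
have := ts_form_eq sol Wp; rewrite jac_field_crit field_crit mul1mx trmx1 mulmx1.
have -> : derm 0 C p = 0 by apply/matrixP => i j; rewrite !mxE derive0.
rewrite add0r => HC.
rewrite /defect /symbol scalemxAl scalemxAr.
have -> : 2%:R *: C p = hessm G f p by rewrite -HC scaler_nat mulr2n.
rewrite (mulVmx uH) mul1mx -trmx_mul (mulmxV uH).
by rewrite trmx1 mxtrace1 subrr.
Qed.

(** Both sides vanish at [p] and have the same derivative along [X]. *)
Lemma covec_on_field x : W x -> (X x *m B x) 0 0 = defect G f C x.
Proof.
move=> Wx; apply/eqP; rewrite -subr_eq0; apply/eqP.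
have sd : smooth_on W (defect G f C) by exact: (smooth_defect oW sG sf hf sC).
have sF := msmooth_mul oW mX sB 0 0.
apply: (first_integral_cst (w := fun y => (X y *m B y) 0 0 - defect G f C y)
  _ _ _ Wx).
- exact: (smooth_onB b oW sF sd).
- by rewrite field_crit mul0mx mxE defect_crit subrr.
move=> y Wy.
have dF := smooth_on_is_derive (X y) sF Wy.
have dd := smooth_on_is_derive (X y) sd Wy.
have [_ ->] := is_deriveB dF dd.
have -> : 'D_(X y) (fun y => (X y *m B y) 0 0) y =
  derm (X y) (fun y => X y *m B y) y 0 0 by rewrite mxE.
rewrite (derm_mul _ mX sB Wy) (derm_row oW _ mX Wy).
rewrite (derive_gradr oW _ sd Wy) -(ts_covec_eq sol Wy).
move: (X y) (jac X y) (derm (X y) B y) (B y) => x0 M D0 B0.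
by rewrite mulmxDr mulmxA [x0 *m D0 + _]addrC subrr.
Qed.

(** The terms of order [t ^- 2] in the evolution equation. *)
Lemma symbol_self x : W x ->
  (gradr f x *m symbol G f C x *m (gradr f x)^T) 0 0 = 2 * (f x - f p).
Proof.
move=> Wx; rewrite -form_on_field // /symbol -scalemxAr -scalemxAl mxE.
by rewrite /grad_field trmx_mul !mulmxA.
Qed.

(** The terms of order [t ^- 1] in the evolution equation. *)
Lemma box_real_self x : W x -> box_real G f C B f x = n%:R.
Proof.
move=> Wx; rewrite /box_real -/(X x) covec_on_field // /defect.
by rewrite addrC subrK.
Qed.

End LocalVerification.

(** * Transport equations with parameters *)

Section Near.
Variables (R : realType) (T : topologicalType).
Implicit Types (g : T -> R) (w : T).

Lemma near_neq0 g w : {for w, continuous g} -> g w != 0 -> \forall y \near w, g y != 0.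
Proof. move=> cg; exact: cvgr_neq0. Qed.

Lemma near_lt g w c : {for w, continuous g} -> g w < c -> \forall y \near w, g y < c.
Proof. move=> cg; exact: cvgr_lt. Qed.

Lemma near_dist g w c : {for w, continuous g} -> 0 < c ->
  \forall y \near w, `|g w - g y| < c.
Proof. move=> cg; exact: cvgr_dist_lt. Qed.

Lemma near_forall (I : finType) w (P : I -> T -> Prop) :
  (forall i, \forall y \near w, P i y) -> \forall y \near w, forall i, P i y.
Proof. exact: filter_forall. Qed.

End Near.

Section Tube.
Variables (R : realType) (k n : nat).
Local Notation VV := ('rV[R]_k * 'rV[R]_n)%type.
Local Notation bb := (prod_fbasis (row_fbasis R k) (row_fbasis R n)).

Lemma tube (P : VV -> Prop) (s0 : 'rV[R]_k) (K : set 'rV[R]_n) : compact K ->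
  (forall x, K x -> \forall w \near (s0, x), P w) ->
  exists2 d : R, 0 < d & forall s x, ball s0 d s -> K x -> P (s, x).
Proof.
move=> cK HP.
have /compact_near_coveringP ncK := cK.
have : \forall s \near s0, K `<=` (fun x => P (s, x)).
  apply: (ncK _ (nbhs s0) (fun s x => P (s, x))) => x Kx.
  have [[Q1 Q2] /= [n1 n2] HQ] := HP x Kx.
  by exists (Q2, Q1); [split | move=> [y s] [/= h1 h2]; exact: HQ].
move=> /nbhs_ballP[d /= d0 Hd]; exists d => // s x sd Kx.
exact: (Hd s sd x Kx).
Qed.

Definition dbox (s0 : 'rV[R]_k) (d : R) (xc : 'rV[R]_n) (r : R) : set VV :=
  ball s0 d `*` ball xc r.

Lemma dbox_open s0 d xc r : open (dbox s0 d xc r).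
Proof. by apply: open_setX; exact: ball_open. Qed.

Lemma bfam_on_compact (Q : set VV) (s0 : 'rV[R]_k) (d : R) (xc : 'rV[R]_n) (r : R)
    (g : VV -> R) : open Q -> 0 < d -> 0 < r ->
  (cbox s0 d `*` cbox xc r `<=` Q) -> smooth_on Q g ->
  bfam bb (dbox s0 d xc r) (fun _ => g).
Proof.
move=> oQ d0 r0 KQ sg.
have DK : dbox s0 d xc r `<=` cbox s0 d `*` cbox xc r.
  by move=> w [h1 h2]; split; exact: ball_cbox.
apply: bfam_const_of_bounded.
  by apply: smooth_onS sg => w /DK; exact: KQ.
move=> vs; set h := iter_der _ g.
have sh : smooth_on Q h by exact: smooth_on_iter_der.
have cK : compact (cbox s0 d `*` cbox xc r).
  by apply: compact_setX; apply: cbox_compact; exact: ltW.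
have [||w0] := @compact_EVT_max _ R (fun w => `|h w|) (cbox s0 d `*` cbox xc r) _ cK.
- by exists (s0, xc); split; rewrite /cbox /= subrr normr0 ltW.
- apply: continuous_in_subspaceT => w /set_mem Kw.
  have ch := smooth_on_continuous sh (KQ w Kw).
  exact: (cvg_norm ch).
- move=> _ Hw; exists `|h w0| => w Dw; apply: Hw; apply: mem_set; exact: DK.
Qed.

End Tube.

Section FamilyTransport.
Variables (R : realType) (k n : nat).
Local Notation VV := ('rV[R]_k * 'rV[R]_n)%type.
Local Notation bb := (prod_fbasis (row_fbasis R k) (row_fbasis R n)).
Variables (Q : set VV) (X : VV -> 'rV[R]_n) (s0 : 'rV[R]_k) (xc : 'rV[R]_n).
Variables (d r0 r : R).
Hypotheses (oQ : open Q) (d0 : 0 < d) (r00 : 0 < r0) (r0r : r0 < r).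
Hypothesis KQ : cbox s0 d `*` cbox xc r `<=` Q.
Local Notation D := (dbox s0 d xc r).
Hypothesis sX : forall j, smooth_on Q (fun w => X w 0 j).
Hypothesis inw : forall w, D w -> `|w.2 - X w - xc| < r0.
Hypothesis HM : forall w i, D w ->
  \sum_j `|jac (fun x => X (w.1, x)) w.2 i j - (i == j)%:R| <= 1 / 4.

Let oD : open D. Proof. exact: dbox_open. Qed.
Let rp : 0 < r. Proof. exact: lt_trans r0r. Qed.

(** Parameters are variables in which the field has no component. *)
Definition vertical (w : VV) : VV := (0, X w).

Lemma vertical_bfam (i : bidx bb) : bfam bb D (fun _ w => bcoord i (vertical w)).
Proof.
case: i => [a|j] /=.
  rewrite (_ : (fun _ w => _) = fun (_ : R) (_ : VV) => 0); first exact: (bfam_cst bb oD).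
  by apply/funext => e; apply/funext => w; rewrite mxE.
by apply: (bfam_on_compact oQ d0 rp KQ); exact: sX.
Qed.

Lemma vertical_step e w : 0 < e <= 1 -> D w -> D (euler_step vertical e w).
Proof.
case: w => s x /andP[e0 e1] [/= Ds Dx].
have -> : euler_step vertical e (s, x) = (s, - e *: X (s, x) + x).
  by rewrite /euler_step /vertical; congr pair; rewrite /= scaler0 add0r.
split=> //=; rewrite -ball_normE /=.
have -> : xc - (- e *: X (s, x) + x) = (1 - e) *: (xc - x) - e *: (x - X (s, x) - xc).
  by apply/rowP => i; rewrite !mxE; ring.
apply: (le_lt_trans (ler_normB _ _)); rewrite !normrZ (gtr0_norm e0) ger0_norm ?subr_ge0 //.
have h1 : `|x - X (s, x) - xc| < r by apply: lt_trans r0r; exact: (inw (w := (s, x))).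
move: Dx; rewrite -ball_normE /= => h2.
have -> : r = (1 - e) * r + e * r by ring.
apply: ler_ltD; last by rewrite ltr_pM2l.
by apply: ler_wpM2l; [rewrite subr_ge0 | exact: ltW].
Qed.

Lemma vertical_jac (a : 'I_n) (j : 'I_n) w :
  'D_(0, basisv R a) (fun y => X y 0 j) w = jac (fun x => X (w.1, x)) w.2 a j.
Proof.
case: w => s x /=; rewrite mxE /pder.
by rewrite (derive_slice (fun y => X y 0 j)).
Qed.

(** Derivatives in the parameters are not damped, but a small weight [sg] makes
    their coupling to the derivatives in space as weak as desired; the latter are
    contracted. *)
Lemma vertical_weights (mu : R) : 0 < mu ->
  exists2 w : bidx bb -> R, (forall i, 0 < w i) &
    forall e y i, 0 < e <= 1 / 2 -> D y ->
      \sum_(l : bidx bb) `|(i == l)%:R -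
         e * 'D_(bvec i) (fun z => bcoord l (vertical z)) y| * (w i / w l)
      <= 1 + mu * e.
Proof.
move=> mu0.
have bX (j : 'I_n) : bfam bb D (fun _ w => X w 0 j).
  by apply: (bfam_on_compact oQ d0 rp KQ); exact: sX.
have [M M0 HMM] := bfam_finite_bound
  (G := fun p : 'I_k * 'I_n => fun (_ : R) => 'D_(@bvec _ _ bb (inl p.1)) (fun w => X w 0 p.2))
  (fun p => bfam_derive (inl p.1 : bidx bb) (bX p.2)).
have Z0 : 0 < n%:R * M + 1 by rewrite ltr_wpDl // mulr_ge0.
have [sg sgE sg0] : exists2 sg, sg = mu / (n%:R * M + 1) & 0 < sg.
  by exists (mu / (n%:R * M + 1)); rewrite // divr_gt0.
exists (fun i => match i with inl _ => sg | inr _ => 1 end).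
  by case=> i //; exact: ltr01.
move=> e y i /andP[e0 e12] Dy.
have e01 : 0 < e <= 1.
  by rewrite e0 /=; apply: (le_trans e12); rewrite ler_pdivrMr // mul1r ler1n.
have z0 (a : 'I_k) v : 'D_v (fun _ : VV => (0 : 'rV[R]_k) 0 a) y = 0.
  exact: (derive_cst ((0 : 'rV[R]_k) 0 a : R)).
rewrite big_sumType /=.
case: i => [a|a].
  rewrite (eq_bigr (fun c => (a == c)%:R)) => [|c _]; last first.
    rewrite z0 mulr0 subr0 (divff (lt0r_neq0 sg0)) mulr1 ger0_norm //.
  rewrite (bigD1 a) //= eqxx big1 => [|c ca]; last by rewrite eq_sym (negbTE ca).
  rewrite addr0 lerD2l.
  apply: (@le_trans _ _ (\sum_(j < n) e * M * sg)).
    apply: ler_sum => j _; rewrite sub0r normrN normrM (gtr0_norm e0) divr1.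
    apply: ler_wpM2r; first exact: ltW.
    apply: ler_wpM2l; first exact: ltW.
    exact: (HMM (a, j) e y e01 Dy).
  rewrite sumr_const card_ord -[_ *+ _]mulr_natl.
  have -> : n%:R * (e * M * sg) = (n%:R * M) * sg * e by ring.
  rewrite ler_pM2r // sgE mulrCA ler_piMr ?ltW // ltr_pdivrMr //.
  by rewrite mul1r ltrDl.
rewrite big1 ?add0r => [|c _]; last by rewrite z0 mulr0 subr0 normr0 mul0r.
apply: (@le_trans _ _ (\sum_(j < n) `|(a == j)%:R - e * jac (fun x => X (y.1, x)) y.2 a j|)).
  by apply: ler_sum => j _; rewrite divr1 mulr1 -vertical_jac.
have e01' : 0 <= e <= 1 by case/andP: e01 => /ltW -> ->.
apply: (le_trans (covec_weight (fun i => HM i Dy) a e01')).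
apply: (@le_trans _ _ 1); first by rewrite gerBl mulr_ge0 // ltW.
by rewrite lerDl mulr_ge0 // ltW.
Qed.

Lemma family_transport (J : finType) (A : J -> J -> VV -> R) (F : J -> VV -> R) :
  (forall j l, smooth_on Q (A j l)) -> (forall j, smooth_on Q (F j)) ->
  (forall e w j, 0 < e <= 1 / 2 -> D w ->
    \sum_l `|(j == l)%:R - e * A j l w| <= 1 - 1 / 2 * e) ->
  exists u : J -> VV -> R, (forall j, smooth_on D (u j)) /\
    forall j w, D w -> 'D_(0, X w) (u j) w + \sum_l A j l w * u l w = F j w.
Proof.
move=> sA sF HA.
apply: (transport_solution oD vertical_bfam vertical_step vertical_weights
  (A := A) (f := F) (c := 1 / 2) (e0 := 1 / 2)).
- by move=> j l; apply: (bfam_on_compact oQ d0 rp KQ); exact: sA.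
- by move=> j; apply: (bfam_on_compact oQ d0 rp KQ); exact: sF.
- split; [by rewrite divr_gt0 | | by move=> e x j he Dx; exact: HA].
  by rewrite divr_gt0 //= ler_pdivrMr // mul1r ler1n.
Qed.

End FamilyTransport.

Section LocalFamily.
Variables (R : realType) (k n : nat).
Local Notation V := 'rV[R]_n.
Local Notation VV := ('rV[R]_k * 'rV[R]_n)%type.
Local Notation bb := (prod_fbasis (row_fbasis R k) (row_fbasis R n)).
Local Notation chris := ('I_n -> 'I_n -> 'I_n -> V -> R).
Variables (S : set 'rV[R]_k) (G : 'rV[R]_k -> chris) (f : 'rV[R]_k -> V -> R).
Variables (xc : V) (r0 rho : R) (s0 : 'rV[R]_k).

Lemma pder_slice (F : VV -> R) i s x :
  pder i (fun z => F (s, z)) x = 'D_(0, basisv R i) F (s, x).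
Proof. exact: derive_slice. Qed.

Lemma smooth_pder_slice (P : set VV) (F : 'rV[R]_k -> V -> R) i :
  smooth_on P (fun w => F w.1 w.2) -> smooth_on P (fun w => pder i (F w.1) w.2).
Proof.
move=> sF; have := smooth_on_derive (0, basisv R i) sF.
suff -> : 'D_(0, basisv R i) (fun w : VV => F w.1 w.2) = fun w => pder i (F w.1) w.2 by [].
by apply/funext => -[s x]; rewrite /= -(pder_slice (fun w => F w.1 w.2)).
Qed.

Section JointSmoothness.
Variables (P : set VV).
Hypothesis oP : open P.
Hypothesis sG : forall i j l, smooth_on P (fun w => G w.1 i j l w.2).
Hypothesis sf : smooth_on P (fun w => f w.1 w.2).

Lemma joint_hessm i j : smooth_on P (fun w => hessm (G w.1) (f w.1) w.2 i j).
Proof.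
have H : smooth_on P (fun w => pder i (pder j (f w.1)) w.2 -
    \sum_l G w.1 i j l w.2 * pder l (f w.1) w.2).
  apply: (smooth_onB bb oP).
    exact: (smooth_pder_slice (F := fun s x => pder j (f s) x) i (smooth_pder_slice (F := f) j sf)).
  apply: (smooth_on_sum bb oP) => l.
  exact: (smooth_onM bb oP (sG i j l) (smooth_pder_slice (F := f) l sf)).
by apply: (smooth_on_eq oP _ H) => w _; rewrite mxE.
Qed.

Hypothesis hf : forall w, P w -> \det (hessm (G w.1) (f w.1) w.2) != 0.

Lemma joint_invhess i j : smooth_on P (fun w => invmx (hessm (G w.1) (f w.1) w.2) i j).
Proof. by apply: (smooth_on_invmx bb oP hf); exact: joint_hessm. Qed.

Lemma joint_gradr i j : smooth_on P (fun w => gradr (f w.1) w.2 i j).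
Proof. by apply: (smooth_on_eq oP _ (smooth_pder_slice (F := f) j sf)) => w _; rewrite mxE. Qed.

Lemma joint_field j : smooth_on P (fun w => grad_field (G w.1) (f w.1) w.2 0 j).
Proof.
exact: (smooth_on_mulmx bb oP joint_gradr joint_invhess).
Qed.

Lemma joint_jac i j : smooth_on P (fun w => jac (grad_field (G w.1) (f w.1)) w.2 i j).
Proof.
have := smooth_pder_slice (F := fun s x => grad_field (G s) (f s) x 0 j) i (joint_field j).
by apply: (smooth_on_eq oP) => w _; rewrite mxE.
Qed.

Lemma joint_symbol (C : VV -> 'M[R]_n) :
  (forall i j, smooth_on P (fun w => C w i j)) -> forall i j,
  smooth_on P (fun w => symbol (G w.1) (f w.1) (fun x => C (w.1, x)) w.2 i j).
Proof.
move=> sC i j.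
have sIT k1 k2 : smooth_on P (fun w => (invmx (hessm (G w.1) (f w.1) w.2))^T k1 k2).
  by apply: (smooth_on_eq oP _ (joint_invhess k2 k1)) => w _; rewrite [RHS]mxE.
have H := smooth_onM bb oP (smooth_on_cst bb oP 2%:R)
  (smooth_on_mulmx bb oP (smooth_on_mulmx bb oP joint_invhess sC) sIT i j).
by apply: (smooth_on_eq oP _ H) => -[s x] _; rewrite [RHS]mxE.
Qed.

Lemma joint_defect (C : VV -> 'M[R]_n) :
  (forall i j, smooth_on P (fun w => C w i j)) ->
  smooth_on P (fun w => defect (G w.1) (f w.1) (fun x => C (w.1, x)) w.2).
Proof.
move=> sC.
have sHT k1 k2 : smooth_on P (fun w => (hessm (G w.1) (f w.1) w.2)^T k1 k2).
  by apply: (smooth_on_eq oP _ (joint_hessm k2 k1)) => w _; rewrite [RHS]mxE.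
apply: (smooth_onB bb oP (smooth_on_cst bb oP n%:R)).
apply: (smooth_on_sum bb oP) => i.
exact: (smooth_on_mulmx bb oP (joint_symbol sC) sHT).
Qed.

End JointSmoothness.

Hypotheses (oS : open S) (Ss0 : S s0).
Hypothesis sG : forall i j l, smooth_on (S `*` ball xc rho) (fun w => G w.1 i j l w.2).
Hypothesis sf : smooth_on (S `*` ball xc rho) (fun w => f w.1 w.2).
Hypothesis hs0 : forall x, ball xc rho x -> \det (hessm (G s0) (f s0) x) != 0.
Hypothesis inw : inward_field (grad_field (G s0) (f s0)) xc r0 rho.

Let P := S `*` ball xc rho.
Let oP : open P. Proof. by apply: open_setX => //; exact: ball_open. Qed.

Lemma cbox_dbox d d' (r r' : R) : d < d' -> r < r' ->
  cbox s0 d `*` cbox xc r `<=` dbox s0 d' xc r'.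
Proof. by move=> dd rr w [h1 h2]; split; [exact: cbox_ball_lt h1 | exact: cbox_ball_lt h2]. Qed.

Lemma dbox_sub d d' (r r' : R) : d <= d' -> r <= r' ->
  dbox s0 d xc r `<=` dbox s0 d' xc r'.
Proof. by move=> dd rr w [h1 h2]; split; [exact: le_ball h1 | exact: le_ball h2]. Qed.

Lemma family_hess r : r0 < r -> r < rho -> exists2 d, 0 < d &
  forall w, dbox s0 d xc r w -> P w /\ \det (hessm (G w.1) (f w.1) w.2) != 0.
Proof.
move=> r0r rrho; have [r00 _ _ _] := inw.
have rp : 0 <= r by rewrite ltW // (lt_trans r00).
have [|d d0 Hd] := @tube R k n
  (fun w => P w /\ \det (hessm (G w.1) (f w.1) w.2) != 0) s0 (cbox xc r) (@cbox_compact R n xc r rp).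
  move=> x Kx; have Bx : ball xc rho x by exact: cbox_ball_lt Kx.
  have Px : P (s0, x) by [].
  have sd : smooth_on P (fun w => \det (hessm (G w.1) (f w.1) w.2)).
    by apply: (smooth_on_det bb oP); exact: joint_hessm.
  have cd := smooth_on_continuous sd Px.
  apply: filterI; first exact: (near_open oP Px).
  exact: (near_neq0 cd (hs0 Bx)).
exists d => // -[s x] [/= h1 h2].
by apply: (Hd s x h1); exact: ball_cbox.
Qed.

Lemma family_inward r : r0 < r -> r < rho -> exists2 d, 0 < d &
  forall s, ball s0 d s -> inward_field (grad_field (G s) (f s)) xc r0 r.
Proof.
move=> r0r rrho; have [r00 _ i1 i2] := inw.
pose r1 := (r + rho) / 2.
have rr1 : r < r1 by rewrite /r1; lra.
have r1rho : r1 < rho by rewrite /r1; lra.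
have [d1 d10 Hd1] := family_hess (lt_trans r0r rr1) r1rho.
have rp : 0 <= r by rewrite ltW // (lt_trans r00).
have oQ : open (dbox s0 d1 xc r1) by exact: dbox_open.
have sG1 i j l : smooth_on (dbox s0 d1 xc r1) (fun w => G w.1 i j l w.2).
  by apply: smooth_onS (sG i j l) => w /Hd1[].
have sf1 : smooth_on (dbox s0 d1 xc r1) (fun w => f w.1 w.2).
  by apply: smooth_onS sf => w /Hd1[].
have hf1 w : dbox s0 d1 xc r1 w -> \det (hessm (G w.1) (f w.1) w.2) != 0.
  by move=> /Hd1[].
have [|d d0 Hd] := @tube R k n
  (fun w => `|w.2 - grad_field (G w.1) (f w.1) w.2 - xc| < r0 /\
    forall i, \sum_j `|jac (grad_field (G w.1) (f w.1)) w.2 i j - (i == j)%:R| < 1 / 4)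
  s0 (cbox xc r) (@cbox_compact R n xc r rp).
  move=> x Kx.
  have Qx : dbox s0 d1 xc r1 (s0, x) by split; [exact: ballxx | exact: cbox_ball_lt Kx].
  have Bx : ball xc rho x by apply: cbox_ball_lt Kx; exact: (lt_trans rr1).
  apply: filterI; last first.
    apply: (@near_forall VV) => i.
    have cs : {for (s0, x), continuous (fun w : VV =>
       \sum_j `|jac (grad_field (G w.1) (f w.1)) w.2 i j - (i == j)%:R|)}.
      apply: cvg_big => [|j _]; first exact: add_continuous.
      apply: cvg_norm; apply: cvgB; last exact: cvg_cst.
      exact: (smooth_on_continuous (joint_jac oQ sG1 sf1 hf1 i j) Qx).
    exact: (near_lt cs (i2 x i Bx)).
  have e0 : 0 < r0 - `|x - grad_field (G s0) (f s0) x - xc| by rewrite subr_gt0 i1.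
  set e := r0 - _ in e0.
  have nj : \forall w \near (s0, x), forall j,
     `|(x - grad_field (G s0) (f s0) x) 0 j -
       (w.2 - grad_field (G w.1) (f w.1) w.2) 0 j| < e.
    apply: (@near_forall VV) => j.
    have sj : smooth_on (dbox s0 d1 xc r1) (fun w => (w.2 - grad_field (G w.1) (f w.1) w.2) 0 j).
      have := smooth_onB bb oQ (smooth_on_bcoord oQ (inr j : bidx bb)) (joint_field oQ sG1 sf1 hf1 j).
      by apply: (smooth_on_eq oQ) => w _; rewrite [RHS]mxE [X in _ = _ + X]mxE.
    have cj := smooth_on_continuous sj Qx.
    exact: (near_dist cj e0).
  apply: filterS nj => w Hw.
  have -> : r0 = e + `|x - grad_field (G s0) (f s0) x - xc| by rewrite /e subrK.
  apply: (le_lt_trans (ler_distD (x - grad_field (G s0) (f s0) x) _ _)).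
  rewrite ltrD2r.
  apply: row_norm_lt => // j; have := Hw j; rewrite distrC.
  by rewrite [X in _ -> `|X| < _]mxE [X in _ -> `|_ + X| < _]mxE.
exists d => // s sd; split=> // [x Bx|x i Bx].
  by have [] := Hd s x sd (ball_cbox Bx).
by have [_] := Hd s x sd (ball_cbox Bx); apply.
Qed.

(** The form is solved for on a larger box than the covector, because the
    right-hand side of the second equation involves derivatives of the form, which
    must be bounded. The radii satisfy [r < r2 < r1 < rho]. *)
Theorem local_family r : r0 < r -> r < rho ->
  exists (d : R) (C : VV -> 'M[R]_n) (B : VV -> 'cV[R]_n), [/\ 0 < d,
    forall i j, smooth_on (dbox s0 d xc r) (fun w => C w i j),
    forall i j, smooth_on (dbox s0 d xc r) (fun w => B w i j) &
    forall s, ball s0 d s -> [/\ S s, inward_field (grad_field (G s) (f s)) xc r0 r &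
      transport_sol (G s) (f s) (ball xc r) (fun x => C (s, x)) (fun x => B (s, x))]].
Proof.
move=> r0r rrho; have [r00 _ _ _] := inw.
have [r2 [r1 [rr2 r21 r1rho]]] : exists r2 r1, [/\ r < r2, r2 < r1 & r1 < rho].
  exists ((r + rho) / 2), (((r + rho) / 2 + rho) / 2); split; lra.
have rp : 0 < r by exact: (lt_trans r00).
have r0r2 : r0 < r2 by exact: (lt_trans r0r).
have [d1 d10 Hd1] := family_hess (lt_trans r0r2 r21) r1rho.
have [d2 d20 Hd2] := family_inward r0r2 (lt_trans r21 r1rho).
have [d3 d30 Hd3] := family_inward r0r rrho.
(* The form is constructed on parameters at distance less than [dC], the
   covector on a smaller ball of radius [d]. *)
have [dC [dC0 dC1 dC2 dC3]] : exists dC, [/\ 0 < dC, dC < d1, dC < d2 & dC < d3].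
  have m0 : 0 < Num.min d1 (Num.min d2 d3) by rewrite !lt_min d10 d20.
  have m2 : Num.min d1 (Num.min d2 d3) / 2 < Num.min d1 (Num.min d2 d3).
    by rewrite ltr_pdivrMr // ltr_pMr // ltr1n.
  move: (m2); rewrite !lt_min => /and3P[h1 h2 h3].
  by exists (Num.min d1 (Num.min d2 d3) / 2); split=> //; rewrite divr_gt0.
have [d d0 ddC] : exists2 d, 0 < d & d < dC.
  by exists (dC / 2); [rewrite divr_gt0 | lra].
pose Q1 := dbox s0 d1 xc r1; pose Q2 := dbox s0 dC xc r2.
have oQ1 : open Q1 by exact: dbox_open.
have oQ2 : open Q2 by exact: dbox_open.
have Q21 : Q2 `<=` Q1 by apply: dbox_sub; exact: ltW.
have oD : open (dbox s0 d xc r) by exact: dbox_open.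
have sG1 i j l : smooth_on Q1 (fun w => G w.1 i j l w.2).
  by apply: smooth_onS (sG i j l) => w /Hd1[].
have sf1 : smooth_on Q1 (fun w => f w.1 w.2).
  by apply: smooth_onS sf => w /Hd1[].
have hf1 w : Q1 w -> \det (hessm (G w.1) (f w.1) w.2) != 0 by move=> /Hd1[].
have sX j := joint_field oQ1 sG1 sf1 hf1 j.
have sM i j := joint_jac oQ1 sG1 sf1 hf1 i j.
have sH i j := joint_hessm oQ1 sG1 sf1 i j.
have ball_lt a c : a <= c -> ball s0 a `<=` ball s0 c by move=> ac; exact: le_ball.
have inwC w : Q2 w -> `|w.2 - grad_field (G w.1) (f w.1) w.2 - xc| < r0.
  case: w => s x [/= h1 h2].
  have [_ _ + _] := Hd2 s (ball_lt _ _ (ltW dC2) _ h1); exact.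
have rowC w : Q2 w -> forall i,
    \sum_j `|jac (grad_field (G w.1) (f w.1)) w.2 i j - (i == j)%:R| <= 1 / 4.
  case: w => s x [/= h1 h2] i; apply: ltW.
  have [_ _ _] := Hd2 s (ball_lt _ _ (ltW dC2) _ h1); exact.
have sA p q : smooth_on Q1 (fun w => form_coef (jac (grad_field (G w.1) (f w.1)) w.2) p q).
  apply: (smooth_onD bb oQ1).
    exact: (smooth_onM bb oQ1 (sM p.1 q.1) (smooth_on_cst bb oQ1 _)).
  exact: (smooth_onM bb oQ1 (sM p.2 q.2) (smooth_on_cst bb oQ1 _)).
have wA e w p : 0 < e <= 1 / 2 -> Q2 w ->
    \sum_q `|(p == q)%:R - e * form_coef (jac (grad_field (G w.1) (f w.1)) w.2) p q|
      <= 1 - 1 / 2 * e.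
  move=> /andP[e0 e1] Dw; apply: form_weight; first exact: (rowC w Dw).
  by rewrite (ltW e0).
have [u [su eu]] := @family_transport R k n Q1
  (fun w => grad_field (G w.1) (f w.1) w.2) s0 xc dC r0 r2 oQ1 dC0 r00 r0r2
  (cbox_dbox dC1 r21) sX inwC (fun w i Dw => rowC w Dw i) _ _
  (fun p w => hessm (G w.1) (f w.1) w.2 p.1 p.2) sA (fun p => sH p.1 p.2) wA.
pose C w : 'M[R]_n := \matrix_(i, j) u (i, j) w.
have sC i j : smooth_on Q2 (fun w => C w i j).
  by apply: (smooth_on_eq oQ2 _ (su (i, j))) => w _; rewrite mxE.
have sG2 i j l := smooth_onS Q21 (sG1 i j l).
have sf2 := smooth_onS Q21 sf1.
have hf2 w : Q2 w -> \det (hessm (G w.1) (f w.1) w.2) != 0 by move=> /Q21; exact: hf1.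
have sdef := joint_defect oQ2 sG2 sf2 hf2 sC.
have DQ2 : dbox s0 d xc r `<=` Q2 by apply: dbox_sub; exact: ltW.
have wB e w i : 0 < e <= 1 / 2 -> dbox s0 d xc r w ->
    \sum_j `|(i == j)%:R - e * jac (grad_field (G w.1) (f w.1)) w.2 i j|
      <= 1 - 1 / 2 * e.
  move=> /andP[e0 e1] Dw; apply: covec_weight; first exact: (rowC w (DQ2 w Dw)).
  by rewrite (ltW e0) /= (le_trans e1) // ler_pdivrMr // mul1r ler1n.
have [v [sv ev]] := @family_transport R k n Q2
  (fun w => grad_field (G w.1) (f w.1) w.2) s0 xc d r0 r oQ2 d0 r00 r0r
  (cbox_dbox ddC rr2) (fun j => smooth_onS Q21 (sX j)) (fun w Dw => inwC w (DQ2 w Dw))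
  (fun w i Dw => rowC w (DQ2 w Dw) i) _
  (fun i j w => jac (grad_field (G w.1) (f w.1)) w.2 i j)
  (fun i w => pder i (defect (G w.1) (f w.1) (fun x => C (w.1, x))) w.2)
  (fun i j => smooth_onS Q21 (sM i j))
  (fun i => smooth_pder_slice (F := fun s => defect (G s) (f s) (fun x => C (s, x))) i sdef) wB.
pose B w : 'cV[R]_n := \col_i v i w.
have sB i j : smooth_on (dbox s0 d xc r) (fun w => B w i j).
  by apply: (smooth_on_eq oD _ (sv i)) => w _; rewrite mxE.
exists d, C, B; split; [exact: d0 | | exact: sB |].
  by move=> i j; exact: (smooth_onS DQ2 (sC i j)).
move=> s sd.
have sec x : ball xc r x -> dbox s0 d xc r (s, x) by move=> xr; split.
have slice (F : VV -> R) : smooth_on (dbox s0 d xc r) F -> smooth_on (ball xc r) (fun x => F (s, x)).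
  move=> sF; apply: (smooth_on_slice (row_fbasis R k) (row_fbasis R n) _ _ sF sd);
    exact: ball_open.
have sd' : ball s0 d3 s by apply: ball_lt sd; rewrite ltW // (lt_trans ddC).
have [Ss _] : P (s, xc) /\ \det (hessm (G s) (f s) xc) != 0.
  by apply: (Hd1 (s, xc)); apply: Q21; apply: DQ2; apply: sec; exact: ballxx.
split; [by case: Ss | exact: Hd3 |].
apply: TransportSol.
- exact: (slice _ (smooth_onS DQ2 sf2)).
- by move=> i j l; exact: (slice _ (smooth_onS DQ2 (sG2 i j l))).
- by move=> x xr; exact: (hf2 (s, x) (DQ2 _ (sec x xr))).
- by move=> i j; exact: (slice _ (smooth_onS DQ2 (sC i j))).
- by move=> i j; exact: (slice _ (sB i j)).
- move=> x xr; apply/matrixP => i j.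
  have E := eu (i, j) (s, x) (DQ2 _ (sec x xr)); move: E => /= <-.
  rewrite -addrA 2!mxE -derive_slice; congr (_ + _).
    by congr ('D_ _ _ _); apply/funext => z; rewrite mxE.
  rewrite -(form_coef_sum _ (C (s, x)) (i, j)); apply: eq_bigr => -[a c] _.
  by rewrite mxE.
- move=> x xr; apply/matrixP => i j; rewrite (ord1 j).
  have E := ev i (s, x) (sec x xr); move: E => /= E.
  rewrite [RHS]mxE [RHS]mxE -[RHS]E 2!mxE -derive_slice; congr (_ + _).
    by congr ('D_ _ _ _); apply/funext => z; rewrite mxE.
  rewrite [LHS]mxE; apply: eq_bigr => a _; congr (_ * _); exact: mxE.
Qed.

End LocalFamily.

(** * Action on functions of the phase *)

Section LocalOperatorFacts.
Variables (R : realType) (n : nat).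
Local Notation V := 'rV[R]_n.
Local Notation b := (row_fbasis R n).
Local Notation chris := ('I_n -> 'I_n -> 'I_n -> V -> R).
Implicit Types (G : chris) (f h : V -> R) (W : set V) (x v : V).

(** The first-order coefficients once the Christoffel terms of the covariant
    Hessian are moved into them. *)
Definition box_coef1 G f (C : V -> 'M[R]_n) (B : V -> 'cV[R]_n) k x : R :=
  (invmx (hessm G f x) *m B x) k 0 - \sum_i \sum_j symbol G f C x i j * G i j k x.

Lemma box_realE G f C B h x : box_real G f C B h x =
  \sum_i \sum_j symbol G f C x i j * pder i (pder j h) x +
  \sum_k box_coef1 G f C B k x * pder k h x.
Proof.
rewrite /box_real /box_coef1 -mulmxA mxE.
move: (invmx (hessm G f x) *m B x) (symbol G f C x) => v a.
rewrite /mxtrace.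
under eq_bigr => i _ do rewrite mxE.
under [X in _ = _ + X]eq_bigr => k _ do rewrite mulrBl.
rewrite sumrB /=.
have -> : \sum_i \sum_j a i j * (hessm G h x)^T j i =
  \sum_i \sum_j a i j * pder i (pder j h) x -
  \sum_k (\sum_i \sum_j a i j * G i j k x) * pder k h x.
  have -> : \sum_k (\sum_i \sum_j a i j * G i j k x) * pder k h x =
    \sum_i \sum_j a i j * \sum_k G i j k x * pder k h x.
    under eq_bigr => k _ do rewrite mulr_suml.
    rewrite exchange_big; apply: eq_bigr => i _ /=.
    under eq_bigr => k _ do rewrite mulr_suml.
    rewrite exchange_big; apply: eq_bigr => j _ /=.
    by rewrite mulr_sumr; apply: eq_bigr => k _; rewrite mulrA.
  rewrite -sumrB; apply: eq_bigr => i _; rewrite -sumrB; apply: eq_bigr => j _.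
  by rewrite !mxE mulrBr.
have -> : \sum_j gradr h x 0 j * v j 0 = \sum_k v k 0 * pder k h x.
  by apply: eq_bigr => k _; rewrite mxE mulrC.
by rewrite -addrA [- _ + _]addrC.
Qed.

Lemma box_real_eq_on W G f C B h1 h2 x : open W -> (forall y, W y -> h1 y = h2 y) ->
  W x -> box_real G f C B h1 x = box_real G f C B h2 x.
Proof.
by move=> oW E Wx; rewrite /box_real (hessm_eq_on G oW E Wx) (gradr_eq_on oW E Wx).
Qed.

Lemma smooth_box_coef1 W G f C B k : open W ->
  transport_sol G f W C B -> smooth_on W (box_coef1 G f C B k).
Proof.
move=> oW sol; have sG := ts_chris sol; have sf := ts_fun sol; have hf := ts_hess sol.
apply: (smooth_onB b oW).
  exact: (msmooth_mul oW (msmooth_invhess oW sG sf hf) (ts_covec sol) k 0).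
apply: (smooth_on_sum b oW) => i; apply: (smooth_on_sum b oW) => j.
exact: (smooth_onM b oW (msmooth_symbol oW sG sf hf (ts_form sol) i j) (sG i j k)).
Qed.

Lemma is_derive_comp_real (F : R -> R) (dF : R) h x v d :
  is_derive (h x) 1 F dF -> is_derive x v h d -> is_derive x v (fun y => F (h y)) (dF * d).
Proof.
move=> HF Hh.
have [dh hE] := Hh.
have H0 : is_derive (0 : R) 1 (fun s : R => h (s *: v + x)) d.
  rewrite -hE; have := @is_derive_along _ _ h x v 0; rewrite scale0r add0r; exact.
have HF' : is_derive (h ((0 : R) *: v + x)) 1 F dF by rewrite scale0r add0r.
have := @is_derive1_comp _ F (fun s : R => h (s *: v + x)) 0 dF d HF' H0.
move=> /is_derive_cvg H; apply/is_derive_cvg; move: H.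
by under eq_fun => s do rewrite /= scale0r add0r addr0 [s *: 1]mulr1.
Qed.

Lemma box_real_chain W G f C B (F F1 F2 : R -> R) h x : open W -> smooth_on W h -> W x ->
  (forall s : R, is_derive s (1 : R) F (F1 s)) -> (forall s : R, is_derive s (1 : R) F1 (F2 s)) ->
  box_real G f C B (fun y => F (h y)) x =
  F1 (h x) * box_real G f C B h x +
  F2 (h x) * (gradr h x *m symbol G f C x *m (gradr h x)^T) 0 0.
Proof.
move=> oW sh Wx HF1 HF2.
have p1 k y : W y -> pder k (fun z => F (h z)) y = F1 (h y) * pder k h y.
  move=> Wy; have dh := smooth_on_is_derive (basisv R k) sh Wy.
  by have [_] := is_derive_comp_real (HF1 (h y)) dh.
have p2 i j : pder i (pder j (fun z => F (h z))) x =
    F1 (h x) * pder i (pder j h) x + F2 (h x) * (pder i h x * pder j h x).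
  have -> : pder i (pder j (fun z => F (h z))) x = pder i (fun y => F1 (h y) * pder j h y) x.
    exact: (eq_on_derive oW (p1 j) (basisv R i) Wx).
  have d1 := is_derive_comp_real (HF2 (h x)) (smooth_on_is_derive (basisv R i) sh Wx).
  have d2 := smooth_on_is_derive (basisv R i) (smooth_on_derive (basisv R j) sh) Wx.
  have [_ E] := is_deriveM d1 d2.
  apply: (etrans E); rewrite /GRing.scale /= /pder.
  by move: ('D_(basisv R i) h x) ('D_(basisv R j) h x) ('D_(basisv R i) _ x) => u1 u2 u3; ring.
have E1 : \sum_i \sum_j symbol G f C x i j * pder i (pder j (fun z => F (h z))) x =
    F1 (h x) * (\sum_i \sum_j symbol G f C x i j * pder i (pder j h) x) +
    F2 (h x) * (\sum_i \sum_j symbol G f C x i j * (pder i h x * pder j h x)).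
  rewrite !mulr_sumr -big_split; apply: eq_bigr => i _.
  rewrite !mulr_sumr -big_split; apply: eq_bigr => j _ /=.
  apply: (etrans (congr1 (fun z => symbol G f C x i j * z) (p2 i j))).
  by rewrite mulrDr !(mulrCA (symbol G f C x i j)).
have E2 : \sum_k box_coef1 G f C B k x * pder k (fun z => F (h z)) x =
    F1 (h x) * (\sum_k box_coef1 G f C B k x * pder k h x).
  rewrite mulr_sumr; apply: eq_bigr => k _.
  apply: (etrans (congr1 (fun z => box_coef1 G f C B k x * z) (p1 k x Wx))).
  by rewrite mulrCA.
have E3 : (gradr h x *m symbol G f C x *m (gradr h x)^T) 0 0 =
    \sum_i \sum_j symbol G f C x i j * (pder i h x * pder j h x).
  rewrite mxE; under eq_bigr => j _ do rewrite !mxE mulr_suml.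
  rewrite exchange_big; apply: eq_bigr => i _; apply: eq_bigr => j _ /=.
  by rewrite !mxE mulrAC mulrC.
apply: (etrans (box_realE _ _ _ _ _ _)); apply: (etrans (congr2 +%R E1 E2)).
by rewrite E3 (box_realE G f C B h x) mulrDr addrAC.
Qed.

(** A single equation is a family over parameters of dimension 0. *)
Lemma local_existence G f (xc : V) (r0 rho r : R) :
  (forall i j k, smooth_on (ball xc rho) (G i j k)) -> smooth_on (ball xc rho) f ->
  (forall x, ball xc rho x -> \det (hessm G f x) != 0) ->
  inward_field (grad_field G f) xc r0 rho -> r0 < r -> r < rho ->
  exists C B, transport_sol G f (ball xc r) C B.
Proof.
move=> sG sf hf inw r0r rrho.
have oB : open (ball xc rho) by exact: ball_open.
have [|||d [C [B [d0 sC sB H]]]] := @local_family R 0 n setT (fun _ => G) (fun _ => f) xc r0 rho 0 openT _ _ _ hf inw r r0r rrho.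
- by [].
- move=> i j l; exact: (smooth_on_snd (row_fbasis R 0) b openT oB (sG i j l)).
- exact: (smooth_on_snd (row_fbasis R 0) b openT oB sf).
have [_ _ sol] := H 0 (ballxx _ d0).
by exists (fun x => C (0, x)), (fun x => B (0, x)).
Qed.

Lemma transport_solS W W' G f C B : W' `<=` W -> transport_sol G f W C B ->
  transport_sol G f W' C B.
Proof.
move=> WW sol; apply: TransportSol.
- exact: smooth_onS (ts_fun sol).
- by move=> i j k; exact: smooth_onS (ts_chris sol i j k).
- by move=> x /WW Wx; exact: (ts_hess sol Wx).
- by move=> i j; exact: smooth_onS (ts_form sol i j).
- by move=> i j; exact: smooth_onS (ts_covec sol i j).
- by move=> x /WW; move=> Wx; exact: (ts_form_eq sol Wx).
- by move=> x /WW; move=> Wx; exact: (ts_covec_eq sol Wx).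
Qed.

Lemma box_real_pointwise G f C1 B1 C2 B2 h x : C1 x = C2 x -> B1 x = B2 x ->
  box_real G f C1 B1 h x = box_real G f C2 B2 h x.
Proof. by move=> EC EB; rewrite /box_real /symbol EC EB. Qed.

End LocalOperatorFacts.

(** * Charts and the evolution equation *)

Section Charts.
Variables (R : realType) (n : nat).
Local Notation V := 'rV[R]_n.
Local Notation b := (row_fbasis R n).

Lemma open_preimage_in (T U : topologicalType) (A : set T) (B : set U) (g : T -> U) :
  open A -> (forall q, A q -> {for q, continuous g}) -> open B -> open (A `&` g @^-1` B).
Proof.
move=> oA cg oB; rewrite openE => q [Aq Bq].
have n1 : nbhs q A by exact: open_nbhs_nbhs.
have n2 : nbhs q (g @^-1` B) by apply: (cg q Aq); exact: open_nbhs_nbhs.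
exact: filterI.
Qed.

Section OneChart.
Variables (M : topologicalType) (c : chart R n M).
Implicit Types (A : set M) (x : V) (q : M).

Lemma coords_mem A q : cdom c q -> A q -> coords c A (cmap c q).
Proof. by move=> cq Aq; exists q. Qed.

Lemma coords_inv A x : coords c A x ->
  [/\ cdom c (cinv c x), A (cinv c x) & cmap c (cinv c x) = x].
Proof. by move=> [q [cq Aq] <-]; rewrite (cmapK cq). Qed.

Lemma coordsS A A' : A `<=` A' -> coords c A `<=` coords c A'.
Proof. by move=> AA x [q [cq /AA Aq] <-]; exact: coords_mem. Qed.

Lemma coords_open A : open A -> open (coords c A).
Proof.
move=> oA; have <- : (cmap c @` cdom c) `&` cinv c @^-1` A = coords c A.
  apply/seteqP; split=> [x [[q cq <-]] /=|x [q [cq Aq] <-]].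
    by rewrite (cmapK cq) => Aq; exact: coords_mem.
  by split; [exists q | rewrite /= (cmapK cq)].
by apply: open_preimage_in => //; [exact: cimg_open | exact: cinv_continuous].
Qed.

Lemma preim_coords_open (W : set V) : open W -> open (cdom c `&` cmap c @^-1` W).
Proof.
by move=> oW; apply: open_preimage_in => //; [exact: cdom_open | exact: cmap_continuous].
Qed.

Lemma coords_preim (W : set V) : W `<=` coords c setT ->
  coords c (cdom c `&` cmap c @^-1` W) = W.
Proof.
move=> WT; apply/seteqP; split=> [x /coords_inv[_ [_ /= H] <-] //|x Wx].
have [cx _ xE] := coords_inv (WT x Wx).
by rewrite -xE; apply: coords_mem => //; split=> //=; rewrite xE.
Qed.

End OneChart.

Lemma jac_id (x : V) : jac (fun y : V => y) x = 1%:M.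
Proof.
apply/matrixP => i j; rewrite !mxE /pder.
have [_ ->] := is_derive_bcoord (b := b) j x (basisv R i).
by rewrite /= mxE eqxx eq_sym.
Qed.

Lemma jac_comp (W1 W2 : set V) (tau sigma : V -> V) (x : V) :
  open W1 -> open W2 -> (forall y, W1 y -> W2 (tau y)) ->
  msmooth W1 tau -> msmooth W2 sigma -> W1 x ->
  jac (fun y => sigma (tau y)) x = jac tau x *m jac sigma (tau x).
Proof.
move=> oW1 oW2 tauW s1 s2 Wx; apply/row_matrixP => i; rewrite row_mul.
rewrite !row_jac (derm_comp oW1 oW2 tauW s1 _ s2 Wx).
rewrite (derm_row oW2 _ s2 (tauW x Wx)).
by congr (_ *m _); rewrite -row_jac /basisv -rowE.
Qed.

Lemma jac_eq_on (W : set V) (F1 F2 : V -> V) (x : V) : open W ->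
  (forall y, W y -> F1 y = F2 y) -> W x -> jac F1 x = jac F2 x.
Proof.
move=> oW E Wx; apply/matrixP => i j; rewrite !mxE.
by apply: (eq_on_derive oW _ _ Wx) => y /E ->.
Qed.

(** By the chain rule the differential has a one-sided inverse, and it is
    square. *)
Lemma jac_unit (W1 W2 : set V) (tau sigma : V -> V) (x : V) :
  open W1 -> open W2 -> (forall y, W1 y -> W2 (tau y)) ->
  msmooth W1 tau -> msmooth W2 sigma -> (forall y, W1 y -> sigma (tau y) = y) ->
  W1 x -> jac tau x \in unitmx.
Proof.
move=> oW1 oW2 tauW s1 s2 sK Wx.
have := jac_comp oW1 oW2 tauW s1 s2 Wx.
rewrite (jac_eq_on oW1 sK Wx) jac_id => /esym.
by case/mulmx1_unit.
Qed.

Section Embedding.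
Variables (M1 M2 : manifold R n) (A : set M1) (psi : M1 -> M2).
Hypotheses (oA : open A) (emb : smooth_open_embedding A psi).
Variables (d : chart R n M1) (c : chart R n M2).
Hypotheses (dat : atlas d) (cat : atlas c) (Ac : psi @` A `<=` cdom c).

Definition in_charts (x : V) : V := cmap c (psi (cinv d x)).
Local Notation tau := in_charts.
Local Notation W := (coords d A).

Lemma in_charts_open : open W. Proof. exact: coords_open. Qed.

Lemma in_charts_coords B : psi @` A `<=` B -> forall x, W x -> coords c B (tau x).
Proof.
move=> AB x /coords_inv[dx Ax xE].
by apply: coords_mem; [apply: Ac; exists (cinv d x) | apply: AB; exists (cinv d x)].
Qed.

Lemma in_charts_dom : coords d (A `&` psi @^-1` cdom c) = W.
Proof.
congr (coords d _); apply/seteqP; split=> [q []//|q Aq]; split=> //.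
by apply: Ac; exists q.
Qed.

Lemma in_charts_smooth : smooth_on W tau.
Proof. by have [[_ /(_ d c dat cat)]] := emb; rewrite in_charts_dom. Qed.

Lemma in_charts_unit x : W x -> jac tau x \in unitmx.
Proof.
move=> Wx; have [_ oB [phi [phiK [cphi sphi]]]] := emb.
have oB' : open (psi @` A `&` phi @^-1` cdom d).
  by apply: open_preimage_in => //; exact: cdom_open.
have oW2 : open (coords c (psi @` A `&` phi @^-1` cdom d)) by exact: coords_open.
have tauW y : W y -> coords c (psi @` A `&` phi @^-1` cdom d) (tau y).
  move=> /coords_inv[dy Ay yE]; have By : (psi @` A) (psi (cinv d y)) by exists (cinv d y).
  by apply: coords_mem; [exact: Ac | split=> //=; rewrite phiK].
apply: (jac_unit in_charts_open oW2 tauW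
  (smooth_on_msmooth in_charts_open in_charts_smooth)
  (smooth_on_msmooth oW2 (sphi c d cat dat)) _ Wx) => y /coords_inv[dy Ay yE].
rewrite /in_charts cmapK; last by apply: Ac; exists (cinv d y).
by rewrite phiK.
Qed.

End Embedding.
End Charts.

Section LocalSolutions.
Variables (R : realType) (n : nat).
Local Notation V := 'rV[R]_n.
Local Notation b := (row_fbasis R n).

(** A chart maps [Omega] onto a ball on which the estimates hold and the
    transport equations are solved. The operator is read off these data. *)
Record local_solution (M : manifold R n) (nabla : connection M) (Phi : M -> R)
    (p : M) (Omega : set M) := LocalSolution {
  ls_chart : chart R n M;
  ls_center : V;
  ls_inner : R;
  ls_outer : R;
  ls_form : V -> 'M[R]_n;
  ls_covec : V -> 'cV[R]_n;
  ls_atlas : atlas ls_chart;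
  ls_open : open Omega;
  ls_dom : Omega `<=` cdom ls_chart;
  ls_image : coords ls_chart Omega = ball ls_center ls_outer;
  ls_point : Omega p;
  ls_crit : gradr (fun x => Phi (cinv ls_chart x)) (cmap ls_chart p) = 0;
  ls_inward : inward_field
    (grad_field (gamma nabla ls_chart) (fun x => Phi (cinv ls_chart x)))
    ls_center ls_inner ls_outer;
  ls_transport : transport_sol (gamma nabla ls_chart)
    (fun x => Phi (cinv ls_chart x)) (coords ls_chart Omega) ls_form ls_covec
}.

Definition box_of M nabla Phi p Omega (D : @local_solution M nabla Phi p Omega)
    (f : M -> R[i]) (q : M) : R[i] :=
  let c := ls_chart D in
  let L h := box_real (gamma nabla c) (fun x => Phi (cinv c x)) (ls_form D)
    (ls_covec D) (fun x => h (f (cinv c x))) (cmap c q) in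
  (L (@complex.Re R) +i* L (@complex.Im R))%C.

Section Embedded.
Variables (M1 M2 : manifold R n) (nabla1 : connection M1) (nabla2 : connection M2).
Variables (Phi1 : M1 -> R) (Phi2 : M2 -> R) (p2 : M2).
Variables (Omega1 : set M1) (Omega2 : set M2) (psi : M1 -> M2).
Variable D : local_solution nabla2 Phi2 p2 Omega2.
Hypotheses (oO : open Omega1) (emb : smooth_open_embedding Omega1 psi).
Hypothesis sub : psi @` Omega1 `<=` Omega2.
Hypothesis pres : connection_preserving Omega1 psi nabla1 nabla2.
Hypothesis Phi12 : forall q, Omega1 q -> Phi1 q = Phi2 (psi q).
Variable d : chart R n M1.
Hypothesis dat : atlas d.

Local Notation c := (ls_chart D).
Local Notation tau := (in_charts psi d c).
Local Notation W := (coords d Omega1).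
Local Notation W2 := (coords c Omega2).

Let Oc : psi @` Omega1 `<=` cdom c. Proof. by move=> q /sub /ls_dom. Qed.
Let oW : open W. Proof. exact: coords_open. Qed.
Let oW2 : open W2. Proof. by apply: coords_open; exact: ls_open D. Qed.
Let tauW x : W x -> W2 (tau x). Proof. exact: (in_charts_coords Oc sub). Qed.
Let stau : smooth_on W tau. Proof. exact: (in_charts_smooth emb dat (ls_atlas D) Oc). Qed.
Let tauU x : W x -> jac tau x \in unitmx.
Proof. exact: (in_charts_unit oO emb dat (ls_atlas D) Oc). Qed.
Let tauG : gamma_transform W tau (gamma nabla1 d) (gamma nabla2 c).
Proof. by have := pres dat (ls_atlas D); rewrite (in_charts_dom d Oc). Qed.
Let sG1 i j k : smooth_on W (gamma nabla1 d i j k).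
Proof. by apply: smooth_onS (gamma_smooth nabla1 i j k dat); apply: coordsS => q. Qed.
Let cinv_tau (T : Type) (h : M2 -> T) x : W x -> h (cinv c (tau x)) = h (psi (cinv d x)).
Proof.
move=> /coords_inv[dx Ax xE]; rewrite /in_charts cmapK //.
by apply: Oc; exists (cinv d x).
Qed.

(** Read in charts, an embedding is a change of variables, and
    [transport_sol_pull] applies. *)
Lemma embedded_solution : transport_sol (gamma nabla1 d) (fun x => Phi1 (cinv d x)) W
  (pull_form tau (ls_form D)) (pull_covec tau (ls_covec D)).
Proof.
apply: (transport_sol_pull oW oW2 tauW stau tauU tauG sG1 _ (ls_transport D)) => x Wx.
by rewrite (cinv_tau Phi2 Wx) Phi12 //; case/coords_inv: Wx.
Qed.

Lemma embedded_box (h : M2 -> R) x : smooth_on W2 (fun y => h (cinv c y)) -> W x ->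
  box_real (gamma nabla1 d) (fun y => Phi1 (cinv d y))
    (pull_form tau (ls_form D)) (pull_covec tau (ls_covec D))
    (fun y => h (psi (cinv d y))) x =
  box_real (gamma nabla2 c) (fun y => Phi2 (cinv c y)) (ls_form D) (ls_covec D)
    (fun y => h (cinv c y)) (tau x).
Proof.
move=> sh Wx.
have f12 y : W y -> Phi1 (cinv d y) = Phi2 (cinv c (tau y)).
  by move=> Wy; rewrite (cinv_tau Phi2 Wy) Phi12 //; case/coords_inv: Wy.
rewrite -(box_real_comp oW oW2 tauW stau tauU tauG f12 (ls_transport D) sh Wx).
apply: (box_real_eq_on _ _ _ _ oW _ Wx) => y Wy.
by rewrite (cinv_tau h Wy).
Qed.

End Embedded.

Lemma id_smooth_map (M : manifold R n) (A : set M) : smooth_map A (fun q : M => q).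
Proof.
split=> [q _|c1 c2 a1 a2]; first exact: cvg_id.
by apply: smooth_onS (atlas_smooth a1 a2); apply: coordsS => q [].
Qed.

Lemma id_embedding (M : manifold R n) (A : set M) : open A ->
  smooth_open_embedding A (fun q : M => q).
Proof.
move=> oA; split; [exact: id_smooth_map | by rewrite image_id |].
by exists (fun q => q); split=> //; rewrite image_id; exact: id_smooth_map.
Qed.

Lemma id_preserving (M : manifold R n) (A : set M) (nabla : connection M) :
  connection_preserving A (fun q : M => q) nabla nabla.
Proof.
move=> c1 c2 a1 a2 x u v xA; apply: (gamma_change nabla a1 a2).
by apply: coordsS xA => q [].
Qed.

Lemma sum_complex (I : Type) (s : seq I) (u v : I -> R) :
  \sum_(i <- s) (u i +i* v i)%C = ((\sum_(i <- s) u i) +i* (\sum_(i <- s) v i))%C.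
Proof.
elim: s => [|i s IH]; first by rewrite !big_nil.
by rewrite !big_cons IH.
Qed.

Lemma real_mul_complex (a u v : R) : ((a%:C) * (u +i* v) = (a * u) +i* (a * v))%C.
Proof. by apply/eqP; rewrite eq_complex /= !mul0r subr0 addr0 !eqxx. Qed.

Lemma half_i_mul (u v : R) : 'i / 2 * (u +i* v)%C = (- (v / 2) +i* (u / 2))%C.
Proof.
have n0 : (2 : R[i]) != 0 by rewrite pnatr_eq0.
apply: (mulfI n0); rewrite mulrA (mulrC 2) divfK // -complexiE mulr_natl mulr2n.
by apply/eqP; rewrite eq_complex /=; apply/andP; split; apply/eqP; field.
Qed.

Lemma second_order_real (a : 'I_n -> 'I_n -> R) (e : 'I_n -> R) (f : V -> R[i]) x :
  let L h := \sum_i \sum_j a i j * pder i (pder j h) x + \sum_i e i * pder i h x in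
  second_order_expr (fun i j => (a i j)%:C)%C (fun i => (e i)%:C)%C 0 f x =
  (L (fun y => complex.Re (f y)) +i* L (fun y => complex.Im (f y)))%C.
Proof.
rewrite /second_order_expr mul0r addr0 /=.
under eq_bigr => i _ do under eq_bigr => j _ do rewrite real_mul_complex.
under eq_bigr => i _ do rewrite sum_complex.
under [X in _ + X = _]eq_bigr => i _ do rewrite real_mul_complex.
by rewrite !sum_complex.
Qed.

Lemma csmooth_real (W : set V) (g : V -> R) : open W -> smooth_on W g ->
  csmooth_on W (fun x => (g x)%:C)%C.
Proof. by move=> oW sg; split; [exact: sg | exact: (smooth_on_cst b oW 0)]. Qed.


Section Trigonometric.
Variables (a P k : R) (s : R).

Let affine : is_derive s (1 : R) (fun z : R => a * (z - P)) a.
Proof.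
have H := is_deriveZ a (is_deriveB (is_derive_id s (1 : R)) (is_derive_cst P s (1 : R))).
by apply: is_derive_eq H _; rewrite subr0 /GRing.scale /= mulr1.
Qed.

Lemma is_derive_affine_cos : is_derive s (1 : R) (fun z : R => k * cos (a * (z - P)))
  (- (k * a) * sin (a * (s - P))).
Proof.
have H := is_deriveZ k (@is_derive1_comp _ (@cos R) (fun z : R => a * (z - P)) s _ _ (is_derive_cos (a * (s - P))) affine).
by apply: is_derive_eq H _; rewrite /GRing.scale /=; ring.
Qed.

Lemma is_derive_affine_sin : is_derive s (1 : R) (fun z : R => k * sin (a * (z - P)))
  (k * a * cos (a * (s - P))).
Proof.
have H := is_deriveZ k (@is_derive1_comp _ (@sin R) (fun z : R => a * (z - P)) s _ _ (is_derive_sin (a * (s - P))) affine).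
by apply: is_derive_eq H _; rewrite /GRing.scale /=; ring.
Qed.

End Trigonometric.

Section Time.
Variables (e delta t : R).
Hypothesis t0 : 0 < t.

Let pow : is_derive t (1 : R) (fun s : R => s `^ e) (e * t^-1 * t `^ e).
Proof.
apply: is_derive_eq (is_derive1_powR e t0) _.
rewrite -mulrA; congr (_ * _); rewrite powRD; last by rewrite (gt_eqF t0) implybT.
by rewrite powR_inv1 ?(ltW t0) // mulrC.
Qed.

Let phase : is_derive t (1 : R) (fun s : R => s^-1 * delta) (- (t^-1 * t^-1 * delta)).
Proof.
have t0' : t != 0 by rewrite gt_eqF.
have H := is_deriveM (is_deriveV t0' (is_derive_id t (1 : R))) (is_derive_cst delta t (1 : R)).
apply: is_derive_eq H _; rewrite /GRing.scale /= mulr0 add0r mulr1 expr2 invfM.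
by rewrite mulrN mulrC.
Qed.

Lemma is_derive_time_cos : is_derive t (1 : R) (fun s : R => s `^ e * cos (s^-1 * delta))
  (t `^ e * (e * t^-1 * cos (t^-1 * delta) + t^-1 * (t^-1 * delta) * sin (t^-1 * delta))).
Proof.
have H := is_deriveM pow (@is_derive1_comp _ (@cos R) (fun s : R => s^-1 * delta) t _ _
  (is_derive_cos (t^-1 * delta)) phase).
by apply: is_derive_eq H _; rewrite /GRing.scale /=; ring.
Qed.

Lemma is_derive_time_sin : is_derive t (1 : R) (fun s : R => s `^ e * sin (s^-1 * delta))
  (t `^ e * (e * t^-1 * sin (t^-1 * delta) - t^-1 * (t^-1 * delta) * cos (t^-1 * delta))).
Proof.
have H := is_deriveM pow (@is_derive1_comp _ (@sin R) (fun s : R => s^-1 * delta) t _ _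
  (is_derive_sin (t^-1 * delta)) phase).
by apply: is_derive_eq H _; rewrite /GRing.scale /=; ring.
Qed.

End Time.

Section Properties.
Variables (M : manifold R n) (nabla : connection M) (Phi : M -> R) (p : M).
Variables (Omega : set M) (D : local_solution nabla Phi p Omega).
Local Notation c := (ls_chart D).
Local Notation G := (gamma nabla c).
Local Notation phi := (fun x => Phi (cinv c x)).

Let oW : open (coords c Omega). Proof. by apply: coords_open; exact: ls_open D. Qed.

(** The solution read in an arbitrary chart: the pull-back along the identity. *)
Definition chart_form (d : chart R n M) := pull_form (in_charts id d c) (ls_form D).
Definition chart_covec (d : chart R n M) := pull_covec (in_charts id d c) (ls_covec D).

Let sub : (fun q : M => q) @` Omega `<=` Omega. Proof. by rewrite image_id. Qed.

Lemma chart_solution d : atlas d -> transport_sol (gamma nabla d)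
  (fun x => Phi (cinv d x)) (coords d Omega) (chart_form d) (chart_covec d).
Proof.
move=> dat; have oO := ls_open D.
exact: (embedded_solution D oO (id_embedding oO) sub
  (@id_preserving M Omega nabla) (fun q _ => erefl) dat).
Qed.

Lemma chart_box d (f : M -> R[i]) x : atlas d -> csmooth_fun Omega f -> coords d Omega x ->
  box_of D f (cinv d x) =
  second_order_expr
    (fun i j => (symbol (gamma nabla d) (fun y => Phi (cinv d y)) (chart_form d) x i j)%:C%C)
    (fun k => (box_coef1 (gamma nabla d) (fun y => Phi (cinv d y)) (chart_form d)
       (chart_covec d) k x)%:C%C) 0 (fun y => f (cinv d y)) x.
Proof.
move=> dat sf Wx; have oO := ls_open D.
have box h := embedded_box (D := D) oO (id_embedding oO) sub
  (@id_preserving M Omega nabla) (fun q _ => erefl) dat (h := h) (x := x).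
rewrite second_order_real.
have EB h := box_realE (gamma nabla d) (fun y => Phi (cinv d y)) (chart_form d)
  (chart_covec d) h x.
apply: (etrans _ (congr2 (@complex.Complex R) (EB (fun y => complex.Re (f (cinv d y))))
  (EB (fun y => complex.Im (f (cinv d y)))))).
have [s1 s2] := sf c (ls_atlas D).
rewrite (box (fun q => complex.Re (f q)) s1 Wx) (box (fun q => complex.Im (f q)) s2 Wx).
by rewrite /box_of /in_charts.
Qed.

Lemma box_of_diffop2 : smooth_diffop2 Omega (box_of D).
Proof.
move=> d dat.
have oWd : open (coords d Omega) by apply: coords_open; exact: ls_open D.
have sol := chart_solution dat.
exists (fun i j x => (symbol (gamma nabla d) (fun y => Phi (cinv d y)) (chart_form d) x i j)%:C%C),
  (fun k x => (box_coef1 (gamma nabla d) (fun y => Phi (cinv d y)) (chart_form d)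
     (chart_covec d) k x)%:C%C), (fun _ => 0); split.
- move=> i j; apply: (csmooth_real oWd).
  exact: (msmooth_symbol oWd (ts_chris sol) (ts_fun sol) (ts_hess sol) (ts_form sol)).
- by move=> k; apply: (csmooth_real oWd); exact: smooth_box_coef1.
- by apply: (csmooth_real oWd); exact: (smooth_on_cst b oWd 0).
move=> f x sf Wx; exact: chart_box.
Qed.

Lemma chart_form_change d e x : atlas d -> atlas e -> Omega `<=` cdom e ->
  coords d Omega x ->
  chart_form d x = pull_form (in_charts id d e) (chart_form e) x /\
  chart_covec d x = pull_covec (in_charts id d e) (chart_covec e) x.
Proof.
move=> dat eat Oe Wx; have oO := ls_open D; have emb := id_embedding oO.
have oWd : open (coords d Omega) by exact: coords_open.
have oWe : open (coords e Omega) by exact: coords_open.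
have ime : (fun q : M => q) @` Omega `<=` cdom e by rewrite image_id.
have imc : (fun q : M => q) @` Omega `<=` cdom c by rewrite image_id; exact: ls_dom D.
have E y : coords d Omega y -> in_charts id d c y = in_charts id e c (in_charts id d e y).
  move=> /coords_inv[dy Oy yE]; rewrite /in_charts; congr (cmap c _).
  by rewrite cmapK //; exact: Oe.
have J : jac (in_charts id d c) x =
    jac (in_charts id d e) x *m jac (in_charts id e c) (in_charts id d e x).
  rewrite (jac_eq_on oWd E Wx).
  apply: (jac_comp oWd oWe (in_charts_coords ime sub) _ _ Wx).
    exact: (smooth_on_msmooth oWd (in_charts_smooth emb dat eat ime)).
  exact: (smooth_on_msmooth oWe (in_charts_smooth emb eat (ls_atlas D) imc)).
rewrite /chart_form /chart_covec /pull_form /pull_covec J (E x Wx) trmx_mul !mulmxA.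
by split.
Qed.

(** The time derivative and the operator produce the factors [t ^- 1] and
    [t ^- 2], whose coefficients agree by [box_real_self] and [symbol_self]. *)
Lemma oscillation_equation : evolution_equation Omega Phi p (box_of D).
Proof.
move=> t q t0 Oq.
have cq : cdom c q by exact: (ls_dom D Oq).
have cp : cdom c p by exact: (ls_dom D (ls_point D)).
have Wq : coords c Omega (cmap c q) by exact: coords_mem.
have Bq : ball (ls_center D) (ls_outer D) (cmap c q) by rewrite -(ls_image D).
have Bp : ball (ls_center D) (ls_outer D) (cmap c p).
  by rewrite -(ls_image D); apply: coords_mem => //; exact: ls_point D.
have sol := ls_transport D; rewrite (ls_image D) in sol.
have inw := ls_inward D; have crit := ls_crit D.
have sself := symbol_self inw sol Bp crit Bq.
have bself := box_real_self inw sol Bp crit Bq.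
have sphi : smooth_on (coords c Omega) phi by exact: ts_fun (ls_transport D).
have oscE s y : oscillation Phi p s y = ((s `^ (- (n%:R / 2)) * cos (s^-1 * (Phi y - Phi p)))
    +i* (s `^ (- (n%:R / 2)) * sin (s^-1 * (Phi y - Phi p))))%C.
  by rewrite /oscillation real_mul_complex.
have ReE s y : complex.Re (oscillation Phi p s y) =
  s `^ (- (n%:R / 2)) * cos (s^-1 * (Phi y - Phi p)) by rewrite oscE.
have ImE s y : complex.Im (oscillation Phi p s y) =
  s `^ (- (n%:R / 2)) * sin (s^-1 * (Phi y - Phi p)) by rewrite oscE.
have dRe : derive1 (fun s : R => complex.Re (oscillation Phi p s q) : R) t =
   t `^ (- (n%:R / 2)) * (- (n%:R / 2) * t^-1 * cos (t^-1 * (Phi q - Phi p))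
     + t^-1 * (t^-1 * (Phi q - Phi p)) * sin (t^-1 * (Phi q - Phi p))).
  rewrite (_ : (fun s : R => _) = fun s : R => s `^ (- (n%:R / 2)) * cos (s^-1 * (Phi q - Phi p))).
    rewrite derive1E; by have [_ ->] := is_derive_time_cos (- (n%:R / 2)) (Phi q - Phi p) t0.
  by apply/funext => s; exact: ReE.
have dIm : derive1 (fun s : R => complex.Im (oscillation Phi p s q) : R) t =
   t `^ (- (n%:R / 2)) * (- (n%:R / 2) * t^-1 * sin (t^-1 * (Phi q - Phi p))
     - t^-1 * (t^-1 * (Phi q - Phi p)) * cos (t^-1 * (Phi q - Phi p))).
  rewrite (_ : (fun s : R => _) = fun s : R => s `^ (- (n%:R / 2)) * sin (s^-1 * (Phi q - Phi p))).
    rewrite derive1E; by have [_ ->] := is_derive_time_sin (- (n%:R / 2)) (Phi q - Phi p) t0.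
  by apply/funext => s; exact: ImE.
rewrite /cderive1 dRe dIm.
pose k := t `^ (- (n%:R / 2)).
have lRe : box_real G phi (ls_form D) (ls_covec D)
    (fun x => complex.Re (oscillation Phi p t (cinv c x))) (cmap c q) =
  - (k * t^-1) * sin (t^-1 * (Phi q - Phi p)) * n%:R +
  - (k * t^-1) * t^-1 * cos (t^-1 * (Phi q - Phi p)) * (2 * (Phi q - Phi p)).
  rewrite (_ : (fun x => complex.Re (oscillation _ _ _ _)) = fun x => k * cos (t^-1 * (phi x - Phi p))); last first.
    by apply/funext => x; exact: ReE.
  have := box_real_chain G phi (ls_form D) (ls_covec D) oW sphi Wq
    (fun s => is_derive_affine_cos t^-1 (Phi p) k s)
    (fun s => is_derive_affine_sin t^-1 (Phi p) (- (k * t^-1)) s).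
  by rewrite sself bself !cmapK.
have lIm : box_real G phi (ls_form D) (ls_covec D)
    (fun x => complex.Im (oscillation Phi p t (cinv c x))) (cmap c q) =
  k * t^-1 * cos (t^-1 * (Phi q - Phi p)) * n%:R +
  - (k * t^-1 * t^-1) * sin (t^-1 * (Phi q - Phi p)) * (2 * (Phi q - Phi p)).
  rewrite (_ : (fun x => complex.Im (oscillation _ _ _ _)) = fun x => k * sin (t^-1 * (phi x - Phi p))); last first.
    by apply/funext => x; exact: ImE.
  have := box_real_chain G phi (ls_form D) (ls_covec D) oW sphi Wq
    (fun s => is_derive_affine_sin t^-1 (Phi p) k s)
    (fun s => is_derive_affine_cos t^-1 (Phi p) (k * t^-1) s).
  by rewrite sself bself !cmapK.
rewrite /box_of lRe lIm half_i_mul -/k.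
apply/eqP; rewrite eq_complex /=; apply/andP; split; apply/eqP; field.
  by rewrite gt_eqF.
by rewrite gt_eqF.
Qed.

End Properties.

End LocalSolutions.

(** * Naturality and smooth dependence *)

Section JointCoefficients.
Variables (R : realType) (k n : nat).
Local Notation VV := ('rV[R]_k * 'rV[R]_n)%type.
Local Notation bb := (prod_fbasis (row_fbasis R k) (row_fbasis R n)).
Local Notation chris := ('I_n -> 'I_n -> 'I_n -> 'rV[R]_n -> R).
Variables (G : 'rV[R]_k -> chris) (f : 'rV[R]_k -> 'rV[R]_n -> R) (P : set VV).
Hypotheses (oP : open P).
Hypothesis sG : forall i j l, smooth_on P (fun w => G w.1 i j l w.2).
Hypothesis sf : smooth_on P (fun w => f w.1 w.2).
Hypothesis hf : forall w, P w -> \det (hessm (G w.1) (f w.1) w.2) != 0.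

Lemma joint_coef1 (C : VV -> 'M[R]_n) (B : VV -> 'cV[R]_n) l :
  (forall i j, smooth_on P (fun w => C w i j)) ->
  (forall i j, smooth_on P (fun w => B w i j)) ->
  smooth_on P (fun w => box_coef1 (G w.1) (f w.1) (fun x => C (w.1, x))
    (fun x => B (w.1, x)) l w.2).
Proof.
move=> sC sB; have sI := joint_invhess oP sG sf hf.
have sS := joint_symbol oP sG sf hf sC.
have H : smooth_on P (fun w => (invmx (hessm (G w.1) (f w.1) w.2) *m B w) l 0 -
    \sum_i \sum_j symbol (G w.1) (f w.1) (fun x => C (w.1, x)) w.2 i j * G w.1 i j l w.2).
  apply: (smooth_onB bb oP); first exact: (smooth_on_mulmx bb oP sI sB).
  apply: (smooth_on_sum bb oP) => i; apply: (smooth_on_sum bb oP) => j.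
  exact: (smooth_onM bb oP (sS i j) (sG i j l)).
by apply: (smooth_on_eq oP _ H) => -[s x] _.
Qed.

Lemma csmooth_real_joint (g : VV -> R) : smooth_on P g -> csmooth_on P (fun w => (g w)%:C%C).
Proof. by move=> sg; split; [exact: sg | exact: (smooth_on_cst bb oP 0)]. Qed.

End JointCoefficients.

Section Naturality.
Variables (R : realType) (n : nat).

(** The pull-back of the second solution along [psi] solves the same equations
    as the first solution, on the same ball. *)
Lemma box_of_natural (M1 M2 : manifold R n)
    (nabla1 : connection M1) (nabla2 : connection M2)
    (Phi1 : M1 -> R) (Phi2 : M2 -> R) (p1 : M1) (p2 : M2)
    (Omega1 : set M1) (Omega2 : set M2) (psi : M1 -> M2)
    (D1 : local_solution nabla1 Phi1 p1 Omega1)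
    (D2 : local_solution nabla2 Phi2 p2 Omega2) :
  smooth_open_embedding Omega1 psi -> psi @` Omega1 `<=` Omega2 ->
  connection_preserving Omega1 psi nabla1 nabla2 ->
  (forall q, Omega1 q -> Phi1 q = Phi2 (psi q)) ->
  forall (f : M2 -> R[i]) (q : M1), csmooth_fun Omega2 f -> Omega1 q ->
  box_of D1 (fun y => f (psi y)) q = box_of D2 f (psi q).
Proof.
move=> emb sub pres Phi12 f q sf Oq.
have oO := ls_open D1; have dat := ls_atlas D1.
have sol := embedded_solution D2 oO emb sub pres Phi12 dat.
have cq : cdom (ls_chart D1) q by exact: (ls_dom D1).
have Wq : coords (ls_chart D1) Omega1 (cmap (ls_chart D1) q) by exact: coords_mem.
have [EC EB] : ls_form D1 (cmap (ls_chart D1) q) =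
    pull_form (in_charts psi (ls_chart D1) (ls_chart D2)) (ls_form D2) (cmap (ls_chart D1) q) /\
  ls_covec D1 (cmap (ls_chart D1) q) =
    pull_covec (in_charts psi (ls_chart D1) (ls_chart D2)) (ls_covec D2) (cmap (ls_chart D1) q).
  have := ls_transport D1; move: sol Wq; rewrite (ls_image D1) => sol Wq sol1.
  exact: (transport_sol_unique (ls_inward D1) sol1 sol Wq).
have [s1 s2] := sf _ (ls_atlas D2).
have box h sh := embedded_box (D := D2) oO emb sub pres Phi12 dat (h := h) sh Wq.
rewrite /box_of; congr (complex.Complex _ _).
  apply: (etrans (box_real_pointwise _ _ _ EC EB)).
  by have := box (fun y => complex.Re (f y)) s1; rewrite /in_charts (cmapK cq).
apply: (etrans (box_real_pointwise _ _ _ EC EB)).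
by have := box (fun y => complex.Im (f y)) s2; rewrite /in_charts (cmapK cq).
Qed.

End Naturality.

Section Families.
Variables (R : realType) (n k : nat).
Local Notation V := 'rV[R]_n.
Local Notation VV := ('rV[R]_k * 'rV[R]_n)%type.
Local Notation bb := (prod_fbasis (row_fbasis R k) (row_fbasis R n)).
Variables (M : manifold R n) (S : set 'rV[R]_k).
Variables (nabla : 'rV[R]_k -> connection M) (Phi : 'rV[R]_k -> M -> R).
Variables (p : 'rV[R]_k -> M) (Omega : set M).
Hypotheses (oS : open S) (oO : open Omega).
Hypothesis snabla : smooth_connection_family S Omega nabla.
Hypothesis sPhi : smooth_fun_family S Omega Phi.
Variable D : forall s, option (local_solution (nabla s) (Phi s) (p s) Omega).
Hypothesis DS : forall s, S s -> D s.

Definition family_form d (w : VV) : 'M[R]_n :=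
  if D w.1 is Some Ds then chart_form Ds d w.2 else 0.
Definition family_covec d (w : VV) : 'cV[R]_n :=
  if D w.1 is Some Ds then chart_covec Ds d w.2 else 0.

(** The data [D s] depend on [s] in an arbitrary way, and so may the charts they
    use. But near [s0] the resulting solutions can be compared, by uniqueness, with
    the smooth family that [local_family] builds in the chart of [D s0]. *)
Lemma family_coef_local d s0 x0 : atlas d -> S s0 -> coords d Omega x0 ->
  exists (N : set VV) (C : VV -> 'M[R]_n) (B : VV -> 'cV[R]_n),
  [/\ open N, N (s0, x0), forall i j, smooth_on N (fun w => C w i j),
      forall i j, smooth_on N (fun w => B w i j) &
      forall w, N w -> family_form d w = C w /\ family_covec d w = B w].
Proof.
move=> dat Ss0 Wx0; have := DS Ss0; case ED : (D s0) => [D0|] // _.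
pose c := ls_chart D0; have cat : atlas c by exact: ls_atlas D0.
have Oc : Omega `<=` cdom c by exact: ls_dom D0.
have imc : (fun q : M => q) @` Omega `<=` cdom c by rewrite image_id.
have sub : (fun q : M => q) @` Omega `<=` Omega by rewrite image_id.
have emb := id_embedding oO.
have cO : coords c Omega = ball (ls_center D0) (ls_outer D0) by exact: ls_image D0.
pose tau := in_charts id d c.
have oWd : open (coords d Omega) by exact: coords_open.
have tauW x : coords d Omega x -> ball (ls_center D0) (ls_outer D0) (tau x).
  by move=> Wx; rewrite -cO; exact: (in_charts_coords imc sub Wx).
have stau : msmooth (coords d Omega) tau.
  exact: (smooth_on_msmooth oWd (in_charts_smooth emb dat cat imc)).
have inw := ls_inward D0.
have [r00 r0rho _ _] := inw.
(* The smaller ball must contain the image of [x0]. *)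
have [r [r0r rrho xr]] : exists r, [/\ ls_inner D0 < r, r < ls_outer D0 &
    ball (ls_center D0) r (tau x0)].
  have := tauW x0 Wx0; rewrite -ball_normE /= => h.
  exists ((Num.max (ls_inner D0) `|ls_center D0 - tau x0| + ls_outer D0) / 2).
  have m1 : Num.max (ls_inner D0) `|ls_center D0 - tau x0| < ls_outer D0.
    by rewrite gt_max r0rho h.
  have m2 : ls_inner D0 <= Num.max (ls_inner D0) `|ls_center D0 - tau x0|.
    by rewrite le_max lexx.
  have m3 : `|ls_center D0 - tau x0| <= Num.max (ls_inner D0) `|ls_center D0 - tau x0|.
    by rewrite le_max lexx orbT.
  split; [lra | lra |].
  by apply: (le_lt_trans m3); lra.
have sG i j l : smooth_on (S `*` ball (ls_center D0) (ls_outer D0))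
    (fun w : VV => gamma (nabla w.1) c i j l w.2).
  by rewrite -cO; exact: (snabla i j l cat).
have sf : smooth_on (S `*` ball (ls_center D0) (ls_outer D0))
    (fun w : VV => Phi w.1 (cinv c w.2)).
  by rewrite -cO; exact: (sPhi cat).
have hs0 x : ball (ls_center D0) (ls_outer D0) x ->
    \det (hessm (gamma (nabla s0) c) (fun y => Phi s0 (cinv c y)) x) != 0.
  by rewrite -cO; exact: (ts_hess (ls_transport D0)).
have [dd [C [B [dd0 sC sB H]]]] := @local_family R k n S
  (fun s => gamma (nabla s) c) (fun s x => Phi s (cinv c x)) _ _ _ s0 oS Ss0 sG sf hs0 inw
  r r0r rrho.
pose N2 := coords d Omega `&` tau @^-1` ball (ls_center D0) r.
have oN2 : open N2.
  apply: open_preimage_in => //; last exact: ball_open.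
  move=> x Wx; apply: smooth_on_continuous Wx.
  exact: (in_charts_smooth emb dat cat imc).
pose N : set VV := ball s0 dd `*` N2.
have oN : open N by apply: open_setX => //; exact: ball_open.
have oQ : open (dbox s0 dd (ls_center D0) r) by exact: dbox_open.
have gN w : N w -> dbox s0 dd (ls_center D0) r (w.1, tau w.2).
  by case: w => s x [/= h1 [h2 h3]].
have oB : open (ball s0 dd) by exact: ball_open.
have sndN (g : V -> R) (sg : smooth_on N2 g) : smooth_on N (fun w => g w.2).
  exact: (smooth_on_snd (row_fbasis R k) (row_fbasis R n) oB oN2 sg).
have sg (l : bidx bb) : smooth_on N (fun w : VV => bcoord l ((w.1, tau w.2) : VV)).
  case: l => [a|j] /=.
    exact: (smooth_on_bcoord oN (inl a : bidx bb)).
  by apply: (sndN (fun x => tau x 0 j)); apply: smooth_onS (stau 0 j) => x [].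
have sT i j : smooth_on N (fun w : VV => jac tau w.2 i j).
  apply: (sndN (fun x => jac tau x i j)).
  by apply: smooth_onS (msmooth_jac oWd stau i j) => x [].
have sCt i j : smooth_on N (fun w : VV => C (w.1, tau w.2) i j).
  exact: (smooth_on_comp bb (bW := bb) oN oQ gN sg (sC i j)).
have sBt i j : smooth_on N (fun w : VV => B (w.1, tau w.2) i j).
  exact: (smooth_on_comp bb (bW := bb) oN oQ gN sg (sB i j)).
have sTT i j : smooth_on N (fun w : VV => (jac tau w.2)^T i j).
  by apply: (smooth_on_eq oN _ (sT j i)) => w _; rewrite [RHS]mxE.
exists N, (fun w => jac tau w.2 *m C (w.1, tau w.2) *m (jac tau w.2)^T),
  (fun w => jac tau w.2 *m B (w.1, tau w.2)); split.
- exact: oN.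
- by split; [exact: ballxx | split].
- exact: (smooth_on_mulmx bb oN (smooth_on_mulmx bb oN sT sCt) sTT).
- exact: (smooth_on_mulmx bb oN sT sBt).
case=> s x [/= sd [Wx xB]].
have [Ss inws sols] := H s sd.
rewrite /family_form /family_covec /=; have := DS Ss; case: (D s) => [Ds|] // _.
have [-> ->] := chart_form_change Ds dat cat Oc Wx.
have solc := chart_solution Ds cat.
have solr : transport_sol (gamma (nabla s) c) (fun y => Phi s (cinv c y))
    (ball (ls_center D0) r) (chart_form Ds c) (chart_covec Ds c).
  by apply: transport_solS solc; rewrite cO; apply: le_ball; exact: ltW.
have [EC EB] := transport_sol_unique inws solr sols xB.
by rewrite /pull_form /pull_covec EC EB.
Qed.

Lemma family_diffop2 (L : 'rV[R]_k -> (M -> R[i]) -> (M -> R[i])) :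
  (forall s, S s -> forall Ds, D s = Some Ds -> L s = box_of Ds) ->
  smooth_diffop2_family S Omega L.
Proof.
move=> LE d dat.
have oWd : open (coords d Omega) by exact: coords_open.
have oP : open (S `*` coords d Omega) by exact: open_setX.
have sC i j : smooth_on (S `*` coords d Omega) (fun w => family_form d w i j).
  apply: smooth_on_local => -[s x] [/= Ss Wx].
  have [N [C [B [oN Nx sC _ E]]]] := family_coef_local dat Ss Wx.
  exists N, (fun w => C w i j); split=> // w Nw.
  by have [-> _] := E w Nw.
have sB i j : smooth_on (S `*` coords d Omega) (fun w => family_covec d w i j).
  apply: smooth_on_local => -[s x] [/= Ss Wx].
  have [N [C [B [oN Nx _ sB E]]]] := family_coef_local dat Ss Wx.
  exists N, (fun w => B w i j); split=> // w Nw.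
  by have [_ ->] := E w Nw.
have sG i j l : smooth_on (S `*` coords d Omega) (fun w : VV => gamma (nabla w.1) d i j l w.2).
  exact: snabla.
have sf : smooth_on (S `*` coords d Omega) (fun w : VV => Phi w.1 (cinv d w.2)).
  exact: sPhi.
have hf w : (S `*` coords d Omega) w ->
    \det (hessm (gamma (nabla w.1) d) (fun y => Phi w.1 (cinv d y)) w.2) != 0.
  case: w => s x [/= Ss Wx]; have := DS Ss; case: (D s) => [Ds|] // _.
  exact: (ts_hess (chart_solution Ds dat)).
exists (fun i j w => (symbol (gamma (nabla w.1) d) (fun y => Phi w.1 (cinv d y))
      (fun x => family_form d (w.1, x)) w.2 i j)%:C%C),
  (fun l w => (box_coef1 (gamma (nabla w.1) d) (fun y => Phi w.1 (cinv d y))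
      (fun x => family_form d (w.1, x)) (fun x => family_covec d (w.1, x)) l w.2)%:C%C),
  (fun _ => 0); split.
- move=> i j; apply: (csmooth_real_joint oP).
  exact: (joint_symbol (G := fun s => gamma (nabla s) d) (f := fun s y => Phi s (cinv d y))
    (C := family_form d) oP sG sf hf sC).
- move=> l; apply: (csmooth_real_joint oP).
  exact: (joint_coef1 (G := fun s => gamma (nabla s) d) (f := fun s y => Phi s (cinv d y))
    (C := family_form d) (B := family_covec d) oP sG sf hf l sC sB).
- by apply: (csmooth_real_joint oP); exact: (smooth_on_cst bb oP 0).
move=> s f x Ss smf Wx; have := DS Ss; case E : (D s) => [Ds|] // _.
rewrite (LE s Ss Ds E) (chart_box Ds dat smf Wx) /=.
have EC : (fun y => family_form d (s, y)) = chart_form Ds d.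
  by apply/funext => y; rewrite /family_form /= E.
have EB : (fun y => family_covec d (s, y)) = chart_covec Ds d.
  by apply/funext => y; rewrite /family_covec /= E.
by rewrite EC EB.
Qed.

End Families.

(** * Stability of the estimates under perturbation *)

Lemma row_continuous (R : realType) (n : nat) (T : topologicalType) (X : T -> 'rV[R]_n) w :
  (forall j, {for w, continuous (fun y => X y 0 j)}) -> {for w, continuous X}.
Proof.
move=> H; apply/cvgrPdist_lt => e e0.
have nj : \forall y \near w, forall j, `|X w 0 j - X y 0 j| < e.
  by apply: near_forall => j; exact: (near_dist (H j) e0).
apply: filterS nj => y Hy; apply: row_norm_lt => // j.
by have := Hy j; rewrite !mxE.
Qed.

Section MatrixLimits.
Variables (R : realType) (T : Type) (F : set_system T).
Hypothesis FF : Filter F.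

Lemma real_cvgD (u v : T -> R) (l m : R) : u z @[z --> F] --> l -> v z @[z --> F] --> m ->
  (u z + v z) @[z --> F] --> l + m.
Proof. exact: cvgD. Qed.

Lemma real_cvgB (u v : T -> R) (l m : R) : u z @[z --> F] --> l -> v z @[z --> F] --> m ->
  (u z - v z) @[z --> F] --> l - m.
Proof. exact: cvgB. Qed.

Lemma real_cvgM (u v : T -> R) (l m : R) : u z @[z --> F] --> l -> v z @[z --> F] --> m ->
  (u z * v z) @[z --> F] --> l * m.
Proof. exact: cvgM. Qed.

Lemma cvg_eventually_neq0 (u : T -> R) (l : R) : u z @[z --> F] --> l -> l != 0 ->
  F (fun z => u z != 0).
Proof. by move=> cu l0; exact: (cvgr_neq0 _ cu l0). Qed.

Lemma cvg_eventually_dist (u : T -> R) (l e : R) : u z @[z --> F] --> l -> 0 < e ->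
  F (fun z => `|u z - l| < e).
Proof.
move=> cu e0; have H := cvgr_dist_lt _ _ cu e e0; have {}H := H FF.
by apply: (filterS _ H) => z; rewrite distrC.
Qed.

Lemma eventually_forall (I : finType) (P : I -> T -> Prop) :
  (forall i, F (P i)) -> F (fun z => forall i, P i z).
Proof. exact: filter_forall. Qed.

Lemma cvg_sum_fin (I : Type) (s : seq I) (P : pred I) (u : I -> T -> R) (l : I -> R) :
  (forall i, u i z @[z --> F] --> l i) ->
  (\sum_(i <- s | P i) u i z) @[z --> F] --> \sum_(i <- s | P i) l i.
Proof.
move=> H; elim: s => [|i s IH].
  rewrite big_nil; under eq_fun do rewrite big_nil; exact: cvg_cst.
rewrite big_cons; under eq_fun do rewrite big_cons.
by case: (P i) => //; exact: cvgD.
Qed.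

Lemma cvg_prod_fin (I : Type) (s : seq I) (u : I -> T -> R) (l : I -> R) :
  (forall i, u i z @[z --> F] --> l i) ->
  (\prod_(i <- s) u i z) @[z --> F] --> \prod_(i <- s) l i.
Proof.
move=> H; elim: s => [|i s IH].
  rewrite big_nil; under eq_fun do rewrite big_nil; exact: cvg_cst.
by rewrite big_cons; under eq_fun do rewrite big_cons; exact: cvgM.
Qed.

Definition mcvg m n (A : T -> 'M[R]_(m, n)) (A0 : 'M[R]_(m, n)) :=
  forall i j, A z i j @[z --> F] --> A0 i j.

Lemma mcvg_mul m n q (A : T -> 'M[R]_(m, n)) (B : T -> 'M[R]_(n, q)) A0 B0 :
  mcvg A A0 -> mcvg B B0 -> mcvg (fun z => A z *m B z) (A0 *m B0).
Proof.
move=> cA cB i j; rewrite mxE; under eq_fun do rewrite mxE.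
by apply: cvg_sum_fin => l; exact: cvgM.
Qed.

Lemma mcvg_mx m n (u : 'I_m -> 'I_n -> T -> R) (l : 'I_m -> 'I_n -> R) :
  (forall i j, u i j z @[z --> F] --> l i j) ->
  mcvg (fun z => \matrix_(i, j) u i j z) (\matrix_(i, j) l i j).
Proof. by move=> H i j; rewrite mxE; under eq_fun do rewrite mxE; exact: H. Qed.

Lemma cvg_det n (A : T -> 'M[R]_n) A0 : mcvg A A0 -> \det (A z) @[z --> F] --> \det A0.
Proof.
move=> cA; rewrite /determinant; apply: cvg_sum_fin => s.
by apply: cvgM; [exact: cvg_cst | exact: cvg_prod_fin].
Qed.

Lemma mcvg_inv n (A : T -> 'M[R]_n) A0 : mcvg A A0 -> \det A0 != 0 ->
  mcvg (fun z => invmx (A z)) (invmx A0).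
Proof.
move=> cA d0 i j; have cd := cvg_det cA.
have invE (B : 'M[R]_n) : \det B != 0 -> invmx B i j = (\det B)^-1 * cofactor B j i.
  by move=> dB; rewrite /invmx unitmxE unitfE dB !mxE.
rewrite invE //.
have nz := cvg_eventually_neq0 cd d0.
apply: (@cvg_trans _ ((\det (A z))^-1 * cofactor (A z) j i @[z --> F])).
  by apply: near_eq_cvg; apply: (filterS _ nz) => z dz; rewrite /= invE.
apply: cvgM; first exact: cvgV.
apply: cvgM; first exact: cvg_cst.
by apply: cvg_det => a c; rewrite !mxE; under eq_fun do rewrite !mxE; exact: cA.
Qed.

End MatrixLimits.

Section Jets.
Variables (R : realType) (n : nat).
Local Notation V := 'rV[R]_n.
Local Notation b := (row_fbasis R n).
Local Notation chris := ('I_n -> 'I_n -> 'I_n -> V -> R).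
Implicit Types (G : chris) (f : V -> R) (W : set V) (x : V).

Definition jet_dhess G f x (a : 'I_n) : 'M[R]_n :=
  \matrix_(i, j) (pder a (pder i (pder j f)) x -
    \sum_l (pder a (G i j l) x * pder l f x + G i j l x * pder a (pder l f) x)).

(** The Jacobian of the gradient field as a function of the derivatives of [f]
    and [G] at the point, obtained by differentiating [X H = d f]. *)
Definition jet_jac G f x : 'M[R]_n :=
  (\matrix_(a, j) (pder a (pder j f) x - (grad_field G f x *m jet_dhess G f x a) 0 j))
    *m invmx (hessm G f x).

Lemma jac_jet W G f x : open W -> (forall i j k, smooth_on W (G i j k)) -> smooth_on W f ->
  (forall y, W y -> \det (hessm G f y) != 0) -> W x ->
  jac (grad_field G f) x = jet_jac G f x.
Proof.
move=> oW sG sf hf Wx.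
have uH := hess_unit hf Wx; apply: (can_inj (mulmxK uH)); rewrite /jet_jac mulmxKV //.
have mX := msmooth_grad_field oW sG sf hf; have mH := msmooth_hessm oW sG sf.
apply/row_matrixP => a; rewrite row_mul.
rewrite row_jac; have E := derm_mul (basisv R a) mX mH Wx.
have DH : derm (basisv R a) (hessm G f) x = jet_dhess G f x a.
  apply/matrixP => i j; rewrite [LHS]mxE [RHS]mxE.
  have -> : (fun y => hessm G f y i j) =
      fun y => pder i (pder j f) y - \sum_k G i j k y * pder k f y.
    by apply/funext => y; rewrite mxE.
  have d1 := smooth_on_is_derive (basisv R a)
    (smooth_on_derive (basisv R i) (smooth_on_derive (basisv R j) sf)) Wx.
  have d2 : is_derive x (basisv R a) (fun y => \sum_k G i j k y * pder k f y)
     (\sum_k (G i j k x * pder a (pder k f) x + pder k f x * pder a (G i j k) x)).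
    apply: is_derive_sum_seq => k.
    have e1 := smooth_on_is_derive (basisv R a) (sG i j k) Wx.
    have e2 := smooth_on_is_derive (basisv R a) (smooth_on_derive (basisv R k) sf) Wx.
    exact: is_deriveM.
  have [_ E2] := is_deriveB d1 d2; apply: (etrans E2); congr (_ - _).
  by apply: eq_bigr => k _; rewrite addrC [pder k f x * _]mulrC.
rewrite DH in E.
have EG : derm (basisv R a) (fun y => grad_field G f y *m hessm G f y) x =
    derm (basisv R a) (gradr f) x.
  by apply: (derm_eq oW) => // y Wy; exact: (grad_field_hess hf Wy).
have -> : derm (basisv R a) (grad_field G f) x *m hessm G f x =
    derm (basisv R a) (gradr f) x - grad_field G f x *m jet_dhess G f x a.
  by rewrite -EG E addrK.
apply/rowP => j; rewrite [LHS]mxE [RHS]mxE [RHS]mxE [X in X + _ = _]mxE [X in _ + X = _]mxE.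
congr (_ - _); apply: (congr1 (fun h : V -> R => 'D_(basisv R a) h x)).
by apply/funext => y; rewrite mxE.
Qed.

Lemma hessm_crit G f x : gradr f x = 0 ->
  hessm G f x = \matrix_(i, j) pder i (pder j f) x.
Proof.
move=> g0; apply/matrixP => i j; rewrite !mxE big1 ?subr0 // => k _.
by have := congr1 (fun v : V => v 0 k) g0; rewrite !mxE => ->; rewrite mulr0.
Qed.

Lemma jet_jac_crit G f x : gradr f x = 0 -> \det (hessm G f x) != 0 ->
  jet_jac G f x = 1%:M.
Proof.
move=> g0 d0; rewrite /jet_jac /grad_field g0 mul0mx.
have -> : \matrix_(a, j) (pder a (pder j f) x - ((0 : V) *m jet_dhess G f x a) 0 j) =
    hessm G f x.
  by rewrite (hessm_crit _ g0); apply/matrixP => i j; rewrite [LHS]mxE [RHS]mxE mul0mx [X in _ - X]mxE subr0.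
by rewrite mulmxV // unitmxE unitfE.
Qed.

End Jets.

Section DataFilter.
Variables (R : realType) (n : nat).
Local Notation V := 'rV[R]_n.
Local Notation b := (row_fbasis R n).
Local Notation chris := ('I_n -> 'I_n -> 'I_n -> V -> R).
Variables (G : chris) (f : V -> R) (W : set V) (x0 : V) (r1 : R).
Hypotheses (oW : open W) (r10 : 0 < r1) (KW : cbox x0 r1 `<=` W).
Hypotheses (sG : forall i j k, smooth_on W (G i j k)) (sf : smooth_on W f).
Local Notation K := (cbox x0 r1).
Local Notation data := ((V -> R) * chris * V)%type.

Definition data_close e (f' : V -> R) (G' : chris) :=
  Cr_close 3 e K f f' /\ forall i j k, Cr_close 3 e K (G i j k) (G' i j k).

Definition near_data (e : R) : set data :=
  [set z | data_close e z.1.1 z.1.2 /\ ball x0 e z.2].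

(** Simultaneous convergence of the data to [(f, G)], in [C^3] on a closed ball,
    and of the point to [x0]. The quantities to be controlled are rational
    functions of jets, hence converge along this filter, which gives bounds that
    are uniform in the data and in the point. *)
Definition data_filter : set_system data := filter_from [set e | 0 < e] near_data.

Lemma Cr_closeW (e e' : R) (g g' : V -> R) : e <= e' -> Cr_close 3 e K g g' -> Cr_close 3 e' K g g'.
Proof. by move=> ee H s x hs Kx; exact: lt_le_trans (H s x hs Kx) ee. Qed.

Lemma data_closeW (e e' : R) f' G' : e <= e' -> data_close e f' G' -> data_close e' f' G'.
Proof.
move=> ee [h1 h2]; split; first exact: Cr_closeW h1.
by move=> i j k; exact: Cr_closeW (h2 i j k).
Qed.

Lemma near_dataW (e e' : R) : e <= e' -> near_data e `<=` near_data e'.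
Proof. by move=> ee z [h1 h2]; split; [exact: data_closeW h1 | exact: le_ball h2]. Qed.

Lemma data_filter_filter : Filter data_filter.
Proof.
apply: filter_from_filter; first by exists 1; exact: ltr01.
move=> e e' /= e0 e0'; exists (Num.min e e'); first by rewrite /= lt_min e0.
by move=> z Hz; split; apply: near_dataW Hz; rewrite ge_min lexx ?orbT.
Qed.

Lemma jet_cvg (h : data -> V -> R) (h0 : V -> R) (s : seq 'I_n) : smooth_on W h0 ->
  (forall e z, near_data e z -> Cr_close 3 e K h0 (h z)) -> (size s <= 3)%N ->
  iter_der (map (@basisv R n) s) (h z) z.2 @[z --> data_filter] -->
    iter_der (map (@basisv R n) s) h0 x0.
Proof.
move=> sh Hh hs; have FF := data_filter_filter.
apply/cvgrPdist_lt => e e0.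
have Wx0 : W x0 by apply: KW; rewrite /cbox /= subrr normr0 ltW.
have ch := smooth_on_continuous (smooth_on_iter_der (map (@basisv R n) s) sh) Wx0.
have e2 : 0 < e / 2 by rewrite divr_gt0.
have /nbhs_ballP[d /= d0 Hd] := near_dist ch e2.
exists (Num.min (e / 2) (Num.min d r1)); first by rewrite /= !lt_min e2 d0.
move=> z Hz.
have zd : ball x0 d z.2.
  by case: Hz => _; apply: le_ball; rewrite !ge_min lexx !orbT.
have zK : K z.2.
  by apply: ball_cbox; case: Hz => _; apply: le_ball; rewrite !ge_min lexx !orbT.
have zc := Hh _ _ Hz s z.2 hs zK.
have zc' : `|iter_der (map (@basisv R n) s) h0 z.2 - iter_der (map (@basisv R n) s) (h z) z.2| < e / 2.
  by apply: lt_le_trans zc _; rewrite ge_min lexx.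
have zd' := Hd z.2 zd.
apply: (le_lt_trans (ler_distD (iter_der (map (@basisv R n) s) h0 z.2) _ _)).
by rewrite [ltRHS](splitr e); apply: ltrD.
Qed.

Local Notation "'F'" := data_filter.
Let FF : Filter F := data_filter_filter.

Let jf (s : seq 'I_n) : (size s <= 3)%N ->
  iter_der (map (@basisv R n) s) z.1.1 z.2 @[z --> F] --> iter_der (map (@basisv R n) s) f x0.
Proof. exact: (jet_cvg (h := fun z => z.1.1) sf (fun e z Hz => proj1 (proj1 Hz))). Qed.
Let jg (s : seq 'I_n) i j k : (size s <= 3)%N ->
  iter_der (map (@basisv R n) s) (z.1.2 i j k) z.2 @[z --> F] -->
    iter_der (map (@basisv R n) s) (G i j k) x0.
Proof.
exact: (jet_cvg (h := fun z => z.1.2 i j k) (sG i j k)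
  (fun e z Hz => proj2 (proj1 Hz) i j k)).
Qed.

Let jf1 j : pder j z.1.1 z.2 @[z --> F] --> pder j f x0.
Proof. exact: (jf (s := [:: j]) isT). Qed.
Let jf2 i j : pder i (pder j z.1.1) z.2 @[z --> F] --> pder i (pder j f) x0.
Proof. exact: (jf (s := [:: i; j]) isT). Qed.
Let jf3 a i j : pder a (pder i (pder j z.1.1)) z.2 @[z --> F] -->
  pder a (pder i (pder j f)) x0.
Proof. exact: (jf (s := [:: a; i; j]) isT). Qed.
Let jG i j k : z.1.2 i j k z.2 @[z --> F] --> G i j k x0.
Proof. exact: (@jg [::] i j k isT). Qed.
Let jG1 a i j k : pder a (z.1.2 i j k) z.2 @[z --> F] --> pder a (G i j k) x0.
Proof. exact: (@jg [:: a] i j k isT). Qed.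

Lemma hessm_cvg : mcvg F (fun z => hessm z.1.2 z.1.1 z.2) (hessm G f x0).
Proof.
apply: (mcvg_mx (u := fun i j z => pder i (pder j z.1.1) z.2 -
  \sum_k z.1.2 i j k z.2 * pder k z.1.1 z.2)) => i j.
apply: (real_cvgB FF (@jf2 i j)); apply: (cvg_sum_fin FF) => k.
exact: (real_cvgM FF (@jG i j k) (@jf1 k)).
Qed.

Lemma jet_dhess_cvg a : mcvg F (fun z => jet_dhess z.1.2 z.1.1 z.2 a) (jet_dhess G f x0 a).
Proof.
apply: (mcvg_mx (u := fun i j z => pder a (pder i (pder j z.1.1)) z.2 -
  \sum_l (pder a (z.1.2 i j l) z.2 * pder l z.1.1 z.2 +
    z.1.2 i j l z.2 * pder a (pder l z.1.1) z.2))) => i j.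
apply: (real_cvgB FF (@jf3 a i j)); apply: (cvg_sum_fin FF) => k.
exact: (real_cvgD FF (real_cvgM FF (@jG1 a i j k) (@jf1 k)) (real_cvgM FF (@jG i j k) (@jf2 a k))).
Qed.

Hypothesis hf : \det (hessm G f x0) != 0.

Lemma grad_field_cvg : mcvg F (fun z => grad_field z.1.2 z.1.1 z.2) (grad_field G f x0).
Proof.
apply: (mcvg_mul FF _ (mcvg_inv FF hessm_cvg hf)).
by apply: (mcvg_mx (u := fun _ j z => pder j z.1.1 z.2)).
Qed.

Lemma jet_jac_cvg : mcvg F (fun z => jet_jac z.1.2 z.1.1 z.2) (jet_jac G f x0).
Proof.
apply: (mcvg_mul FF _ (mcvg_inv FF hessm_cvg hf)).
apply: (mcvg_mx (u := fun a j z => pder a (pder j z.1.1) z.2 -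
  (grad_field z.1.2 z.1.1 z.2 *m jet_dhess z.1.2 z.1.1 z.2 a) 0 j)) => i j.
apply: (real_cvgB FF (@jf2 i j)).
have := mcvg_mul FF (@grad_field_cvg) (@jet_dhess_cvg i); exact.
Qed.

Hypothesis crit : gradr f x0 = 0.

(** The radius is chosen first; the tolerance depends on it through the last
    bound. *)
Lemma stable_ball (eta : R) : 0 < eta -> exists r e : R, [/\ 0 < r, r < r1, 0 < e &
  forall f' G', data_close e f' G' ->
   [/\ forall x, ball x0 r x -> \det (hessm G' f' x) != 0,
       forall x i j, ball x0 r x -> `|jet_jac G' f' x i j - (i == j)%:R| < eta &
       `|grad_field G' f' x0| < r / 4]].
Proof.
move=> eta0.
have n1 : F (fun z => \det (hessm z.1.2 z.1.1 z.2) != 0).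
  exact: (cvg_eventually_neq0 FF (cvg_det FF hessm_cvg) hf).
have n2 : F (fun z => forall ij : 'I_n * 'I_n,
    `|jet_jac z.1.2 z.1.1 z.2 ij.1 ij.2 - (ij.1 == ij.2)%:R| < eta).
  apply: (eventually_forall FF) => -[i j] /=.
  have := cvg_eventually_dist FF (@jet_jac_cvg i j) eta0.
  by rewrite (jet_jac_crit crit hf) mxE.
have [e1 /= e10 H1] := @filterI _ F FF _ _ n1 n2.
have [r [rE r0 rr1]] : exists r, [/\ r <= e1, 0 < r & r < r1].
  exists (Num.min e1 r1 / 2).
  have m0 : 0 < Num.min e1 r1 by rewrite lt_min e10.
  have m2 : Num.min e1 r1 / 2 < Num.min e1 r1 by rewrite ltr_pdivrMr // ltr_pMr // ltr1n.
  move: (m2); rewrite lt_min => /andP[h1 h2].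
  by split; rewrite ?(ltW h1) ?divr_gt0.
have r4 : 0 < r / 4 by rewrite divr_gt0.
have n3 : F (fun z => forall j : 'I_n, `|grad_field z.1.2 z.1.1 z.2 0 j| < r / 4).
  apply: (eventually_forall FF) => j.
  have := cvg_eventually_dist FF (@grad_field_cvg 0 j) r4.
  have -> : grad_field G f x0 0 j = 0 by rewrite /grad_field crit mul0mx mxE.
  by apply: (@filterS _ F FF) => z; rewrite subr0.
have [e2 /= e20 H2] := n3.
exists r, (Num.min e1 e2); split; [exact: r0 | exact: rr1 | by rewrite lt_min e10 |].
move=> f' G' close.
have c1 : data_close e1 f' G' by apply: data_closeW close; rewrite ge_min lexx.
have c2 : data_close e2 f' G' by apply: data_closeW close; rewrite ge_min lexx orbT.
have inN x : ball x0 r x -> near_data e1 (f', G', x).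
  by move=> Bx; split=> //; exact: le_ball rE _ Bx.
split.
- by move=> x /inN /H1[].
- by move=> x i j /inN /H1[_ /(_ (i, j))].
- apply: row_norm_lt => // j; apply: (H2 (f', G', x0)); split=> //; exact: ballxx.
Qed.

End DataFilter.

Section FixedPoint.
Variables (R : realType) (n : nat).
Local Notation V := 'rV[R]_n.
Local Notation b := (row_fbasis R n).
Variables (X : V -> V) (x0 : V) (rho : R).
Local Notation W := (ball x0 rho).
Hypotheses (rho0 : 0 < rho) (mX : msmooth W X).
Hypothesis HJ : forall x i j, W x -> `|jac X x i j - (i == j)%:R| < (4 * n.+1%:R)^-1.
Hypothesis HX : `|X x0| < rho / 4.

Let oW : open W. Proof. exact: ball_open. Qed.

Lemma card_weight : n%:R * (4 * n.+1%:R)^-1 < (1 / 4 : R).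
Proof. by rewrite ltr_pdivrMr ?mulr_gt0 // mulrA divfK // mul1r ltr_nat. Qed.

(** For [f] with gradient field [X], [x - X x] is the Newton iteration for a
    critical point of [f]. The assumption on the entries of the Jacobian controls
    its column sums, needed here, and its row sums, needed for the damping. *)
Lemma newton_contraction x y : W x -> W y ->
  `|(x - X x) - (y - X y)| <= 1 / 4 * `|x - y|.
Proof.
move=> Wx Wy; apply: row_norm_le => [|j]; first by rewrite mulr_ge0.
have sh : smooth_on W (fun z => z 0 j - X z 0 j).
  exact: (smooth_onB b oW (smooth_on_bcoord oW (j : bidx b)) (mX 0 j)).
have Wseg (t : R) : 0 <= t <= 1 -> W (t *: (x - y) + y) by exact: ball_segment.
have [t t01] := @mean_value _ _ (fun z : V => z 0 j - X z 0 j) y (x - y)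
  (fun t t01 => smooth_on_derivable sh (Wseg t t01) (v := x - y)).
have t01' : 0 <= t <= 1 by case/andP: t01 => /ltW -> /ltW ->.
rewrite subrK; set z := t *: (x - y) + y => E.
have Wz : W z by exact: Wseg.
have -> : (x - X x - (y - X y)) 0 j = x 0 j - X x 0 j - (y 0 j - X y 0 j).
  by rewrite !mxE.
rewrite E.
have d1 := is_derive_bcoord (b := b) j z (x - y).
have d2 := smooth_on_is_derive (x - y) (mX 0 j) Wz.
have [_ E2] := is_deriveB d1 d2.
have -> : 'D_(x - y) (fun w : V => w 0 j - X w 0 j) z =
    \sum_i (x - y) 0 i * ((i == j)%:R - jac X z i j).
  apply: (etrans E2); rewrite (deriveEcoord b oW _ (mX 0 j) Wz).
  under [RHS]eq_bigr => i _ do rewrite mulrBr.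
  rewrite sumrB; congr (_ - _).
    rewrite (bigD1 j) //= eqxx mulr1 big1 ?addr0 // => i ij.
    by rewrite (negbTE ij) mulr0.
  by apply: eq_bigr => i _; rewrite [X in _ = _ * X]mxE.
apply: (le_trans (ler_norm_sum _ _ _)).
apply: (@le_trans _ _ (\sum_(i < n) `|x - y| * (4 * n.+1%:R)^-1)).
  apply: ler_sum => i _; rewrite normrM; apply: ler_pM => //.
    exact: row_coord_le.
  by rewrite distrC; apply: ltW; exact: HJ.
rewrite sumr_const card_ord -[_ *+ _]mulr_natl mulrCA mulrC.
by apply: ler_wpM2r => //; apply: ltW; exact: card_weight.
Qed.

Lemma newton_inward x : W x -> `|x - X x - x0| < rho / 2.
Proof.
move=> Wx.
have c := newton_contraction (ballxx x0 rho0) Wx.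
apply: (le_lt_trans (ler_distD (x0 - X x0) _ _)).
have -> : x0 - X x0 - x0 = - X x0 by rewrite addrAC subrr add0r.
rewrite normrN.
move: Wx; rewrite -ball_normE /= => h.
move: HX c h; rewrite [`|x - X x - _|]distrC.
move: `|x0 - X x0 - _| `|x0 - x| `|X x0| => a1 a2 a3; lra.
Qed.

Lemma newton_inward_field : inward_field X x0 (rho / 2) rho.
Proof.
split; [by rewrite divr_gt0 | by rewrite ltr_pdivrMr // ltr_pMr // ltr1n | |].
  exact: newton_inward.
move=> x i Wx.
apply: (@le_lt_trans _ _ (\sum_(k < n) (4 * n.+1%:R)^-1)).
  by apply: ler_sum => k _; apply: ltW; exact: HJ.
by rewrite sumr_const card_ord -[_ *+ _]mulr_natl; exact: card_weight.
Qed.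

(** At a minimum of [|X|] on the closed ball, a step of the contraction would
    divide [|X|] by at least 4. *)
Lemma newton_zero : exists2 p, `|p - x0| <= rho / 2 & X p = 0.
Proof.
have r2 : 0 <= rho / 2 by rewrite divr_ge0 // ltW.
have r2r : rho / 2 < rho by rewrite ltr_pdivrMr // ltr_pMr // ltr1n.
have KW : cbox x0 (rho / 2) `<=` W by move=> x; exact: cbox_ball_lt.
have [||p Kp Hp] := @compact_EVT_min _ R (fun w => `|X w|) (cbox x0 (rho / 2)) _
    (@cbox_compact R n x0 (rho / 2) r2).
- by exists x0; rewrite /cbox /= subrr normr0.
- apply: continuous_in_subspaceT => w /set_mem Kw.
  have cX : {for w, continuous X}.
    apply: row_continuous => j.
    exact: (smooth_on_continuous (mX 0 j) (KW _ Kw)).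
  exact: (cvg_norm cX).
have {}Kp := set_mem Kp; exists p; first exact: Kp.
have Wp := KW _ Kp.
have Kg : cbox x0 (rho / 2) (p - X p) by apply: ltW; exact: newton_inward.
have c := newton_contraction Wp (KW _ Kg).
have := Hp _ (mem_set Kg).
have e1 : p - X p - (p - X p - X (p - X p)) = X (p - X p).
  by rewrite opprD addrA subrr add0r opprK.
have e2 : p - (p - X p) = X p by rewrite opprD addrA subrr add0r opprK.
rewrite e1 e2 in c => h.
apply/eqP; rewrite -normr_le0; lra.
Qed.

Lemma newton_zero_unique x y : W x -> W y -> X x = 0 -> X y = 0 -> x = y.
Proof.
move=> Wx Wy x0' y0'; have := newton_contraction Wx Wy; rewrite x0' y0' !subr0 => c.
by apply/eqP; rewrite -subr_eq0 -normr_le0; lra.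
Qed.

End FixedPoint.

(** * Existence near the critical point *)

Section Stability.
Variables (R : realType) (n : nat) (M : manifold R n).
Local Notation V := 'rV[R]_n.
Local Notation b := (row_fbasis R n).

Lemma chart_hessian (A : set M) (nabla : connection M) (Phi : M -> R) c d q :
  open A -> A q -> A `<=` cdom c -> smooth_fun A Phi -> atlas c -> atlas d -> cdom d q ->
  let T := jac (in_charts id d c) (cmap d q) in
  [/\ T \in unitmx,
      gradr (fun x => Phi (cinv d x)) (cmap d q) =
        gradr (fun x => Phi (cinv c x)) (cmap c q) *m T^T &
      hessm (gamma nabla d) (fun x => Phi (cinv d x)) (cmap d q) =
        T *m hessm (gamma nabla c) (fun x => Phi (cinv c x)) (cmap c q) *m T^T].
Proof.
move=> oA Aq Ac sPhi cat dat dq.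
have imc : (fun q : M => q) @` A `<=` cdom c by rewrite image_id.
have sub : (fun q : M => q) @` A `<=` A by rewrite image_id.
have emb := id_embedding oA.
have oW : open (coords d A) by exact: coords_open.
have oW2 : open (coords c A) by exact: coords_open.
have Wq : coords d A (cmap d q) by exact: coords_mem.
have tauW := in_charts_coords (d := d) imc sub.
have stau := in_charts_smooth emb dat cat imc.
have tauq : in_charts id d c (cmap d q) = cmap c q by rewrite /in_charts cmapK.
have f12 x : coords d A x -> Phi (cinv d x) = Phi (cinv c (in_charts id d c x)).
  by move=> /coords_inv[dx Ax xE]; rewrite /in_charts cmapK //; exact: Ac.
have tauG : gamma_transform (coords d A) (in_charts id d c) (gamma nabla d) (gamma nabla c).
  by have := @id_preserving R n M A nabla d c dat cat; rewrite (in_charts_dom d imc).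
have sf := sPhi c cat.
split; first exact: (in_charts_unit oA emb dat cat imc Wq).
  rewrite (gradr_eq_on oW f12 Wq) -tauq.
  exact: (gradr_comp oW oW2 tauW (smooth_on_msmooth oW stau) sf Wq).
rewrite (hessm_eq_on _ oW f12 Wq) -tauq.
exact: (hessm_comp oW oW2 tauW stau tauG sf Wq).
Qed.

Lemma gradr_critical (Phi : M -> R) q c : critical_point Phi q -> atlas c -> cdom c q ->
  gradr (fun x => Phi (cinv c x)) (cmap c q) = 0.
Proof. by move=> H cat cq; apply/rowP => i; rewrite !mxE; exact: H. Qed.

Lemma nondegenerate_of_chart (A : set M) (nabla : connection M) (Phi : M -> R) c q :
  open A -> A q -> A `<=` cdom c -> smooth_fun A Phi -> atlas c ->
  gradr (fun x => Phi (cinv c x)) (cmap c q) = 0 ->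
  \det (hessm (gamma nabla c) (fun x => Phi (cinv c x)) (cmap c q)) != 0 ->
  nondegenerate_critical_point Phi q.
Proof.
move=> oA Aq Ac sPhi cat g0 d0; split=> [d i dat dq|d dat dq].
  have [_ E _] := chart_hessian nabla oA Aq Ac sPhi cat dat dq.
  rewrite g0 mul0mx in E.
  by have := congr1 (fun v : V => v 0 i) E; rewrite !mxE.
have [uT E1 E2] := chart_hessian nabla oA Aq Ac sPhi cat dat dq.
rewrite g0 mul0mx in E1; rewrite (hessm_crit _ E1) in E2.
by rewrite E2 !det_mulmx det_tr !mulf_neq0 // -unitfE -unitmxE.
Qed.

Section AroundPoint.
Variables (nabla : connection M) (U : set M) (Phi : M -> R) (p : M).
Hypotheses (oU : open U) (sPhi : smooth_fun U Phi) (Up : U p).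
Hypothesis nd : nondegenerate_critical_point Phi p.
Variable c : chart R n M.
Hypotheses (cat : atlas c) (cp : cdom c p).

Local Notation x0 := (cmap c p).
Local Notation in_c F := (fun x => F (cinv c x)).

Definition coord_ball (r : R) : set M := cdom c `&` cmap c @^-1` ball x0 r.

Lemma coord_ball_open r : open (coord_ball r).
Proof. by apply: preim_coords_open; exact: ball_open. Qed.

Lemma gamma_smooth_on (nabla' : connection M) (A : set M) i j k :
  smooth_on (coords c A) (gamma nabla' c i j k).
Proof. by apply: smooth_onS (gamma_smooth nabla' i j k cat); exact: coordsS. Qed.

Lemma stable_neighborhood : exists (r1 r e : R),
  [/\ 0 < r1 /\ 0 < r, 0 < e, cbox x0 r1 `<=` coords c U, ball x0 r `<=` coords c U &
   forall (Phi' : M -> R) (nabla' : connection M), smooth_fun U Phi' ->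
     data_close (gamma nabla c) (in_c Phi) x0 r1 e (in_c Phi') (gamma nabla' c) ->
   [/\ forall x, ball x0 r x -> \det (hessm (gamma nabla' c) (in_c Phi') x) != 0,
       msmooth (ball x0 r) (grad_field (gamma nabla' c) (in_c Phi')),
       forall x i j, ball x0 r x ->
         `|jac (grad_field (gamma nabla' c) (in_c Phi')) x i j - (i == j)%:R| <
           (4 * n.+1%:R)^-1 &
       `|grad_field (gamma nabla' c) (in_c Phi') x0| < r / 4]].
Proof.
have oW : open (coords c U) by exact: coords_open.
have Wx0 : coords c U x0 by exact: coords_mem.
have /nbhs_ballP[e0 /= e00 He0] := near_open oW Wx0.
have [r1 r10 r1e] : exists2 r1, 0 < r1 & r1 < e0.
  by exists (e0 / 2); rewrite ?divr_gt0 // ltr_pdivrMr // ltr_pMr // ltr1n.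
have KW : cbox x0 r1 `<=` coords c U by move=> x Kx; apply: He0; exact: cbox_ball_lt Kx.
have crit := gradr_critical (proj1 nd) cat cp.
have hf : \det (hessm (gamma nabla c) (in_c Phi) x0) != 0.
  by rewrite (hessm_crit _ crit); exact: (proj2 nd).
have eta0 : (0 : R) < (4 * n.+1%:R)^-1 by rewrite invr_gt0 mulr_gt0.
have [r [e [r0 rr1 e1 H]]] := stable_ball r10 KW
  (fun i j k => gamma_smooth_on nabla i j k) (sPhi cat) hf crit eta0.
have Br : ball x0 r `<=` coords c U.
  by move=> x Bx; apply: KW; apply: ball_cbox; exact: le_ball (ltW rr1) _ Bx.
exists r1, r, e; split; [by split | exact: e1 | exact: KW | exact: Br |].
move=> Phi' nabla' sPhi' close.
have [h1 h2 h3] := H _ _ close.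
have oB : open (ball x0 r) by exact: ball_open.
have sG' i j k : smooth_on (ball x0 r) (gamma nabla' c i j k).
  exact: (smooth_onS Br (gamma_smooth_on nabla' i j k)).
have sf' : smooth_on (ball x0 r) (in_c Phi') := smooth_onS Br (sPhi' _ cat).
split; [exact: h1 | exact: (msmooth_grad_field oB sG' sf' h1) | | exact: h3].
by move=> x i j Bx; rewrite (jac_jet oB sG' sf' h1 Bx); exact: h2.
Qed.

Section CloseData.
Variables (r : R) (Phi' : M -> R) (nabla' : connection M).
Local Notation X' := (grad_field (gamma nabla' c) (in_c Phi')).
Hypotheses (r0 : 0 < r) (BU : ball x0 r `<=` coords c U) (sPhi' : smooth_fun U Phi').
Hypothesis hdet : forall x, ball x0 r x -> \det (hessm (gamma nabla' c) (in_c Phi') x) != 0.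
Hypothesis mX : msmooth (ball x0 r) X'.
Hypothesis hJ : forall x i j, ball x0 r x ->
  `|jac X' x i j - (i == j)%:R| < (4 * n.+1%:R)^-1.
Hypothesis hX : `|X' x0| < r / 4.

(* The estimates hold at radius [r] and [x - X x] maps that ball into the one of
   radius [r / 2]; [Omega] has an intermediate radius because solutions are
   constructed on strictly smaller balls only. *)
Local Notation Omega := (coord_ball (3 / 4 * r)).

Let inner_lt : r / 2 < 3 / 4 * r. Proof. move: r0; lra. Qed.
Let outer_lt : 3 / 4 * r < r. Proof. move: r0; lra. Qed.
Let sub : ball x0 (3 / 4 * r) `<=` ball x0 r. Proof. by apply: le_ball; exact: ltW. Qed.

Lemma coords_coord_ball : coords c Omega = ball x0 (3 / 4 * r).
Proof.
apply: coords_preim; apply: (subset_trans sub); apply: (subset_trans BU).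
by apply: coordsS => q.
Qed.

Lemma coord_ball_sub : Omega `<=` U.
Proof.
by move=> q [cq /sub /BU /coords_inv[_ + _]]; rewrite cmapK.
Qed.

Lemma close_local_solution q : Omega q -> gradr (in_c Phi') (cmap c q) = 0 ->
  exists _ : local_solution nabla' Phi' q Omega, True.
Proof.
move=> Oq g0; have inw := newton_inward_field r0 mX hJ hX.
have sG' i j k : smooth_on (ball x0 r) (gamma nabla' c i j k).
  exact: smooth_onS BU (gamma_smooth_on nabla' i j k).
have sf' : smooth_on (ball x0 r) (in_c Phi') by exact: smooth_onS BU (sPhi' cat).
have [C [B sol]] := local_existence sG' sf' hdet inw inner_lt outer_lt.
have inw' : inward_field X' x0 (r / 2) (3 / 4 * r).
  have [i1 _ i3 i4] := inw; split=> // [x /sub Bx|x i /sub Bx]; first exact: i3.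
  exact: i4.
rewrite -coords_coord_ball in sol.
unshelve eexists; last by [].
exact: (@LocalSolution R n M nabla' Phi' q Omega c x0 (r / 2) (3 / 4 * r) C B cat
  (@coord_ball_open _) (fun q Oq => proj1 Oq) coords_coord_ball Oq g0 inw' sol).
Qed.

Lemma close_critical_point : exists p', [/\ Omega p',
  nondegenerate_critical_point Phi' p',
  gradr (in_c Phi') (cmap c p') = 0 &
  forall q, Omega q -> critical_point Phi' q -> q = p'].
Proof.
have sG' i j k : smooth_on (ball x0 r) (gamma nabla' c i j k).
  exact: smooth_onS BU (gamma_smooth_on nabla' i j k).
have sf' : smooth_on (ball x0 r) (in_c Phi') by exact: smooth_onS BU (sPhi' cat).
have [y yr Xy] := newton_zero r0 mX hJ hX.
have By : ball x0 (3 / 4 * r) y.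
  by rewrite -ball_normE /= distrC; apply: (le_lt_trans yr).
have Wy : coords c Omega y by rewrite coords_coord_ball.
have [cy Oy yE] := coords_inv Wy.
have gy : gradr (in_c Phi') (cmap c (cinv c y)) = 0.
  rewrite yE -(grad_field_hess hdet (sub By)) Xy mul0mx //.
exists (cinv c y); split=> //.
  apply: (nondegenerate_of_chart (A := Omega) (nabla := nabla') (coord_ball_open _) Oy _ _ cat gy).
  - by move=> q [].
  - by move=> d dat; apply: smooth_onS (sPhi' dat); apply: coordsS; exact: coord_ball_sub.
  - by rewrite yE; apply: hdet; exact: sub.
move=> q [cq Bq] crit; rewrite -(cmapK cq); congr (cinv c _).
apply: (newton_zero_unique mX hJ (sub Bq) (sub By) _ Xy).
by rewrite /grad_field (gradr_critical crit cat cq) mul0mx.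
Qed.

End CloseData.

End AroundPoint.

End Stability.

Section Operator.
Variables (R : realType) (n : nat).

Definition admissible (M : manifold R n) (nabla : connection M) (Phi : M -> R) (p : M)
    (Omega : set M) : Prop := exists _ : local_solution nabla Phi p Omega, True.

(** By [box_of_natural], applied to the identity, the action of the operator on
    smooth functions does not depend on the choice made here. *)
Definition chosen_solution (M : manifold R n) (nabla : connection M) (Phi : M -> R) (p : M)
    (Omega : set M) : option (local_solution nabla Phi p Omega) :=
  match pselect (admissible nabla Phi p Omega) with
  | left h => Some (projT1 (cid h))
  | right _ => None
  end.

Definition box (M : manifold R n) (nabla : connection M) (Phi : M -> R) (p : M)
    (Omega : set M) : (M -> R[i]) -> (M -> R[i]) :=
  if chosen_solution nabla Phi p Omega is Some D then box_of D else fun _ _ => 0.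

Lemma admissible_chosen (M : manifold R n) (nabla : connection M) (Phi : M -> R) (p : M)
    (Omega : set M) : admissible nabla Phi p Omega -> chosen_solution nabla Phi p Omega.
Proof. by rewrite /chosen_solution; case: pselect. Qed.

Lemma boxE (M : manifold R n) (nabla : connection M) (Phi : M -> R) (p : M)
    (Omega : set M) : admissible nabla Phi p Omega ->
  exists D : local_solution nabla Phi p Omega, box nabla Phi p Omega = box_of D.
Proof.
move=> /admissible_chosen; rewrite /box; case: chosen_solution => [D|] // _.
by exists D.
Qed.

Lemma box_persistence (M : manifold R n) (nabla : connection M) (U : set M)
    (Phi : M -> R) (p : M) :
  open U -> smooth_fun U Phi -> U p -> nondegenerate_critical_point Phi p ->
  exists Omega : set M, [/\ open Omega, Omega p, Omega `<=` U,
    admissible nabla Phi p Omega &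
    for_small_perturbations U Phi nabla (fun Phi' nabla' => exists p' : M,
      [/\ Omega p', nondegenerate_critical_point Phi' p',
          forall q, Omega q -> critical_point Phi' q -> q = p' &
          admissible nabla' Phi' p' Omega])].
Proof.
move=> oU sPhi Up nd; have [c cat cp] := atlas_cover p.
have [r1 [r [e [[r10 r0] e0 KU BU H]]]] := stable_neighborhood nabla oU sPhi Up nd cat cp.
(* The given data are close to themselves, so one estimate serves them too. *)
have self : data_close (gamma nabla c) (fun x => Phi (cinv c x)) (cmap c p) r1 e
    (fun x => Phi (cinv c x)) (gamma nabla c).
  by split=> [s x _ _|i j k s x _ _]; rewrite subrr normr0.
have [h1 h2 h3 h4] := H Phi nabla sPhi self.
have Op : coord_ball p c (3 / 4 * r) p.
  by split=> //; apply: ballxx; rewrite mulr_gt0 // divr_gt0.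
exists (coord_ball p c (3 / 4 * r)); split=> //.
- exact: coord_ball_open.
- exact: (coord_ball_sub r0 BU).
- exact: (close_local_solution cat r0 BU sPhi h1 h2 h3 h4 Op (gradr_critical (proj1 nd) cat cp)).
exists 1%N, (fun=> c), (fun=> c), (fun=> cbox (cmap c p) r1), (fun=> cbox (cmap c p) r1),
  3%N, e; split=> //.
- move=> _; split=> //; apply: cbox_compact; exact: ltW.
- move=> _; split=> //; first by apply: cbox_compact; exact: ltW.
  by apply: (subset_trans KU); apply: coordsS => q.
move=> Phi' nabla' sPhi' _ c1 c2.
have close : data_close (gamma nabla c) (fun x => Phi (cinv c x)) (cmap c p) r1 e
    (fun x => Phi' (cinv c x)) (gamma nabla' c).
  by split=> [|i j k]; [exact: (c1 ord0) | exact: (c2 ord0)].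
have [k1 k2 k3 k4] := H Phi' nabla' sPhi' close.
have [p' [Op' nd' g0 uniq]] := close_critical_point cat r0 BU sPhi' k1 k2 k3 k4.
exists p'; split=> //.
exact: (close_local_solution cat r0 BU sPhi' k1 k2 k3 k4 Op' g0).
Qed.

End Operator.

Theorem lemma1 (R : realType) (n : nat) :
  (* box M nabla Phi p Omega is the operator on Omega; admissible singles out
     the data for which the construction of box on Omega is valid *)
  exists (admissible : forall M : manifold R n,
            connection M -> (M -> R) -> M -> set M -> Prop)
         (box : forall M : manifold R n,
            connection M -> (M -> R) -> M -> set M ->
            (M -> R[i]) -> (M -> R[i])),
  [/\ (* box is a smooth second-order operator solving the equation *)
      forall (M : manifold R n) (nabla : connection M) (Phi : M -> R) (p : M)
             (Omega : set M),
        admissible M nabla Phi p Omega ->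
        smooth_diffop2 Omega (box M nabla Phi p Omega) /\
        evolution_equation Omega Phi p (box M nabla Phi p Omega),
      (* existence, and persistence on the same Omega under perturbations *)
      forall (M : manifold R n) (nabla : connection M) (U : set M)
             (Phi : M -> R) (p : M),
        torsion_free nabla -> open U -> smooth_fun U Phi -> U p ->
        nondegenerate_critical_point Phi p ->
        exists Omega : set M,
          [/\ open Omega, Omega p, Omega `<=` U,
              admissible M nabla Phi p Omega &
              for_small_perturbations U Phi nabla (fun Phi' nabla' =>
                exists p' : M,
                  [/\ Omega p', nondegenerate_critical_point Phi' p',
                      forall q, Omega q -> critical_point Phi' q -> q = p' &
                      admissible M nabla' Phi' p' Omega])],
      (* box depends only on Phi and nabla: it commutes with all embeddings
         preserving them *)
      forall (M1 M2 : manifold R n)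
             (nabla1 : connection M1) (nabla2 : connection M2)
             (Phi1 : M1 -> R) (Phi2 : M2 -> R) (p : M1)
             (Omega1 : set M1) (Omega2 : set M2) (psi : M1 -> M2),
        admissible M1 nabla1 Phi1 p Omega1 ->
        admissible M2 nabla2 Phi2 (psi p) Omega2 ->
        smooth_open_embedding Omega1 psi -> psi @` Omega1 `<=` Omega2 ->
        connection_preserving Omega1 psi nabla1 nabla2 ->
        (forall q, Omega1 q -> Phi1 q = Phi2 (psi q)) ->
        forall (f : M2 -> R[i]) (q : M1),
          csmooth_fun Omega2 f -> Omega1 q ->
          box M1 nabla1 Phi1 p Omega1 (fun y => f (psi y)) q =
          box M2 nabla2 Phi2 (psi p) Omega2 f (psi q) &
      (* box varies smoothly with Phi and nabla *)
      forall (M : manifold R n) (k : nat) (S : set 'rV[R]_k)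
             (nabla : 'rV[R]_k -> connection M) (Phi : 'rV[R]_k -> M -> R)
             (p : 'rV[R]_k -> M) (Omega : set M),
        open S -> open Omega ->
        smooth_connection_family S Omega nabla ->
        smooth_fun_family S Omega Phi ->
        (forall s, S s -> admissible M (nabla s) (Phi s) (p s) Omega) ->
        smooth_diffop2_family S Omega
          (fun s => box M (nabla s) (Phi s) (p s) Omega)].
Proof.
exists (@admissible R n), (@box R n); split.
- move=> M nabla Phi p Omega /boxE[D ->].
  by split; [exact: box_of_diffop2 | exact: oscillation_equation].
- move=> M nabla U Phi p _; exact: box_persistence.
- move=> M1 M2 nabla1 nabla2 Phi1 Phi2 p Omega1 Omega2 psi.
  move=> /boxE[D1 ->] /boxE[D2 ->] emb sub pres Phi12 f q sf Oq.
  exact: (box_of_natural D1 D2 emb sub pres Phi12 sf Oq).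
- move=> M k S nabla Phi p Omega oS oO snabla sPhi adm.
  apply: (family_diffop2 oS oO snabla sPhi
    (fun s Ss => admissible_chosen (adm s Ss))) => s Ss D E.
  by rewrite /box E.
Qed.
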